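(* Let $M$ be a generic regular closed curve in $\mathbb{R}^2$ and let $2n>0$ be the number of inflexion points of $M$. If $\#\mathcal{S}_M=2m$ then (i) the number of inflexion points of $\mathrm{SC}(M)$ is equal to $4m-2n$, (ii) the number of inflexion points of every branch of $\mathrm{SC}(M)$ is even, (iii) the number of inflexion points of every branch of $\mathrm{SC}(M)$ passing through the origin is $2$ modulo $4$, (iv) the total number of inflexion points in all branches with the exception of branches passing through the origin is a multiple of $4$.
   Context: A closed regular curve $M$ is the image of a $C^\infty$ immersion $f:S^1\to\mathbb{R}^2$; $f$ is chosen so that $f(0)$ is not an inflexion point. A parallel pair of $M$ is a pair of points $a,b\in M$, $a\neq b$, such that the tangent lines to $M$ at $a$ and $b$ are parallel. The secant caustic is $\mathrm{SC}(M)=\mathrm{cl}\{a-b : a,b \text{ is a parallel pair of } M\}$. A point of $M$ is an inflexion point if the signed curvature changes sign there; an undulation point is a point where the curvature vanishes without changing sign. An inflexion point $f(s_0)$ is non-degenerate if $\det(f'(s_0),f'''(s_0))\neq 0$. $M$ is parameterized in the same direction at $f(s_1)$ and $f(s_2)$ if $f'(s_1)=\alpha f'(s_2)$ with $\alpha>0$. $M$ is generic if: (i) $f$ is regular; (ii) $f$ has only non-degenerate inflexion points and no undulation points; (iii) $f$ has only transversal self-crossings; (iv) if $f(s_1),f(s_2)$ is a parallel pair then at least one of them is not an inflexion point; (v) if $f(s_1),f(s_2)$ with $s_1\neq s_2$ is a parallel pair and, for local arc length parameterizations near $s_1$ and $s_2$ chosen in the same direction, the signed curvatures at $f(s_1)$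 and $f(s_2)$ are equal, then the derivatives of the curvatures with respect to arc length at these points are different. The angle function $\varphi_M:S^1\to[0,\pi]/(0\sim\pi)$ assigns to $s$ the oriented angle between $f'(s)$ and $f'(0)$ modulo $\pi$. A value $\varphi$ is a local extremum of $\varphi_M$ if there is $s$ with $\varphi_M(s)=\varphi$, $\varphi_M'(s)=0$, $\varphi_M''(s)\neq0$; $\mathcal{M}(\varphi_M)$ is the set of local extrema. When $\mathcal{M}(\varphi_M)\neq\emptyset$ (i.e. $M$ has inflexion points), $\mathcal{S}_M=\varphi_M^{-1}(\mathcal{M}(\varphi_M))\subset S^1$, i.e. the set of parameters at which the tangent line is parallel to a tangent line at an inflexion point of $M$. The number of elements of $\mathcal{S}_M$ is even. The (smooth) branches of $\mathrm{SC}(M)$ are the smooth parameterized closed curves obtained by restricting $(s,t)\mapsto f(s)-f(t)$ to the connected components of $\Sigma=\mathrm{cl}\{(s,t)\in S^1\times S^1: s\neq t,\ \det(f'(s),f'(t))=0\}$. Inflexion points of a branch are its regular points at which the curvature of the branch changes sign; they are counted along the parameterized branches (so different passages through the origin are counted separately), and the number of inflexion points of $\mathrm{SC}(M)$ is the total over all branches. *)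

(* Defs.v *)
From HB Require Import structures.
From mathcomp Require Import all_boot all_order all_algebra.
From mathcomp Require Import all_classical all_reals all_analysis.

Set Implicit Arguments.
Unset Strict Implicit.
Unset Printing Implicit Defensive.

Import Order.TTheory GRing.Theory Num.Theory.
Import numFieldNormedType.Exports.

Local Open Scope ring_scope.
Local Open Scope classical_set_scope.

Section PlaneCurves.
Variable R : realType.
Implicit Types (f g : R -> R * R) (s t u : R) (v w : R * R).

Definition det2 v w : R := v.1 * w.2 - v.2 * w.1.

(* The norm `|v| of the product type R * R is the max norm. *)
Definition enorm v : R := Num.sqrt (v.1 ^+ 2 + v.2 ^+ 2).

Definition rotate (a : R) v : R * R :=
  (cos a * v.1 - sin a * v.2, sin a * v.1 + cos a * v.2).

Definition smooth_at f s : Prop := forall n, derivable (f^`(n)) s 1.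

Definition curvature f s : R :=
  det2 (f^`() s) (f^`(2) s) / enorm (f^`() s) ^+ 3.

(* d(curvature)/d(arc length) for a curve with arbitrary regular parameter:
   d/dl = |f'|^-1 d/ds. *)
Definition curvature_darc f s : R :=
  derive1 (curvature f) s / enorm (f^`() s).

Definition changes_sign (k : R -> R) s : Prop :=
  ((\forall u \near s^'-, k u < 0) /\ (\forall u \near s^'+, 0 < k u)) \/
  ((\forall u \near s^'-, 0 < k u) /\ (\forall u \near s^'+, k u < 0)).

(* S^1 is the unit circle of the plane, with parameter [circ s] at angle s;
   a map defined on S^1 is a 2pi-periodic map defined on R. *)
Definition circ s : R * R := (cos s, sin s).

Definition torus (st : R * R) : (R * R) * (R * R) := (circ st.1, circ st.2).

Definition closed_smooth_curve f : Prop :=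
  periodic f (pi *+ 2) /\ forall s, smooth_at f s.

Definition inflexion f s : Prop := changes_sign (curvature f) s.

Definition undulation f s : Prop := curvature f s = 0 /\ ~ inflexion f s.

Definition parallel_pair f s t : Prop :=
  f s <> f t /\ det2 (f^`() s) (f^`() t) = 0.

Definition same_direction f s g t : Prop :=
  exists2 a : R, 0 < a & f^`() s = a *: derive1 g t.

Definition reverse f : R -> R * R := fun u => f (- u).

Definition curvatures_separated f s g t : Prop :=
  same_direction f s g t -> curvature f s = curvature g t ->
  curvature_darc f s <> curvature_darc g t.

(* In the last clause, one of the two hypotheses [same_direction] holds for
   each parallel pair: either f itself runs in the same direction at s and t,
   or f at s and the reversed curve at the same point f t do. *)
Definition generic f : Prop :=
  [/\ forall s, f^`() s <> 0,
      (forall s, inflexion f s -> det2 (f^`() s) (f^`(3) s) <> 0) /\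
      (forall s, ~ undulation f s),
      forall s t, circ s <> circ t -> f s = f t ->
        det2 (f^`() s) (f^`() t) <> 0,
      forall s t, parallel_pair f s t -> ~ (inflexion f s /\ inflexion f t) &
      forall s t, circ s <> circ t -> parallel_pair f s t ->
        curvatures_separated f s f t /\
        curvatures_separated f s (reverse f) (- t)].

(* Inflexion points are counted on S^1, i.e. along the parameterized curve. *)
Definition inflexion_set f : set (R * R) := circ @` [set s | inflexion f s].

(* The value at s of the angle function, as an element of R / pi Z: the set of
   all a such that the tangent direction at s is the tangent direction at 0
   rotated by a. *)
Definition angle_function f s : set R :=
  [set a | exists2 r : R, r != 0 & f^`() s = r *: rotate a (f^`() 0)].

(* The derivatives of the (R / pi Z)-valued angle function are those of a
   continuous local real-valued lift th. *)
Definition angle_local_extrema f : set (set R) :=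
  [set Phi | exists s, angle_function f s = Phi /\
     exists th : R -> R,
       [/\ \forall u \near s, angle_function f u (th u),
           \forall u \near s, {for u, continuous th},
           th^`() s = 0 & th^`(2) s <> 0]].

Definition S_set f : set (R * R) :=
  circ @` [set s | angle_local_extrema f (angle_function f s)].

Definition secant f (st : R * R) : R * R := f st.1 - f st.2.

(* Sigma, as a subset of the torus S^1 x S^1, which is closed in the ambient
   space (R * R) * (R * R). *)
Definition Sigma f : set ((R * R) * (R * R)) :=
  closure (torus @` [set st | circ st.1 <> circ st.2 /\
                              det2 (f^`() st.1) (f^`() st.2) = 0]).

(* A branch of SC(M), given by its domain: a connected component of Sigma. *)
Definition branches f : set (set ((R * R) * (R * R))) :=
  [set connected_component (Sigma f) p | p in Sigma f].

(* Points p of C at which the restriction of [secant f] to C is regular and its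
   curvature changes sign; c is a local regular smooth parameterization of C at
   p, written in the angle coordinates of the torus. *)
Definition branch_inflexions f (C : set ((R * R) * (R * R))) :
    set ((R * R) * (R * R)) :=
  [set p | exists c : R -> R * R,
     [/\ torus (c 0) = p,
         \forall u \near (0 : R), C (torus (c u)) /\ smooth_at c u,
         c^`() 0 <> 0,
         (secant f \o c)^`() 0 <> 0 &
         changes_sign (curvature (secant f \o c)) 0]].

Definition through_origin f : set (set ((R * R) * (R * R))) :=
  [set C | exists2 st, C (torus st) & secant f st = 0].

(* Disjoint sum over the branches in B: the cardinal of this set is the sum of
   the numbers of inflexion points of the members of B. *)
Definition total_inflexions f (B : set (set ((R * R) * (R * R)))) :
    set (set ((R * R) * (R * R)) * ((R * R) * (R * R))) :=
  [set Cp | B Cp.1 /\ branch_inflexions f Cp.1 Cp.2].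

End PlaneCurves.

(* Main.v *)
(* The tangent direction of f lifts to an angle th.  Cut the circle at the
   points whose tangent is parallel to an inflexional tangent: th is strictly
   monotone on each arc, and two arcs starting at parallel points with th
   varying in the same direction have the same th-variation, since otherwise
   one of them would contain a cut point.  Hence Sigma is a finite union of
   arcs which meet only at pairs of cut points.  A dart is such an arc with a
   chosen end; one involution passes to the other end of the arc, another one to
   the other dart at the same point, and the components of Sigma are the orbits
   of these two involutions.

   At a parallel pair (s, t) the secant map moves along the common tangent
   direction, so the curvature of a branch has the sign of the derivative of
   th (s u), and the inflexions of the branch are the points where s or t is an
   inflexion.  There the involution fixing the point keeps the label (th grows
   or decreases away from the point), elsewhere it changes it, as the other
   involution always does.  So a component has as many upper as lower folds,
   which gives the parity; off the diagonal, the swap (s, t) -> (t, s) gives one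
   more factor 2.  A component through the origin meets the diagonal, and
   composing the second involution with the swap turns it into a path whose two
   end points are the diagonal points of the component; an orientation argument
   shows that one of them is an upper fold and the other one a lower fold. *)

(* Writing f' = r (cos th, sin th) with r of any sign is harmless, as parallelism sees th only
   modulo pi. Genericity says that th' has only simple zeros, exactly at the inflexions, and that
   distinct inflexions are never parallel. As there are at least two, no arc turns by pi or more, so
   interior points of one arc are never parallel to each other.

   The total in (i) is inclusion-exclusion: 2m parallel pairs have an inflexion on the left, 2m on
   the right, and 2n diagonal pairs are counted twice.

   In (iii) the sign [dart_eps] alternates along the path except at its ends, where it determines
   the label. One involution exchanges the signs everywhere, so the fixed points of the other are
   shared equally between them; there are at most two, hence one of each kind.

   The analytic obstacle is that an inflexion of a branch requires a smooth regular parameterization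
   of Sigma. Off the diagonal an inverse of th gives it; on the diagonal the equation th s = th t is
   singular, and the Morse form th (x + g u) = th x + e u^2 gives the branch (x + g u, x + g (-
   u)). *)
Require Import Defs.
From HB Require Import structures.
From mathcomp Require Import all_boot zify.

Set Implicit Arguments.
Unset Strict Implicit.
Unset Printing Implicit Defensive.

(** * Involutions and darts *)

Section Involutions.
Variable T : finType.
Implicit Types (X A B : {set T}) (f : T -> T) (p : pred T).

Lemma leq_card_maps f A B : {in A &, injective f} -> {in A, forall x, f x \in B} ->
  #|A| <= #|B|.
Proof.
move=> finj fAB; rewrite -(card_in_imset finj) subset_leq_card//.
by apply/subsetP => _ /imsetP[x xA ->]; exact: fAB.
Qed.

Lemma card_swap f A p : involutive f -> {in A, forall x, f x \in A} ->
  {in A, forall x, p (f x) = ~~ p x} ->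
  #|[set x in A | p x]| = #|[set x in A | ~~ p x]|.
Proof.
move=> fK fA fp; apply/eqP; rewrite eqn_leq; apply/andP; split;
  apply: (@leq_card_maps f); try by move=> x y _ _ /(can_inj fK).
- by move=> x; rewrite !inE => /andP[xA px]; rewrite fA// fp// px.
- by move=> x; rewrite !inE => /andP[xA px]; rewrite fA// fp.
Qed.

Lemma card_split A p :
  #|A| = #|[set x in A | p x]| + #|[set x in A | ~~ p x]|.
Proof.
rewrite -(cardsID [set x | p x] A); congr (_ + _); apply: eq_card => x;
  by rewrite !inE /= ?[(x \in A) && _]andbC.
Qed.

Lemma card_half f A p : involutive f -> {in A, forall x, f x \in A} ->
  {in A, forall x, p (f x) = ~~ p x} -> #|A| = 2 * #|[set x in A | p x]|.
Proof. by move=> fK fA fp; rewrite (card_split A p) -(card_swap fK)// mul2n addnn. Qed.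

(** [al] exchanges the two labels on [X], so they are equally frequent. Where [be] changes the
    label, [be] itself exchanges them; removing these elements leaves a balance among those whose
    label [be] keeps. *)
Lemma card_balance (al be : T -> T) X p : involutive al -> involutive be ->
  {in X, forall x, al x \in X} -> {in X, forall x, be x \in X} ->
  {in X, forall x, p (al x) = ~~ p x} ->
  #|[set x in X | (p (be x) == p x) && p x]| =
  #|[set x in X | (p (be x) == p x) && ~~ p x]|.
Proof.
move=> alK beK Xal Xbe pal.
have e1 := card_swap alK Xal pal.
pose Y := [set x in X | p (be x) != p x].
have YX x : x \in Y -> x \in X by rewrite inE => /andP[].
have e2 : #|[set x in Y | p x]| = #|[set x in Y | ~~ p x]|.
  apply: (card_swap beK) => x; rewrite !inE => /andP[xX].
    by rewrite Xbe// beK eq_sym.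
  by case: (p (be x)) (p x) => -[].
have s (q : pred T) : #|[set x in X | q x]| =
    #|[set x in X | (p (be x) == p x) && q x]| + #|[set x in Y | q x]|.
  rewrite (card_split _ (fun x => p (be x) == p x)); congr (_ + _);
    apply: eq_card => x; rewrite !inE -?andbA; congr (_ && _).
    by rewrite andbC.
  by rewrite andbC.
by have := e1; rewrite (s p) (s (fun x => ~~ p x)) e2 => /addIn.
Qed.

End Involutions.

(** * Orbits of two involutions through a fixed point of one of them *)

Section DihedralOrbit.
Variables (T : finType) (al be : T -> T).
Hypotheses (alK : involutive al) (beK : involutive be).
Variable d0 : T.
Hypothesis be_d0 : be d0 = d0.

Let rho x := be (al x).

Let rho_inj : injective rho.
Proof. by apply: inj_comp; [exact: (can_inj beK)|exact: (can_inj alK)]. Qed.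

(** Iterates of [rho] alone are enough: [be] conjugates [rho] to its inverse and fixes [d0], so the
    orbit is a cycle on which [be] acts as a reflection. *)
Definition dihedral_orbit : {set T} := [set x | fconnect rho d0 x].

Let rho_be x : rho (be (rho x)) = be x.
Proof. by rewrite /rho beK alK. Qed.

Let iter_rho_be i : iter i rho (be (iter i rho d0)) = d0.
Proof. by elim: i => //= i IH; rewrite -iterS iterSr rho_be. Qed.

Lemma dihedral_orbit_be x : x \in dihedral_orbit -> be x \in dihedral_orbit.
Proof.
rewrite !inE => /iter_findex; set i := findex _ _ _ => xE.
rewrite fconnect_sym// -[X in fconnect _ _ X](iter_rho_be i) xE.
exact: fconnect_iter.
Qed.

Lemma dihedral_orbit_rho x : x \in dihedral_orbit -> rho x \in dihedral_orbit.
Proof. by rewrite !inE => /connect_trans; apply; exact: fconnect1. Qed.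

Lemma dihedral_orbit_al x : x \in dihedral_orbit -> al x \in dihedral_orbit.
Proof. by move=> /dihedral_orbit_rho/dihedral_orbit_be; rewrite /rho beK. Qed.

Lemma dihedral_orbit_d0 : d0 \in dihedral_orbit.
Proof. by rewrite inE connect0. Qed.

Lemma dihedral_orbit_ind (P : T -> Prop) : P d0 ->
  (forall x, P x -> P (be (al x))) -> forall x, x \in dihedral_orbit -> P x.
Proof.
move=> P0 PS x; rewrite inE => /iter_findex <-.
by elim: (findex _ _ _) => //= i; exact: PS.
Qed.

(* If rho ^ i d0 is fixed by be then it equals rho ^ (- i) d0. *)
Lemma dihedral_orbit_fixed : #|[set x in dihedral_orbit | be x == x]| <= 2.
Proof.
have sub : [set x in dihedral_orbit | be x == x] \subset
    [set d0; iter (order rho d0)./2 rho d0].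
  apply/subsetP => x; rewrite !inE => /andP[d0x /eqP bex].
  have iL := findex_max d0x; have xE := iter_findex d0x.
  set i := findex _ _ _ in iL xE; set L := order rho d0 in iL *.
  have it2 : iter (i + i) rho d0 = d0.
    by rewrite iterD xE -bex -xE iter_rho_be.
  have dvd : (i + i) %% L = 0.
    rewrite -(@findex_iter _ rho d0 ((i + i) %% L)) ?ltn_pmod ?order_gt0//.
    rewrite -(@findex0 _ rho d0); congr (findex _ _ _).
    rewrite -[RHS]it2 [in RHS](divn_eq (i + i) L) addnC iterD; congr (iter _ _ _).
    by elim: (_ %/ _) => // j IH; rewrite mulSn iterD -IH iter_order.
  have [i0|i_gt0] := posnP i; first by rewrite -xE i0 eqxx.
  (* [L] divides [2 i] with [0 < i < L], so [2 i = L]: besides [d0] the reflection can only fix the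
     antipodal element of the cycle. *)
  have -> : L./2 = i.
    have : L %| i + i by rewrite /dvdn dvd.
    move=> /dvdnP[[|[|q]]]; lia.
  by rewrite xE eqxx orbT.
by rewrite (leq_trans (subset_leq_card sub))// cards2; case: (_ != _).
Qed.

(** [card_balance] makes the fixed points of [be] with and without [p] equinumerous; [d0] is one and
    there are at most two, hence one of each kind. *)
Lemma dihedral_orbit_unique_fixed (p : pred T) :
  {in dihedral_orbit, forall x, p (al x) = ~~ p x} ->
  {in dihedral_orbit, forall x, (p (be x) == p x) = (be x == x)} ->
  exists x, [set x in dihedral_orbit | (be x == x) && p x] = [set x].
Proof.
move=> pal pbe; apply/cards1P.
have := card_balance alK beK dihedral_orbit_al dihedral_orbit_be pal.
have eqs (q : pred T) : [set x in dihedral_orbit | (p (be x) == p x) && q x] =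
    [set x in dihedral_orbit | (be x == x) && q x].
  apply/setP => x; rewrite !inE; have [xP|//] := boolP (fconnect _ _ _).
  by rewrite pbe// inE.
rewrite (eqs p) (eqs (fun x => ~~ p x)) => e.
have := dihedral_orbit_fixed; rewrite (card_split _ p).
have eq2 (q : pred T) : #|[set x in [set x in dihedral_orbit | be x == x] | q x]| =
    #|[set x in dihedral_orbit | (be x == x) && q x]|.
  by apply: eq_card => x; rewrite !inE andbA.
rewrite (eq2 p) (eq2 (fun x => ~~ p x)) -e.
have : 0 < #|[set x in dihedral_orbit | be x == x]|.
  by apply/card_gt0P; exists d0; rewrite inE dihedral_orbit_d0 be_d0 eqxx.
rewrite (card_split _ p) (eq2 p) (eq2 (fun x => ~~ p x)) -e; lia.
Qed.

End DihedralOrbit.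

(* A germ is an arc of the circle with a chosen end: [al] goes to the other end,
   [ga] to the other arc at the same end point, [up h] says that the angle grows
   when one moves away from the end, [side h] that the end is the right one. *)
Section Darts.
Variables (H : finType) (al ga : H -> H) (up side : pred H) (par : rel H).
Hypotheses (alK : involutive al) (gaK : involutive ga).
Hypotheses (side_al : forall h, side (al h) = ~~ side h)
           (side_ga : forall h, side (ga h) = ~~ side h)
           (up_al : forall h, up (al h) = ~~ up h).
Hypotheses (par_sym : symmetric par) (par_trans : transitive par)
           (par_ga : forall h, par h (ga h))
           (par_al : forall h k, par h k -> up h = up k -> par (al h) (al k)).

(** The angle moves the same way on both sides of the end point, so it has a local extremum there:
    folds stand for the inflexion points of the curve. *)
Definition fold h := up (ga h) == up h.

(** The combinatorial trace of genericity: parallel inflexions are one point of the circle, seen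
    from either side. *)
Hypothesis fold_unique : forall h k, fold h -> fold k -> par h k ->
  k = h \/ k = ga h.

Implicit Types (d : H * H) (X : {set H * H}).

(** Equal labels let the two germs be followed simultaneously with parallel tangents. Excluding
    equal germs discards the diagonal of the torus, whose pairs are always parallel but which meets
    Sigma only at inflexions. *)
Definition is_dart d := [&& par d.1 d.2, up d.1 == up d.2 & d.1 != d.2].
Definition darts : {set H * H} := [set d | is_dart d].
Definition dart_al d : H * H := (al d.1, al d.2).
Definition dart_sw d : H * H := (d.2, d.1).
(* The other dart at the same point of Sigma: both germs are continued through
   the point, except that a germ is not continued when only the other one is
   at a fold. *)
Definition dart_be d : H * H :=
  (if fold d.2 ==> fold d.1 then ga d.1 else d.1,
   if fold d.1 ==> fold d.2 then ga d.2 else d.2).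
Definition dart_fold d := fold d.1 || fold d.2.
Definition dart_up d := up d.1.
(* The sign of [th' (d.1) * th' (d.2)], times the sign of the end: [dart_al] and
   [dart_be] change it, except [dart_be] on the diagonal. *)
Definition dart_eps d := side d.1 (+) side d.2 (+) up d.1.
(* Exactly one of the two darts at a fold point is marked. *)
Definition dart_mark d := if fold d.1 then side d.1 else side d.2.
Definition nfolds X := #|[set d in X | dart_fold d && dart_mark d]|.
Definition dart_diag d := ga d.1 == d.2.

Lemma fold_ga h : fold (ga h) = fold h.
Proof. by rewrite /fold gaK eq_sym. Qed.

Lemma up_ga h : up (ga h) = if fold h then up h else ~~ up h.
Proof. by rewrite /fold; case: (up (ga h)) (up h) => -[]. Qed.

Lemma dart_alK : involutive dart_al.
Proof. by move=> [h k]; rewrite /dart_al /= !alK. Qed.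

Lemma dart_swK : involutive dart_sw.
Proof. by case. Qed.

Lemma dart_beK : involutive dart_be.
Proof.
move=> [h k]; rewrite /dart_be /=.
have f1 (c : bool) x : fold (if c then ga x else x) = fold x.
  by case: c; rewrite ?fold_ga.
by rewrite !f1; case: (_ ==> _); case: (_ ==> _); rewrite ?gaK.
Qed.

Lemma dart_sw_al d : dart_sw (dart_al d) = dart_al (dart_sw d).
Proof. by []. Qed.

Lemma dart_sw_be d : dart_sw (dart_be d) = dart_be (dart_sw d).
Proof. by []. Qed.

Lemma dart_folds d : d \in darts -> fold d.1 && fold d.2 -> d.2 = ga d.1.
Proof.
rewrite inE => /and3P[par12 _ d12] /andP[f1 f2].
by have [e|//] := fold_unique f1 f2 par12; rewrite e eqxx in d12.
Qed.

Lemma dart_diag_folds d : d \in darts -> dart_diag d = fold d.1 && fold d.2.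
Proof.
move=> dD; apply/idP/idP => [/eqP e|/(dart_folds dD) e]; last by rewrite /dart_diag e.
rewrite -e fold_ga andbb.
by move: dD; rewrite inE /fold e => /and3P[_ /eqP -> _].
Qed.

Lemma dart_al_in d : d \in darts -> dart_al d \in darts.
Proof.
rewrite !inE /= => /and3P[p /eqP u n]; apply/and3P; split => /=.
- exact: par_al.
- by rewrite !up_al u.
- by rewrite (can_eq alK).
Qed.

Lemma dart_sw_in d : d \in darts -> dart_sw d \in darts.
Proof.
by rewrite !inE /is_dart /= => /and3P[p /eqP u n]; rewrite par_sym p u eqxx eq_sym.
Qed.

Lemma par_if_ga (c : bool) h k : par h k -> par (if c then ga h else h) k.
Proof. by case: c => // p; apply: par_trans p; rewrite par_sym. Qed.

Lemma dart_be_in d : d \in darts -> dart_be d \in darts.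
Proof.
move=> dD; move: (dD); rewrite !inE /is_dart => /and3P[p /eqP u n].
rewrite par_if_ga ?(par_sym _ (if _ then _ else _)) ?par_if_ga ?(par_sym d.2)//=.
have f12 := dart_folds dD.
move: f12; have [f1|f1] := boolP (fold d.1); have [f2|f2] := boolP (fold d.2) => /= f12.
- by rewrite !up_ga f1 f2 u eqxx (inj_eq (inv_inj gaK)).
(* Equal germs would be folds together, whereas here exactly one of the two is. *)
- rewrite up_ga f1 u eqxx /=; apply/negP => /eqP e.
  by move: f2; rewrite -e fold_ga f1.
- rewrite up_ga f2 u eqxx /=; apply/negP => /eqP e.
  by move: f1; rewrite e fold_ga f2.
- by rewrite !up_ga (negbTE f1) (negbTE f2) u eqxx (inj_eq (inv_inj gaK)).
Qed.

Lemma dart_up_al d : dart_up (dart_al d) = ~~ dart_up d.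
Proof. exact: up_al. Qed.

Lemma dart_fold_be d : dart_fold (dart_be d) = dart_fold d.
Proof. by rewrite /dart_fold /dart_be /=; do 2 case: ifP => _; rewrite ?fold_ga. Qed.

(** At a fold the first germ either stays or passes to a germ with the same label; elsewhere it
    passes an ordinary point, where growth away from it on one side means decrease on the other. *)
Lemma dart_up_be d : d \in darts -> (dart_up (dart_be d) == dart_up d) = dart_fold d.
Proof.
move=> dD; rewrite /dart_up /dart_be /dart_fold /=.
have [f1|f1] := boolP (fold d.1); have [f2|f2] := boolP (fold d.2) => //=;
  rewrite ?up_ga ?f1 ?(negbTE f1) ?eqxx //.
by case: (up d.1).
Qed.

Lemma dart_eps_al d : dart_eps (dart_al d) = ~~ dart_eps d.
Proof.
rewrite /dart_eps /= !side_al up_al.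
by case: (side d.1) (side d.2) (up d.1) => -[] [].
Qed.

Lemma dart_eps_sw d : d \in darts -> dart_eps (dart_sw d) = dart_eps d.
Proof. by rewrite inE => /and3P[_ /eqP u _]; rewrite /dart_eps /= u [side d.2 (+) _]addbC. Qed.

Lemma dart_up_sw d : d \in darts -> dart_up (dart_sw d) = dart_up d.
Proof. by rewrite inE => /and3P[_ /eqP u _]; rewrite /dart_up /= u. Qed.

(** At a single fold only one side flips and the label stays; with no fold both sides flip and so
    does the label. Only when both germs fold, that is on the diagonal, do two flipped sides meet an
    unchanged label. *)
Lemma dart_eps_be d : d \in darts ->
  (dart_eps (dart_be d) == dart_eps d) = dart_diag d.
Proof.
move=> dD; rewrite dart_diag_folds// /dart_eps /dart_be /=.
have [f1|f1] := boolP (fold d.1); have [f2|f2] := boolP (fold d.2) => //=;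
  rewrite ?side_ga ?up_ga ?f1 ?(negbTE f1) ?eqxx //;
  by case: (side d.1) (side d.2) (up d.1) => -[] [].
Qed.

Lemma dart_diag_eps d : dart_diag d -> dart_eps d = ~~ dart_up d.
Proof. by move=> /eqP e; rewrite /dart_eps -e side_ga /dart_up; case: (side _) (up _) => -[]. Qed.

(** Swap composed with [dart_be] is thus an involution whose fixed darts are the diagonal ones, as
    the dihedral argument requires. *)
Lemma dart_diag_be d : d \in darts -> dart_diag d = (dart_be d == dart_sw d).
Proof.
move=> dD; apply/idP/eqP => [dd|].
  move: (dd); rewrite dart_diag_folds// /dart_be => /andP[-> ->] /=.
  by rewrite /dart_sw -(eqP dd) gaK.
rewrite /dart_be /dart_sw => -[e _]; move: dD e; rewrite inE => /and3P[_ _ /eqP n].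
by case: ifP => _ e; [rewrite /dart_diag e|case: n].
Qed.

Lemma dart_mark_be d : d \in darts -> dart_fold d ->
  dart_mark (dart_be d) = ~~ dart_mark d.
Proof.
move=> dD; rewrite /dart_mark /dart_be /dart_fold /=.
have [f1|f1] := boolP (fold d.1); have [f2|f2] := boolP (fold d.2) => //= _;
  by rewrite ?fold_ga ?f1 ?(negbTE f1) ?side_ga.
Qed.

Lemma dart_mark_sw d : d \in darts -> dart_fold d -> ~~ dart_diag d ->
  dart_mark (dart_sw d) = dart_mark d.
Proof.
move=> dD; rewrite dart_diag_folds// /dart_mark /dart_fold /=.
by case: (fold d.1); case: (fold d.2).
Qed.

(** * Fold points in a set of darts stable under both involutions *)

Section Stable.
Variable X : {set H * H}.
Hypotheses (XD : {subset X <= darts}) (Xal : {in X, forall d, dart_al d \in X})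
           (Xbe : {in X, forall d, dart_be d \in X}).

(** A fold point carries two darts, one of them marked, so fold points are half as many as fold
    darts. By [card_balance] the upper fold darts are half of them too. *)
Lemma nfoldsE : nfolds X = #|[set d in X | dart_fold d && dart_up d]|.
Proof.
have e := card_balance dart_alK dart_beK Xal Xbe (fun d _ => dart_up_al d).
have eqs (q : pred (H * H)) :
    #|[set d in X | (dart_up (dart_be d) == dart_up d) && q d]| =
    #|[set d in [set d in X | dart_fold d] | q d]|.
  apply: eq_card => d; rewrite !inE -andbA; have [dX|//] := boolP (d \in X).
  by rewrite dart_up_be// XD.
rewrite (eqs dart_up) (eqs (fun d => ~~ dart_up d)) in e.
have := @card_half _ dart_be [set d in X | dart_fold d] dart_mark dart_beK.
rewrite (card_split _ dart_up) -e.
have eq2 (q : pred (H * H)) : #|[set d in [set d in X | dart_fold d] | q d]| =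
    #|[set d in X | dart_fold d && q d]|.
  by apply: eq_card => d; rewrite !inE andbA.
rewrite !eq2 addnn -mul2n -/(nfolds X) => e2; apply/eqP.
rewrite -(eqn_pmul2l (isT : 0 < 2)) e2// => d; rewrite !inE => /andP[dX df].
  by rewrite Xbe// dart_fold_be.
by rewrite dart_mark_be// XD.
Qed.

(** [dart_be] pairs the upper fold darts without fixed points, since it changes the mark. *)
Lemma nfolds_even : ~~ odd (nfolds X).
Proof.
rewrite nfoldsE (@card_half _ dart_be _ dart_mark) ?oddM//; first exact: dart_beK.
- move=> d; rewrite !inE => /and3P[dX df du]; rewrite Xbe// dart_fold_be df /=.
  by have := dart_up_be (XD dX); rewrite df du => /eqP ->.
- by move=> d; rewrite !inE => /and3P[dX df du]; rewrite dart_mark_be// XD.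
Qed.

(** Off the diagonal [dart_be] and the swap group the upper fold darts by fours: the first changes
    the mark, the second keeps the mark but changes which of the two germs folds. *)
Lemma card_offdiag (Xsw : {in X, forall d, dart_sw d \in X}) :
  4 %| #|[set d in X | [&& dart_fold d, dart_up d & ~~ dart_diag d]]|.
Proof.
have diag_be d : d \in X -> dart_diag (dart_be d) = dart_diag d.
  move=> dX; have dD := XD dX.
  by rewrite !dart_diag_folds ?dart_be_in// /dart_be /=;
    do 2 case: ifP => _; rewrite ?fold_ga.
have diag_sw d : d \in X -> dart_diag (dart_sw d) = dart_diag d.
  move=> dX; have dD := XD dX.
  by rewrite !dart_diag_folds ?dart_sw_in//= andbC.
rewrite (@card_half _ dart_be _ dart_mark dart_beK).
- rewrite (@card_half _ dart_sw _ (fun d => fold d.1) dart_swK).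
  + by rewrite mulnA dvdn_mulr.
  + move=> d; rewrite !inE -!andbA => /and5P[dX df du dd dm].
    rewrite Xsw// dart_up_sw ?XD// du diag_sw// dd dart_mark_sw ?XD// dm.
    by have -> : dart_fold (dart_sw d) by move: df; rewrite /dart_fold orbC.
  + move=> d; rewrite !inE -!andbA => /and5P[dX + _ + _].
    by rewrite dart_diag_folds ?XD// /dart_fold /=; case: (fold d.1); case: (fold d.2).
- move=> d; rewrite !inE => /and4P[dX df du dd].
  rewrite Xbe// dart_fold_be df diag_be// dd andbT /=.
  by have := dart_up_be (XD dX); rewrite df du => /eqP ->.
- by move=> d; rewrite !inE => /and4P[dX df du dd]; rewrite dart_mark_be// XD.
Qed.

Lemma nfolds_offdiag (Xsw : {in X, forall d, dart_sw d \in X})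
  (Xdiag : {in X, forall d, ~~ dart_diag d}) : 4 %| nfolds X.
Proof.
rewrite nfoldsE; have := card_offdiag Xsw; congr (_ %| _); apply: eq_card => d.
by rewrite !inE; have [dX|//] := boolP (d \in X); rewrite Xdiag// andbT.
Qed.

End Stable.

Definition dart_step d d' := (d' == dart_al d) || (d' == dart_be d).
Definition dart_orbit d : {set H * H} := [set d' | connect dart_step d d'].

Lemma dart_orbit_al d x : x \in dart_orbit d -> dart_al x \in dart_orbit d.
Proof.
rewrite !inE => /connect_trans; apply.
by apply: connect1; rewrite /dart_step eqxx.
Qed.

Lemma dart_orbit_be d x : x \in dart_orbit d -> dart_be x \in dart_orbit d.
Proof.
rewrite !inE => /connect_trans; apply.
by apply: connect1; rewrite /dart_step eqxx orbT.
Qed.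

Lemma dart_orbit_refl d : d \in dart_orbit d.
Proof. by rewrite inE connect0. Qed.

Lemma dart_orbit_sub (A : {set H * H}) d : d \in A ->
  {in A, forall x, dart_al x \in A} -> {in A, forall x, dart_be x \in A} ->
  {subset dart_orbit d <= A}.
Proof.
move=> dA Aal Abe x; rewrite inE => /connectP[p + ->].
elim: p d dA {x} => //= x p IH d dA /andP[st]; apply: IH.
by case/orP: st => /eqP ->; [exact: Aal|exact: Abe].
Qed.

Lemma dart_orbit_darts d : d \in darts -> {subset dart_orbit d <= darts}.
Proof. by move=> dD; apply: dart_orbit_sub => // x; [exact: dart_al_in|exact: dart_be_in]. Qed.

(** * The orbit of a diagonal dart *)

Section DiagOrbit.
Variable d0 : H * H.
Hypotheses (d0D : d0 \in darts) (d0diag : dart_diag d0).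

Let be' d := dart_sw (dart_be d).

Let be'K : involutive be'.
Proof. by move=> d; rewrite /be' dart_sw_be dart_swK dart_beK. Qed.

Let be'_d0 : be' d0 = d0.
Proof. by move: d0diag; rewrite dart_diag_be// /be' => /eqP ->; rewrite dart_swK. Qed.

Let P := dihedral_orbit dart_al be' d0.

Let Pal x : x \in P -> dart_al x \in P.
Proof. by apply: dihedral_orbit_al => //; exact: dart_alK. Qed.

Let Pbe x : x \in P -> be' x \in P.
Proof. by apply: dihedral_orbit_be => //; exact: dart_alK. Qed.

Let PD : {subset P <= darts}.
Proof.
apply: dihedral_orbit_ind => // x xD.
by rewrite dart_sw_in// dart_be_in// dart_al_in.
Qed.

(** The swap commutes with both involutions and sends [d0] to its image by [dart_be]. *)
Let orbit_sw x : x \in dart_orbit d0 -> dart_sw x \in dart_orbit d0.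
Proof.
pose A := [set x | dart_sw x \in dart_orbit d0].
suff /[apply] : {subset dart_orbit d0 <= A} by rewrite inE.
apply: dart_orbit_sub.
- move: d0diag; rewrite dart_diag_be// => /eqP e.
  by rewrite inE -e dart_orbit_be// dart_orbit_refl.
- by move=> y; rewrite !inE dart_sw_al => h; have := @dart_orbit_al d0 (dart_sw y);
    rewrite !inE; apply.
- by move=> y; rewrite !inE dart_sw_be => h; have := @dart_orbit_be d0 (dart_sw y);
    rewrite !inE; apply.
Qed.

Let P_orbit : {subset P <= dart_orbit d0}.
Proof.
apply: dihedral_orbit_ind; first exact: dart_orbit_refl.
by move=> x xO; rewrite orbit_sw// dart_orbit_be// dart_orbit_al.
Qed.

(** Replacing [dart_be] by [be'] only introduces swaps, so the path [P] and its mirror image fill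
    the orbit. *)
Let orbit_P x : x \in dart_orbit d0 -> x \in P \/ dart_sw x \in P.
Proof.
pose A := [set x | (x \in P) || (dart_sw x \in P)].
have AE y : (y \in A) = (y \in P) || (dart_sw y \in P) by rewrite inE.
suff /[apply] : {subset dart_orbit d0 <= A} by rewrite AE => /orP.
apply: dart_orbit_sub.
- by rewrite AE (dihedral_orbit_d0 _ _ d0).
- by move=> y; rewrite !AE dart_sw_al => /orP[] /Pal ->; rewrite ?orbT.
- move=> y; rewrite !AE => /orP[] /Pbe; first by move=> ->; rewrite orbT.
  by rewrite /be' dart_sw_be dart_swK => ->.
Qed.

(** Modulo 4 the off-diagonal upper folds disappear by [card_offdiag]; what remains is one upper
    diagonal dart of the path [P] and its swap. *)
Lemma nfolds_diag : nfolds (dart_orbit d0) = 2 %[mod 4].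
Proof.
have OD := dart_orbit_darts d0D.
rewrite (nfoldsE OD (@dart_orbit_al d0) (@dart_orbit_be d0)).
have := card_offdiag OD (@dart_orbit_be d0) orbit_sw.
set N := #|_| => N4.
rewrite (card_split _ dart_diag) addnC.
have -> : #|[set x in [set d in dart_orbit d0 | dart_fold d && dart_up d]
    | ~~ dart_diag x]| = N.
  by apply: eq_card => x; rewrite !inE -!andbA.
rewrite -modnDml (eqP N4) add0n; congr (_ %% 4).
have fixE x : x \in darts -> (be' x == x) = dart_diag x.
  by move=> xD; rewrite dart_diag_be// /be' (inv_eq dart_swK).
(* [~~ dart_eps] changes under [dart_al] everywhere and is kept by [be'] exactly at its fixed
   points; on the diagonal it coincides with [dart_up]. *)
have [||p Pp] := @dihedral_orbit_unique_fixed _ _ _ dart_alK be'K _ be'_d0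
  (fun x => ~~ dart_eps x).
- by move=> x _; rewrite dart_eps_al.
- move=> x xP; have xD := PD xP.
  by rewrite /be' dart_eps_sw ?dart_be_in// (inj_eq negb_inj) dart_eps_be// -fixE.
have Pp' x : x \in P -> dart_diag x -> dart_up x -> x = p.
  move=> xP xd xu; apply/set1P; rewrite -Pp inE xP fixE ?PD// xd.
  by rewrite dart_diag_eps// xu.
have /and3P[pP pd pu] : [&& p \in P, dart_diag p & dart_up p].
  have : p \in [set p] by rewrite inE.
  rewrite -Pp inE => /and3P[pP]; rewrite fixE ?PD// => pd.
  by rewrite dart_diag_eps// negbK => ->; rewrite pP pd.
have pD := PD pP.
have pn : p != dart_sw p.
  move: pD; rewrite inE => /and3P[_ _]; apply: contraNneq => e.
  by rewrite {1}e.
have -> : 2 = #|[set p; dart_sw p]| by rewrite cards2 pn.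
apply: eq_card => x; rewrite !inE -!andbA; apply/and4P/orP.
  move=> [xO _ xu xd]; have xD : x \in darts by apply: OD; rewrite inE.
  have [xP|sxP] : x \in P \/ dart_sw x \in P by apply: orbit_P; rewrite inE.
    by left; rewrite (Pp' x).
  right; apply/eqP; rewrite -[x]dart_swK; congr dart_sw; apply: Pp' => //.
    by move: xd; rewrite !dart_diag_folds ?dart_sw_in//= andbC.
  by rewrite dart_up_sw.
have df y : y \in darts -> dart_diag y -> dart_fold y.
  by move=> yD; rewrite dart_diag_folds// /dart_fold => /andP[->].
have pO := P_orbit pP; have spO := orbit_sw pO.
rewrite inE in pO; rewrite inE in spO.
have sd : dart_diag (dart_sw p).
  by move: pd; rewrite !dart_diag_folds ?dart_sw_in//= andbC.
move=> [] /eqP ->; split => //; rewrite ?df ?dart_sw_in ?dart_up_sw//.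
Qed.
End DiagOrbit.
End Darts.

From mathcomp Require Import all_order all_algebra.
From mathcomp Require Import all_classical all_reals all_analysis.
From mathcomp Require Import ring lra.

Import Order.TTheory GRing.Theory Num.Theory.
Import numFieldNormedType.Exports.

Local Open Scope ring_scope.
Local Open Scope classical_set_scope.
Local Open Scope card_scope.

(** * Smooth functions of a real variable *)

Section Ck.
Variable R : realType.
Implicit Types (f g : R -> R) (x : R) (n : nat).

Lemma derive1_near f g x : (\near x, f x = g x) -> (derive1 f) x = (derive1 g) x.
Proof. by move=> fg; rewrite !derive1E (near_eq_derive _ fg). Qed.

Lemma derivable1_continuous f x : derivable f x 1 -> {for x, continuous f}.
Proof. by move=> ?; apply/differentiable_continuous/derivable1_diffP. Qed.

(* A plain proposition, so that it does not trigger type class resolution. *)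
Definition der f x (df : R) : Prop := is_derive x 1 f df.

Lemma derP f x : derivable f x 1 -> der f x ((derive1 f) x).
Proof. by rewrite /der derive1E; exact: derivableP. Qed.

Lemma der_val f x df : der f x df -> (derive1 f) x = df.
Proof. by case=> _ <-; rewrite derive1E. Qed.

Lemma der_derivable f x df : der f x df -> derivable f x 1.
Proof. by case. Qed.

Lemma der_eq f x df df' : der f x df -> df = df' -> der f x df'.
Proof. by move=> ? <-. Qed.

Lemma der_near f g x df : (\near x, f x = g x) -> der f x df -> der g x df.
Proof. exact: near_eq_is_derive. Qed.

Lemma der_cst (c : R) x : der (fun=> c) x 0.
Proof. exact: is_derive_cst. Qed.

Lemma der_id x : der id x 1.
Proof. exact: is_derive_id. Qed.

Lemma derD f g x df dg : der f x df -> der g x dg ->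
  der (fun u => f u + g u) x (df + dg).
Proof. exact: is_deriveD. Qed.

Lemma derN f x df : der f x df -> der (fun u => - f u) x (- df).
Proof. exact: is_deriveN. Qed.

Lemma derB f g x df dg : der f x df -> der g x dg ->
  der (fun u => f u - g u) x (df - dg).
Proof. exact: is_deriveB. Qed.

Lemma derM f g x df dg : der f x df -> der g x dg ->
  der (fun u => f u * g u) x (df * g x + f x * dg).
Proof.
move=> hf hg; apply: der_eq (is_deriveM hf hg) _.
by rewrite addrC /GRing.scale/= [g x * df]mulrC.
Qed.

Lemma derV f x df : f x != 0 -> der f x df ->
  der (fun u => (f u)^-1) x (- df / f x ^+ 2).
Proof.
move=> f0 hf; apply: der_eq (is_deriveV f0 hf) _.
by rewrite /GRing.scale/= mulrC mulrN mulNr.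
Qed.

Lemma der_comp f g x df dg : der f x df -> der g (f x) dg ->
  der (fun u => g (f u)) x (dg * df).
Proof. by move=> hf hg; exact: is_derive1_comp. Qed.

Lemma der_sqrt x : 0 < x -> der Num.sqrt x (2 * Num.sqrt x)^-1.
Proof. exact: is_derive1_sqrt. Qed.

Lemma der_cos x : der cos x (- sin x).
Proof. exact: is_derive_cos. Qed.

Lemma der_sin x : der sin x (cos x).
Proof. exact: is_derive_sin. Qed.

Lemma der_continuous f x df : der f x df -> {for x, continuous f}.
Proof. by case=> ? _; exact: derivable1_continuous. Qed.

Lemma near_continuous f x (P : R -> Prop) : {for x, continuous f} ->
  (\forall y \near f x, P y) -> \forall u \near x, P (f u).
Proof. by move=> fx Px; have := fx P Px. Qed.

Lemma near_neq0 f x : {for x, continuous f} -> f x != 0 ->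
  \forall u \near x, f u != 0.
Proof. by move=> fx; apply: cvgr_neq0 fx. Qed.

Lemma near_gt0 f x : {for x, continuous f} -> 0 < f x ->
  \forall u \near x, 0 < f u.
Proof. by move=> fx; apply: cvgr_gt fx _. Qed.

Lemma near_lt0 f x : {for x, continuous f} -> f x < 0 ->
  \forall u \near x, f u < 0.
Proof. by move=> fx; apply: cvgr_lt fx _. Qed.

(** Differentiability up to order [n] near [x], with no continuity of the last derivative, so that
    the closure properties follow by plain induction. The neighbourhood may shrink with [n];
    smoothness on one neighbourhood is expressed by quantifying over the order inside [\near]. *)
Fixpoint Ck n f x : Prop :=
  if n is m.+1 then (\forall u \near x, derivable f u 1) /\ Ck m (derive1 f) x
  else True.

Lemma Ck_near n f g x : (\near x, f x = g x) -> Ck n f x -> Ck n g x.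
Proof.
elim: n f g => //= n IH f g fg [df Cf]; split.
  near=> u; have : derivable f u 1 by near: u.
  by apply: near_eq_derivable; near: u; exact: (near_join fg).
apply: IH Cf; near=> u; apply: derive1_near; near: u; exact: (near_join fg).
Unshelve. all: by end_near. Qed.

Lemma CkW n f x : Ck n.+1 f x -> Ck n f x.
Proof. by elim: n f => //= n IH f [df [d2f Cf]]; split=> //; apply: IH. Qed.

Lemma Ck_cst n (c : R) x : Ck n (cst c) x.
Proof.
elim: n c => //= n IH c; split; first by near=> u.
by apply: Ck_near (IH 0); near=> u; rewrite derive1_cst.
Unshelve. all: by end_near. Qed.

Lemma Ck_id n x : Ck n id x.
Proof.
case: n => //= n; split; first by near=> u; exact: derivable_id.
by apply: Ck_near (Ck_cst n 1 x); near=> u; rewrite derive1E derive_id.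
Unshelve. all: by end_near. Qed.

Lemma CkD n f g x : Ck n f x -> Ck n g x -> Ck n (fun u => f u + g u) x.
Proof.
elim: n f g => //= n IH f g [df Cf] [dg Cg].
have dfg : \forall u \near x,
    der (fun u => f u + g u) u (derive1 f u + derive1 g u).
  by apply: filterS2 df dg => u ? ?; apply: derD; apply: derP.
split; first by apply: filterS dfg => u; exact: der_derivable.
apply: Ck_near (IH _ _ Cf Cg).
by apply: filterS dfg => u /der_val.
Unshelve. all: by end_near. Qed.

Lemma CkM n f g x : Ck n f x -> Ck n g x -> Ck n (fun u => f u * g u) x.
Proof.
elim: n f g => //= n IH f g Cf Cg.
have := IH _ _ (CkW Cf) Cg.2; have := IH _ _ Cf.2 (CkW Cg).
case: Cf Cg => [df _] [dg _] C1 C2.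
have dfg : \forall u \near x,
    der (fun u => f u * g u) u (derive1 f u * g u + f u * derive1 g u).
  by apply: filterS2 df dg => u ? ?; apply: derM; apply: derP.
split; first by apply: filterS dfg => u; exact: der_derivable.
apply: Ck_near (CkD C1 C2).
by apply: filterS dfg => u /der_val.
Unshelve. all: by end_near. Qed.

Lemma CkN n f x : Ck n f x -> Ck n (fun u => - f u) x.
Proof.
move=> Cf; apply: Ck_near (CkM (Ck_cst n (-1) x) Cf).
by near=> u; rewrite mulN1r.
Unshelve. all: by end_near. Qed.

Lemma Ck_continuous n f x : Ck n.+1 f x -> \forall u \near x, {for u, continuous f}.
Proof. by case=> df _; near=> u; apply: derivable1_continuous; near: u.
Unshelve. all: by end_near. Qed.

Lemma Ck_comp n f g x : Ck n g (f x) -> Ck n f x -> Ck n (g \o f) x.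
Proof.
elim: n f g => // n IH f g Cg Cf.
have fx : {for x, continuous f}.
  by apply: derivable1_continuous; apply: nbhs_singleton Cf.1.
have := CkM (IH _ _ Cg.2 (CkW Cf)) Cf.2.
case: Cf Cg => df _ [dg _] C2.
have dgf : \forall u \near x, derivable g (f u) 1 by exact: near_continuous fx dg.
have dC : \forall u \near x,
    der (g \o f) u (derive1 g (f u) * derive1 f u).
  by apply: filterS2 df dgf => u ? ?; apply: der_comp; apply: derP.
split; first by apply: filterS dC => u; exact: der_derivable.
apply: Ck_near C2.
by apply: filterS dC => u /der_val.
Unshelve. all: by end_near. Qed.

Lemma Ck_inv n x : x != 0 -> Ck n (fun u => u^-1) x.
Proof.
elim: n x => //= n IH x x0.
have near0 : \forall u \near x, u != 0 by exact: (@near_neq0 id).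
have dV : \forall u \near x,
    der (fun u : R => u^-1) u (- (u^-1 * u^-1)).
  apply: filterS near0 => u u0.
  apply: der_eq (derV u0 (der_id u)) _.
  by rewrite mulNr mul1r expr2 invfM.
split; first by apply: filterS dV => u; exact: der_derivable.
have C := IH _ x0; apply: Ck_near (CkN (CkM C C)).
by apply: filterS dV => u /der_val.
Unshelve. all: by end_near. Qed.

Lemma Ck_sqrt n x : 0 < x -> Ck n Num.sqrt x.
Proof.
move=> x0.
have near0 : \forall u \near x, 0 < u by exact: (@near_gt0 id).
elim: n => //= n IH.
have dS : \forall u \near x, der Num.sqrt u (2 * Num.sqrt u)^-1.
  by apply: filterS near0 => u; exact: der_sqrt.
split; first by apply: filterS dS => u; exact: der_derivable.
have C : Ck n (fun u => (2 * Num.sqrt u)^-1) x.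
  apply: (@Ck_comp n (fun u => 2 * Num.sqrt u) (fun u => u^-1)).
    by apply: Ck_inv; rewrite mulf_neq0// gt_eqF// sqrtr_gt0.
  by apply: CkM => //; exact: Ck_cst.
apply: Ck_near C.
by apply: filterS dS => u /der_val.
Unshelve. all: by end_near. Qed.

Lemma Ck_deriv n f x : Ck n.+1 f x -> Ck n (derive1 f) x.
Proof. by case. Qed.

(** The formula g' = 1 / f'(g) holds near [f x], and its right side is as regular as [g], which
    gains one order at each induction step. *)
Lemma Ck_inverse n f g x : (forall k, Ck k f x) -> (derive1 f) x != 0 ->
  {near x, cancel f g} -> Ck n g (f x).
Proof.
move=> Cf f'x fK.
have cf : {near x, continuous f} by exact: (Ck_continuous (Cf 1%N)).
have cf' : {for x, continuous (derive1 f)}.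
  by have /nbhs_singleton := @Ck_continuous 0 _ _ (Cf 2%N).2.
have [cg gK] := near_can_continuousAcan_sym fK cf.
have gx : g (f x) = x by have /nbhs_singleton := fK.
have cgx : {for f x, continuous g} by have /nbhs_singleton := cg.
have f'0 : \forall u \near x, (derive1 f) u != 0 by exact: near_neq0 cf' _.
have gP (P : R -> Prop) : (\forall u \near x, P u) -> \forall y \near f x, P (g y).
  by move=> Px; apply: near_continuous cgx _; rewrite gx.
have dg : \forall y \near f x, der g y (derive1 f (g y))^-1.
  have h1 := gP _ (near_join fK).
  have h2 := gP _ (near_join cf).
  have h3 := gP _ (Cf 1%N).1.
  have h4 := gP _ f'0.
  apply: filterS (filterI (filterI (filterI h1 h2) (filterI h3 h4)) gK) => y.
  move=> [[[Hc Hf] [Hd H0]] fgy].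
  rewrite -[X in der g X _]fgy.
  by apply: is_derive_inverse => //; exact: derP.
elim: n => //= n IH; split.
  by apply: filterS dg => y; exact: der_derivable.
have C : Ck n (fun y => (derive1 f (g y))^-1) (f x).
  apply: (@Ck_comp n (fun y => derive1 f (g y)) (fun u => u^-1)).
    by rewrite gx; exact: Ck_inv.
  apply: (@Ck_comp n g (derive1 f)) => //; rewrite gx; exact: (Cf n.+1).2.
apply: Ck_near C.
by apply: filterS dg => y /der_val.
Unshelve. all: by end_near. Qed.

End Ck.

(** * Smooth division by the variable *)

Section Hadamard.
Variable R : realType.
Implicit Types (f g F h : R -> R) (x : R) (n : nat).

Lemma derX n x : der (fun u : R => u ^+ n.+1) x (n.+1%:R * x ^+ n).
Proof.
apply: DeriveDef; first exact: exprn_derivable.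
by rewrite exp_derive /GRing.scale/= mulr1.
Qed.

Lemma lhopital0 f df g dg (l : R) : f 0 = 0 -> g 0 = 0 ->
  {for 0, continuous f} -> {for 0, continuous g} ->
  (forall x, x != 0 -> der f x (df x)) -> (forall x, x != 0 -> der g x (dg x)) ->
  (forall x, x != 0 -> dg x != 0) ->
  (df x / dg x @[x --> 0^'] --> l) -> f x / g x @[x --> 0^'] --> l.
Proof.
move=> f0 g0 cf cg Df Dg dg0 dl.
(* The values at 0 are chosen so that the quotient extends continuously by the limit [l]. *)
pose df' x := if x == 0 then l else df x.
pose dg' x := if x == 0 then 1 else dg x.
have mem x : x \in `]-1, 1[ `\ 0 -> x != 0 by rewrite inE => -[_ /= /eqP].
apply: (@lhopital R f df' g dg' (-1) 1 0 l) => //.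
- by rewrite in_itv/= ltr01 ltrN10.
- by move=> x /mem x0; rewrite /df' (negbTE x0); exact: Df.
- by move=> x /mem x0; rewrite /dg' (negbTE x0); exact: Dg.
- have : f x @[x --> 0] --> f 0 by exact: cf.
  by rewrite f0.
- have : g x @[x --> 0] --> g 0 by exact: cg.
  by rewrite g0.
- by move=> x /mem x0; rewrite /dg' (negbTE x0) dg0.
have E0 : df' 0 / dg' 0 = l by rewrite /df' /dg' eqxx divr1.
have : {for 0, continuous (fun x => df' x / dg' x)}.
  apply/continuous_withinNx; rewrite E0.
  apply: cvg_trans dl; apply: near_eq_cvg.
  apply: filterS (nbhs_dnbhs_neq (0 : R)) => x x0.
  by rewrite /df' /dg' (negbTE x0).
by rewrite /prop_for /continuous_at E0.
Qed.

Lemma dnbhs_cvg f g (l : R) : (forall x, x != 0 -> f x = g x) ->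
  (f x @[x --> 0^'] --> l) -> g x @[x --> 0^'] --> l.
Proof.
move=> fg; apply: cvg_trans; apply: near_eq_cvg.
by apply: filterS (nbhs_dnbhs_neq (0 : R)) => x /fg.
Qed.

Lemma derivable_dnbhs f (l : R) :
  ((f x - f 0) / x @[x --> 0^'] --> l) -> der f 0 l.
Proof.
move=> fl.
have dl : h^-1 *: ((f \o shift 0) (h *: (1 : R)) - f 0) @[h --> 0^'] --> l.
  apply: dnbhs_cvg fl => x x0.
  by rewrite /GRing.scale/= mulr1 addr0 mulrC.
apply: DeriveDef; last exact: cvg_lim dl.
by apply/cvg_ex; exists l.
Qed.

(* For [x != 0] the hypothesis says that the derivative of [x ^+ n.+1 * h x] is
   [x ^+ n * F x], i.e. [h x] is the mean of [t ^+ n * F (t * x)] over [0, 1];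
   then [h'] is the same mean for [n.+1] and [F']. *)
Lemma mean_derivable n F h : (forall k x, Ck k F x) ->
  {for 0, continuous h} ->
  (forall x, x != 0 -> derivable h x 1 /\ x * derive1 h x + n.+1%:R * h x = F x) ->
  [/\ derivable h 0 1, {for 0, continuous (derive1 h)} &
   forall x, x != 0 -> derivable (derive1 h) x 1 /\
     x * derive1 (derive1 h) x + n.+2%:R * derive1 h x = derive1 F x].
Proof.
move=> CF ch Dh.
have cF k x : {for x, continuous (derive1n k F)}.
  suff : Ck 1 (derive1n k F) x by case=> /nbhs_singleton + _; exact: derivable1_continuous.
  have : Ck (k + 1) F x by []; elim: k F {CF Dh} => // k IH F' CF'.
  by rewrite derive1Sn; apply: IH; case: CF'.
have dF x : der F x (derive1 F x) by apply: derP; case: (CF 1%N x) => /nbhs_singleton.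
have h'E x : x != 0 -> derive1 h x = (F x - n.+1%:R * h x) / x.
  by move=> x0; have [_ <-] := Dh x x0; rewrite addrK [x * _]mulrC mulfK.
have dh x : x != 0 -> der h x (derive1 h x) by move=> /Dh[/derP].
have d2h x : x != 0 -> der (derive1 h) x ((derive1 F x - n.+2%:R * derive1 h x) / x).
  move=> x0; apply: (@der_near _ (fun u => (F u - n.+1%:R * h u) * u^-1)).
    by have := @near_neq0 _ id x (@cvg_id _ _) x0; apply: filterS => u /h'E ->.
  apply: der_eq (derM (derB (dF x) (derM (der_cst _ x) (dh x x0))) (derV x0 (der_id x))) _.
  rewrite h'E// -[n.+2]addn1 natrD; field.
  by rewrite x0.
(* The mean of [t ^+ n.+1] over [0, 1] is 1 / (n + 2), which predicts this value of h' at 0. *)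
pose L := derive1 F 0 / n.+2%:R.
have n0 : n.+2%:R != 0 :> R by rewrite pnatr_eq0.
have h'L : derive1 h x @[x --> 0^'] --> L.
  (* With this factor the terms in h' cancel when the numerator is differentiated, and only
     [x ^+ n.+1] times F' remains. *)
  apply: (@dnbhs_cvg (fun x => (x ^+ n.+1 * (F x - n.+1%:R * h x)) / x ^+ n.+2)).
    by move=> x x0; rewrite h'E// [x ^+ n.+2]exprS; field; rewrite x0 expf_neq0.
  apply: (@lhopital0 _ (fun x => x ^+ n.+1 * derive1 F x) _ (fun x => n.+2%:R * x ^+ n.+1)).
  - by rewrite exprS !mul0r.
  - by rewrite exprS mul0r.
  - apply: continuousM; first exact: exprn_continuous.
    apply: continuousB; first exact: (cF 0%N).
    by apply: continuousM => //; exact: cst_continuous.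
  - exact: exprn_continuous.
  - move=> x x0.
    apply: der_eq (derM (derX n x) (derB (dF x) (derM (der_cst _ x) (dh x x0)))) _.
    rewrite h'E// exprS; field; by rewrite x0.
  - by move=> x _; exact: derX.
  - by move=> x x0; rewrite mulf_neq0// expf_neq0.
  - apply: (@dnbhs_cvg (fun x => derive1 F x / n.+2%:R)).
      by move=> x x0; rewrite [n.+2%:R * _]mulrC -mulf_div divff ?mul1r ?expf_neq0.
    apply/continuous_withinNx; apply: continuousM; first exact: (cF 1%N).
    exact: cst_continuous.
have dh0 : der h 0 L.
  apply: derivable_dnbhs.
  apply: (@lhopital0 _ (derive1 h) _ (fun=> 1)) => //.
  - by rewrite subrr.
  - by apply: continuousB => //; exact: cst_continuous.
  - by move=> x x0; apply: der_eq (derB (dh x x0) (der_cst _ x)) _; rewrite subr0.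
  - by move=> x _; exact: der_id.
  - by apply: dnbhs_cvg h'L => x _; rewrite divr1.
split.
- exact: der_derivable dh0.
- by apply/continuous_withinNx; rewrite (der_val dh0).
- move=> x x0; split; first exact: der_derivable (d2h x x0).
  by rewrite (der_val (d2h x x0)); field.
Qed.

Lemma mean_Ck k n F h : (forall k x, Ck k F x) ->
  {for 0, continuous h} ->
  (forall x, x != 0 -> derivable h x 1 /\ x * derive1 h x + n.+1%:R * h x = F x) ->
  forall x, Ck k h x.
Proof.
elim: k n F h => //= k IH n F h CF ch Dh x.
have [dh0 ch' Dh'] := mean_derivable CF ch Dh.
split.
  near=> u; have [->|/Dh[]//] := eqVneq u 0.
  exact: dh0.
apply: IH ch' Dh' x => j u; exact: (CF j.+1 u).2.
Unshelve. all: by end_near. Qed.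

(** The quotient [F x / x] is the mean of F'(t x) over [0, 1], that is the case [n = 0] of [mean_Ck]
    for F'; no integral has to be formed. *)
Lemma hadamard F : (forall k x, Ck k F x) -> F 0 = 0 ->
  exists h, [/\ forall k x, Ck k h x, forall x, F x = x * h x & h 0 = derive1 F 0].
Proof.
move=> CF F0.
have dF x : der F x (derive1 F x) by apply: derP; case: (CF 1%N x) => /nbhs_singleton.
pose h x := if x == 0 then derive1 F 0 else F x / x.
have h0 : h 0 = derive1 F 0 by rewrite /h eqxx.
have hE x : x != 0 -> h x = F x / x by rewrite /h => /negbTE ->.
have dh x : x != 0 -> der h x ((derive1 F x - h x) / x).
  move=> x0; apply: (@der_near _ (fun u => F u * u^-1)).
    by have := @near_neq0 _ id x (@cvg_id _ _) x0; apply: filterS => u /hE ->.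
  apply: der_eq (derM (dF x) (derV x0 (der_id x))) _.
  by rewrite hE//; field.
exists h; split => //; last first.
  move=> x; have [->|x0] := eqVneq x 0; first by rewrite F0 mul0r.
  by rewrite hE// mulrC divfK.
move=> k; apply: (@mean_Ck k 0 (derive1 F)).
- by move=> j u; case: (CF j.+1 u).
- apply/continuous_withinNx; rewrite h0.
  apply: (@dnbhs_cvg (fun x => F x / x)); first by move=> x /hE.
  apply: (@lhopital0 _ (derive1 F) _ (fun=> 1)) => //.
  - exact: der_continuous (dF 0).
  - by move=> x _; exact: der_id.
  - apply: (@dnbhs_cvg (derive1 F)); first by move=> x _; rewrite divr1.
    apply/continuous_withinNx; apply: derivable1_continuous.
    by case: (CF 2%N 0) => _ [/nbhs_singleton].
- move=> x x0; split; first exact: der_derivable (dh x x0).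
  by rewrite (der_val (dh x x0)); field.
Qed.

End Hadamard.

(** * Local inverses and the Morse normal form *)

Section LocalInverse.
Variable R : realType.
Implicit Types (f g F h : R -> R) (x : R) (n : nat).

Lemma Ck_der f x : Ck 1 f x -> der f x (derive1 f x).
Proof. by case=> /nbhs_singleton /derP. Qed.

Lemma Ck_cont n f x : Ck n.+1 f x -> {for x, continuous f}.
Proof. by move/Ck_continuous/nbhs_singleton. Qed.

Lemma near_continuous_eq f x y (P : R -> Prop) : {for x, continuous f} ->
  f x = y -> (\forall y \near y, P y) -> \forall u \near x, P (f u).
Proof. by move=> fx <-; exact: near_continuous. Qed.

(** On a ball where f' does not vanish Rolle's theorem gives injectivity, a choice of preimages
    gives [g], and [Ck_inverse] applies at every nearby point rather than at [x0] only. *)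
Lemma local_inverse f x0 : (\forall x \near x0, forall k, Ck k f x) ->
  derive1 f x0 != 0 ->
  exists g, [/\ g (f x0) = x0, \forall y \near f x0, f (g y) = y,
    \forall y \near f x0, forall k, Ck k g y & der g (f x0) (derive1 f x0)^-1].
Proof.
move=> Cf f'0.
have Cf0 : forall k, Ck k f x0 by have /nbhs_singleton := Cf.
have near_f' : \forall x \near x0, derive1 f x != 0.
  exact: near_neq0 (Ck_cont (Ck_deriv (Cf0 2%N))) f'0.
have [e /= e0 ballP] := filterI Cf near_f'.
have inj x y : ball x0 e x -> ball x0 e y -> f x = f y -> x = y.
  wlog xy : x y / x <= y.
    move=> H bx by_ fxy; have [xy|/ltW yx] := leP x y; first exact: H.
    by apply/esym; exact: H.
  move=> bx by_ fxy; apply/eqP; rewrite eq_le xy /= leNgt; apply/negP => xy'.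
  have sub u : u \in `[x, y]%R -> ball x0 e u.
    rewrite in_itv/= => /andP[xu uy]; move: bx by_.
    rewrite /ball/= !ltr_norml => /andP[b1 b2] /andP[b3 b4].
    by apply/andP; split; lra.
  have dfu u : ball x0 e u -> der f u (derive1 f u).
    by move=> /ballP[/(_ 1%N) C _]; exact: Ck_der.
  have [| | |c cxy [_ fc]] := @Rolle _ f x y xy' => //.
  - by move=> u /subset_itv_oo_cc /sub /dfu; exact: der_derivable.
  - apply: continuous_in_subspaceT => u; rewrite inE => /sub /dfu.
    exact: der_continuous.
  - have [_ /negP] := ballP _ (sub _ (subset_itv_oo_cc cxy)).
    by apply; rewrite derive1E fc.
pose g y := xget x0 [set x | ball x0 e x /\ f x = y].
have fK : {near x0, cancel f g}.
  exists e => // x bx; apply/esym; rewrite /g.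
  by case: xgetP => [z _ [bz fz]|/(_ x)[]//]; exact: inj.
have cf : {near x0, continuous f}.
  by apply: filterS Cf => x /(_ 1%N) /Ck_cont.
have [cg gK] := near_can_continuousAcan_sym fK cf.
have gx : g (f x0) = x0 by have /nbhs_singleton := fK.
have cgx : {for f x0, continuous g} by have /nbhs_singleton := cg.
exists g; split => //.
- have gP (P : R -> Prop) := @near_continuous_eq g (f x0) x0 P cgx gx.
  have h1 := gP _ (near_join fK); have h2 := gP _ Cf; have h3 := gP _ near_f'.
  apply: filterS (filterI (filterI h1 h2) (filterI h3 gK)) => y.
  move=> [[fKy Cfy] [f'y fgy]] k; rewrite -fgy; exact: Ck_inverse.
- by apply: is_derive_inverse => //; apply: Ck_der.
Qed.

(** Dividing twice by the variable gives F x = x^2 h2 x with [h2 0] nonzero of sign [e]; then [g]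
    inverts [w x = x * sqrt (e * h2 x)]. The left inverse [w] is kept in the conclusion because it
    makes [g] injective near 0. *)
Lemma morse F : (forall k x, Ck k F x) -> F 0 = 0 -> derive1 F 0 = 0 ->
  derive1 (derive1 F) 0 != 0 ->
  exists e g, [/\ e != 0, g 0 = 0, \forall u \near 0, F (g u) = e * u ^+ 2,
    (\forall u \near 0, forall k, Ck k g u) /\
      exists w : R -> R, \forall u \near 0, w (g u) = u &
    exists2 l, l != 0 & der g 0 l].
Proof.
move=> CF F0 F'0 F''0.
have [h1 [Ch1 Fh1 h10]] := hadamard CF F0.
have [|h2 [Ch2 h1h2 h20]] := hadamard Ch1; first by rewrite h10.
have {}h20 : h2 0 != 0.
  rewrite h20; apply: contraNneq F''0 => h1'0.
  have F'E : derive1 F = (fun u => 1 * h1 u + u * derive1 h1 u).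
    apply/funext => u; apply: der_val.
    have -> : F = (fun u => u * h1 u) by exact/funext.
    exact: derM (der_id u) (Ck_der (Ch1 1%N u)).
  have d : der (derive1 F) 0 (0 * h1 0 + 1 * derive1 h1 0 +
      (1 * derive1 h1 0 + 0 * derive1 (derive1 h1) 0)).
    rewrite F'E; apply: derD; first exact: derM (der_cst _ _) (Ck_der (Ch1 1%N 0)).
    by apply: derM (der_id _) (Ck_der (Ck_deriv (Ch1 2%N 0))).
  by rewrite (der_val d) h1'0 !(mul0r, mulr0, addr0).
pose e := Num.sg (h2 0).
have e0 : e != 0 by rewrite sgr_eq0.
have ee : e * e = 1 by rewrite -expr2 sqr_sg h20.
pose q x := e * h2 x.
have Cq k x : Ck k q x by apply: CkM => //; exact: Ck_cst.
have q0 : 0 < q 0 by rewrite /q -normrEsg normr_gt0.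
have near_q : \forall x \near 0, 0 < q x.
  exact: near_gt0 (Ck_cont (Cq 1%N 0)) q0.
pose w x := x * Num.sqrt (q x).
have w0 : w 0 = 0 by rewrite /w mul0r.
have Cw : \forall x \near 0, forall k, Ck k w x.
  apply: filterS near_q => x qx k; apply: CkM; first exact: Ck_id.
  by apply: (@Ck_comp _ k q) => //; exact: Ck_sqrt.
have dw : der w 0 (Num.sqrt (q 0)).
  have := derM (der_id 0) (der_comp (Ck_der (Cq 1%N 0)) (der_sqrt q0)).
  by move=> d; apply: der_eq d _; rewrite mul1r mul0r addr0.
have sq0 : Num.sqrt (q 0) != 0 by rewrite gt_eqF// sqrtr_gt0.
have [|g [gx wg Cg dg]] := local_inverse Cw; first by rewrite (der_val dw).
rewrite w0 in gx wg Cg dg.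
have cg : {for 0, continuous g} by exact: der_continuous dg.
exists e, g; split => //.
- have := near_continuous_eq cg gx near_q.
  apply: filterS2 wg => u wgu qu; rewrite Fh1 h1h2.
  have -> : u ^+ 2 = w (g u) ^+ 2 by rewrite wgu.
  rewrite /w exprMn sqr_sqrtr ?ltW// /q.
  by rewrite [in RHS]mulrCA [e * (e * _)]mulrA ee mul1r mulrA expr2.
- by split=> //; exists w.
- by eexists; last exact: dg; rewrite (der_val dw) invr_eq0.
Qed.

End LocalInverse.

(** * Primitives on the whole line *)

Section Primitive.
Variable R : realType.
Implicit Types (W : R -> R).

Lemma der_unique_near (f g df : R -> R) (a b : R) : a < 0 -> 0 < b ->
  (forall x, a < x < b -> der f x (df x)) ->
  (forall x, a < x < b -> der g x (df x)) -> f 0 = g 0 ->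
  forall x, a < x < b -> f x = g x.
Proof.
move=> a0 b0 Df Dg fg0 x /andP[ax xb].
pose h u := f u - g u.
have Dh u : a < u < b -> der h u 0.
  by move=> /[dup] /Df dfu /Dg dgu; apply: der_eq (derB dfu dgu) _; rewrite subrr.
have h0 : h 0 = 0 by rewrite /h fg0 subrr.
have hc u v : a < u -> v < b -> {within `[u, v], continuous h}.
  move=> au vb; apply: continuous_in_subspaceT => z; rewrite inE/= in_itv/=.
  move=> /andP[uz zv]; apply: (@der_continuous _ _ _ 0); apply: Dh.
  by rewrite (lt_le_trans au uz) (le_lt_trans zv vb).
suff : h x = 0 by move/eqP; rewrite subr_eq0 => /eqP.
have [x0|x0|->//] := ltgtP x 0.
- have [|c _] := @MVT _ h (fun=> 0) x 0 x0 _ (hc _ _ ax b0).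
    move=> z; rewrite in_itv/= => /andP[xz z0]; apply: Dh.
    by rewrite (lt_trans ax xz) (lt_trans z0 b0).
  by rewrite mul0r h0 sub0r => /eqP; rewrite oppr_eq0 => /eqP.
- have [|c _] := @MVT _ h (fun=> 0) 0 x x0 _ (hc _ _ a0 xb).
    move=> z; rewrite in_itv/= => /andP[xz z0]; apply: Dh.
    by rewrite (lt_trans a0 xz) (lt_trans z0 xb).
  by rewrite mul0r h0 subr0.
Qed.

Lemma primitive_right W : continuous W ->
  exists F, forall x, -1 < x -> der F x (W x).
Proof.
move=> cW; pose F x := (\int[@lebesgue_measure R]_(t in `[-1, x]) W t)%R.
exists F => x x1.
have xu : x < x + 1 by rewrite ltrDl.
have iW : (@lebesgue_measure R).-integrable `[-1, x + 1] (EFin \o W).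
  apply: continuous_compact_integrable; first exact: segment_compact.
  exact: continuous_subspaceT.
have [dF F'] := @continuous_FTC1_closed R W (-1) x (x + 1) xu iW x1 (cW x).
by have := derP dF; rewrite F'.
Qed.

(** Integration from -1 covers the points to the right of -1, and reflecting the variable covers
    those to the left of 1; normalized to vanish at 0, both agree on the overlap by
    [der_unique_near] and can be glued at 0. *)
Lemma primitive W : continuous W -> exists F, forall x, der F x (W x).
Proof.
move=> cW; have [F DF] := primitive_right cW.
have [|G DG] := @primitive_right (fun x => W (- x)).
  by move=> x; apply: continuous_comp; [exact: opp_continuous|exact: cW].
have DF0 x : -1 < x -> der (fun u => F u - F 0) x (W x).
  by move=> /DF d; apply: der_eq (derB d (der_cst _ x)) _; rewrite subr0.
have DG0 x : x < 1 -> der (fun u => G 0 - G (- u)) x (W x).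
  move=> x1; have d : der G (- x) (W (- - x)) by apply: DG; rewrite ltrN2.
  have := derB (der_cst (G 0) x) (der_comp (derN (der_id x)) d).
  by move=> dd; apply: der_eq dd _; rewrite opprK mulrN1 sub0r opprK.
exists (fun x => if 0 <= x then F x - F 0 else G 0 - G (- x)) => x.
have [x0|x0] := ltP x 1; last first.
  apply: der_near (DF0 x _); last by rewrite (lt_le_trans _ x0)// ltrN10 || lra.
  have : \forall u \near x, 0 < u by apply: (@near_gt0 _ id) => //; lra.
  by apply: filterS => u /ltW ->.
have [x1|x1] := leP x (- 2^-1).
  apply: der_near (DG0 x x0).
  have : \forall u \near x, u < 0 by apply: (@near_lt0 _ id) => //=; lra.
  by apply: filterS => u; rewrite ltNge => /negbTE ->.
apply: der_near (DG0 x x0).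
have b1 : \forall u \near x, 0 < u + 1.
  by apply: (@near_gt0 _ (fun u => u + 1)); [exact: der_continuous (derD (der_id x) (der_cst _ x))|lra].
have b2 : \forall u \near x, u - 1 < 0.
  by apply: (@near_lt0 _ (fun u => u - 1)); [exact: der_continuous (derB (der_id x) (der_cst _ x))|lra].
apply: filterS2 b1 b2 => u u1 u2; case: ifP => // _; apply/esym.
apply: (@der_unique_near (fun u => F u - F 0) (fun u => G 0 - G (- u)) W (-1) 1) => //.
- by move=> z /andP[z1 _]; exact: DF0.
- by move=> z /andP[_ z1]; exact: DG0.
- by rewrite oppr0 !subrr.
- by apply/andP; split; lra.
Qed.
End Primitive.

(** * Differentiating plane curves by coordinates *)

Section PlaneCalculus.
Variable R : realType.
Implicit Types (c : R -> R * R) (x : R) (n : nat) (s t : R -> R).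

Lemma der_pair c x a b : der (fun u => (c u).1) x a ->
  der (fun u => (c u).2) x b -> is_derive x (1 : R) c (a, b).
Proof.
move=> [d1 <-] [d2 <-].
have cl : h^-1 *: ((c \o shift x) (h *: (1 : R)) - c x) @[h --> 0^'] -->
    ('D_1 (fun u => (c u).1) x, 'D_1 (fun u => (c u).2) x).
  apply: cvg_trans (cvg_pair d1 d2); apply: near_eq_cvg; apply: nearW => h.
  by rewrite /=; case: (c _) (c x) => [? ?] [? ?].
by apply: DeriveDef; [apply/cvg_ex; eexists; exact: cl|exact: cvg_lim cl].
Qed.

Lemma fst_continuous : continuous (@fst R R).
Proof. by move=> [a b]; exact: cvg_fst. Qed.

Lemma snd_continuous : continuous (@snd R R).
Proof. by move=> [a b]; exact: cvg_snd. Qed.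

Lemma der_fst c x : derivable c x 1 -> der (fun u => (c u).1) x (derive1 c x).1.
Proof.
move=> dc.
have dl : h^-1 *: ((c \o shift x) (h *: (1 : R)) - c x) @[h --> 0^'] --> derive1 c x.
  by rewrite derive1E; exact: dc.
have cl : h^-1 *: (((fun u => (c u).1) \o shift x) (h *: (1 : R)) - (c x).1)
    @[h --> 0^'] --> (derive1 c x).1.
  apply: cvg_trans (cvg_comp _ _ dl (@fst_continuous _)).
  apply: near_eq_cvg; apply: nearW => h.
  by rewrite /=; case: (c _) (c x) => [? ?] [? ?].
by apply: DeriveDef; [apply/cvg_ex; eexists; exact: cl|exact: cvg_lim cl].
Qed.

Lemma der_snd c x : derivable c x 1 -> der (fun u => (c u).2) x (derive1 c x).2.
Proof.
move=> dc.
have dl : h^-1 *: ((c \o shift x) (h *: (1 : R)) - c x) @[h --> 0^'] --> derive1 c x.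
  by rewrite derive1E; exact: dc.
have cl : h^-1 *: (((fun u => (c u).2) \o shift x) (h *: (1 : R)) - (c x).2)
    @[h --> 0^'] --> (derive1 c x).2.
  apply: cvg_trans (cvg_comp _ _ dl (@snd_continuous _)).
  apply: near_eq_cvg; apply: nearW => h.
  by rewrite /=; case: (c _) (c x) => [? ?] [? ?].
by apply: DeriveDef; [apply/cvg_ex; eexists; exact: cl|exact: cvg_lim cl].
Qed.

Lemma derive1_pair c x a b : der (fun u => (c u).1) x a ->
  der (fun u => (c u).2) x b -> derive1 c x = (a, b).
Proof. by move=> da db; rewrite derive1E; have [] := der_pair da db. Qed.

Lemma derive1_near2 c d x : (\near x, c x = d x) -> derive1 c x = derive1 d x.
Proof. by move=> cd; rewrite !derive1E (near_eq_derive _ cd). Qed.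

Lemma Ck_derive1n n k s x : Ck (n + k) s x -> Ck k (derive1n n s) x.
Proof. by elim: n s => // n IH s [_ /IH]; rewrite -derive1Sn. Qed.

Lemma smooth_at_pair s t x : (forall k, Ck k s x) -> (forall k, Ck k t x) ->
  smooth_at (fun u => (s u, t u)) x.
Proof.
move=> Cs Ct.
have D n (g : R -> R) : (forall k, Ck k g x) ->
    \forall u \near x, derivable (derive1n n g) u 1.
  by move=> Cg; have [] := @Ck_derive1n n 1 g x (Cg _).
have E n : \forall u \near x, derive1n n (fun u => (s u, t u)) u =
    (derive1n n s u, derive1n n t u).
  elim: n => [|n /near_join IH]; first by near=> u.
  apply: filterS3 IH (D n s Cs) (D n t Ct) => u /derive1_near2 + /derP ds /derP dt.
  by rewrite derive1nS => ->; apply: derive1_pair.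
move=> n; have /nbhs_singleton/derP ds := D n s Cs.
have /nbhs_singleton/derP dt := D n t Ct.
have [d _] := @der_pair (fun u => (derive1n n s u, derive1n n t u)) x _ _ ds dt.
by apply: near_eq_derivable d; apply: filterS (E n) => u ->.
Unshelve. all: by end_near. Qed.

Lemma Ck_smooth c : (forall x, smooth_at c x) -> forall k x,
  Ck k (fun u => (c u).1) x /\ Ck k (fun u => (c u).2) x.
Proof.
move=> sc k x; elim: k c sc => // k IH c sc.
have dc u : derivable c u 1 by exact: (sc u 0%N).
have [|C1 C2] := IH (derive1 c).
  by move=> u n; rewrite -derive1Sn; exact: (sc u n.+1).
have e1 : derive1 (fun u => (c u).1) = (fun u => (derive1 c u).1).
  by apply/funext => u; exact: der_val (der_fst (dc u)).
have e2 : derive1 (fun u => (c u).2) = (fun u => (derive1 c u).2).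
  by apply/funext => u; exact: der_val (der_snd (dc u)).
split; split; rewrite ?e1 ?e2//.
- by near=> u; exact: der_derivable (der_fst (dc u)).
- by near=> u; exact: der_derivable (der_snd (dc u)).
Unshelve. all: by end_near. Qed.

End PlaneCalculus.

(** * The angle of the tangent *)

Section Polar.
Variable R : realType.
Implicit Types (g : R -> R) (x s : R).

Lemma Ck_sin_cos k x : Ck k sin x /\ Ck k cos x.
Proof.
have ds : derive1 (@sin R) = cos by apply/funext => u; exact: der_val (der_sin u).
have dc : derive1 (@cos R) = (fun u => - sin u).
  by apply/funext => u; exact: der_val (der_cos u).
elim: k x => // k IH x; have [Cs Cc] := IH x; split; split; rewrite ?ds ?dc//.
- by near=> u; exact: der_derivable (der_sin u).
- by near=> u; exact: der_derivable (der_cos u).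
- exact: CkN.
Unshelve. all: by end_near. Qed.

Lemma Ck_primitive g (dg : R -> R) : (forall x, der g x (dg x)) ->
  (forall k x, Ck k dg x) -> forall k x, Ck k g x.
Proof.
move=> Dg Cdg [|k] x //.
have e : derive1 g = dg by apply/funext => u; exact: der_val (Dg u).
split; last by rewrite e.
by near=> u; exact: der_derivable (Dg u).
Unshelve. all: by end_near. Qed.

Lemma der0_cst g : (forall x, der g x 0) -> forall x y, g x = g y.
Proof. by move=> Dg x y; exact: is_derive_0_is_cst. Qed.

(** The radius may be negative, so only the line spanned by (a, b) matters and the arctangent is
    enough. *)
Lemma direction_angle (a b : R) : exists t : R, b * cos t = a * sin t.
Proof.
have [a0|a0] := eqVneq a 0.
  by exists (pi / 2); rewrite cos_pihalf a0 mulr0 mul0r.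
exists (atan (b / a)).
have ct0 : cos (atan (b / a)) != 0.
  by rewrite gt_eqF// cos_gt0_pihalf// atan_gtNpi2 atan_ltpi2.
have := atanK (b / a); move: ct0; rewrite /tan; set t := atan _ => ct0 e.
have -> : sin t = b / a * cos t by rewrite -e divfK.
by field.
Qed.

(** [th] is a primitive of (a b' - b a') / (a^2 + b^2), the angular speed of the tangent, started at
    the right direction. The component [S] of the tangent normal to [th] satisfies (S^2 / q)' = 0
    and vanishes at 0, so the tangent stays on the line of angle [th]. *)
Lemma polar (f : R -> R * R) : (forall s, smooth_at f s) ->
  (forall s, derive1 f s <> 0) ->
  exists r th : R -> R, [/\ forall k s, Ck k r s, forall k s, Ck k th s,
    forall s, r s != 0 &
    forall s, derive1 f s = (r s * cos (th s), r s * sin (th s))].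
Proof.
move=> fs f'0.
have df s : derivable f s 1 by exact: (fs s 0%N).
pose a s := (derive1 f s).1; pose b s := (derive1 f s).2.
have Cab k x : Ck k a x /\ Ck k b x.
  by apply: Ck_smooth => s n; rewrite -derive1Sn; exact: (fs s n.+1).
pose a' := derive1 a; pose b' := derive1 b.
have Da x : der a x (a' x) by apply: Ck_der; have [] := Cab 1%N x.
have Db x : der b x (b' x) by apply: Ck_der; have [] := Cab 1%N x.
pose q s := a s * a s + b s * b s.
have q0 s : q s != 0.
  apply/eqP => qs; apply: (f'0 s); move: qs; rewrite /q -!expr2.
  move/eqP; rewrite paddr_eq0 ?sqr_ge0// !sqrf_eq0 => /andP[/eqP as0 /eqP bs0].
  by rewrite (surjective_pairing (derive1 f s)) -/(a s) -/(b s) as0 bs0.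
pose W s := (a s * b' s - b s * a' s) * (q s)^-1.
have CW k x : Ck k W x.
  have [Ca Cb] := Cab k x; have [[_ Ca'] [_ Cb']] := Cab k.+1 x.
  apply: CkM; first by apply: CkD; [exact: CkM|apply: CkN; exact: CkM].
  apply: (@Ck_comp _ k q (fun u => u^-1)); first exact: Ck_inv.
  by apply: CkD; exact: CkM.
have cW : continuous W by move=> x; exact: Ck_cont (CW 1%N x).
have [F DF] := primitive cW.
have [t0 t0E] := direction_angle (a 0) (b 0).
pose th s := F s + (t0 - F 0).
have Dth s : der th s (W s).
  by apply: der_eq (derD (DF s) (der_cst _ s)) _; rewrite addr0.
have Cth := Ck_primitive Dth CW.
have Ccos k x : Ck k (fun u => cos (th u)) x.
  by apply: (@Ck_comp _ k th cos) => //; have [] := Ck_sin_cos k (th x).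
have Csin k x : Ck k (fun u => sin (th u)) x.
  by apply: (@Ck_comp _ k th sin) => //; have [] := Ck_sin_cos k (th x).
have Dcos s : der (fun u => cos (th u)) s (- sin (th s) * W s).
  exact: der_comp (Dth s) (der_cos _).
have Dsin s : der (fun u => sin (th u)) s (cos (th s) * W s).
  exact: der_comp (Dth s) (der_sin _).
pose r s := a s * cos (th s) + b s * sin (th s).
pose S s := b s * cos (th s) - a s * sin (th s).
have DE s : der (fun u => S u * S u * (q u)^-1) s 0.
  have DS := derB (derM (Db s) (Dcos s)) (derM (Da s) (Dsin s)).
  have Dq := derD (derM (Da s) (Da s)) (derM (Db s) (Db s)).
  apply: der_eq (derM (derM DS DS) (derV (q0 s) Dq)) _.
  have qE : a s * a s + b s * b s != 0 by exact: q0.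
  rewrite /S /W /q; field.
  by rewrite qE.
have S0 s : S s = 0.
  have := der0_cst DE s 0; rewrite [X in _ = X * _ * _](_ : _ = 0) ?mul0r.
    move=> /eqP; rewrite mulf_eq0 invr_eq0 (negbTE (q0 s)) orbF mulf_eq0 orbb.
    by move/eqP.
  by rewrite /S /th [F 0 + _]addrC subrK t0E subrr.
have cs s : cos (th s) * cos (th s) + sin (th s) * sin (th s) = 1.
  by rewrite -!expr2 cos2Dsin2.
have ar s : a s = r s * cos (th s).
  have := S0 s; rewrite /S /r => /eqP; rewrite subr_eq0 => /eqP e.
  rewrite mulrDl -[b s * _ * _]mulrAC e -[LHS]mulr1 -(cs s); ring.
have br s : b s = r s * sin (th s).
  have := S0 s; rewrite /S /r => /eqP; rewrite subr_eq0 => /eqP e.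
  rewrite mulrDl -[a s * _ * _]mulrAC -e -[LHS]mulr1 -(cs s); ring.
exists r, th; split => //.
- by move=> k s; have [Ca Cb] := Cab k s; apply: CkD; exact: CkM.
- move=> s; apply/eqP => rs; have /eqP := q0 s; apply.
  by rewrite /q ar br rs !mul0r addr0.
- by move=> s; rewrite -ar -br; exact: surjective_pairing.
Qed.

End Polar.

(** * Parallel directions and points of the circle *)

Section Trigo.
Variable R : realType.
Implicit Types (g k : R -> R) (x y s t : R).

Lemma sin_eq0_small y : sin y = 0 -> `|y| < pi -> y = 0.
Proof.
wlog y0 : y / 0 <= y.
  move=> H sy ny; have [y0|y0] := leP 0 y; first exact: H.
  apply/eqP; rewrite -oppr_eq0; apply/eqP; apply: H; last by rewrite normrN.
    by rewrite oppr_ge0 ltW.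
  by rewrite sinN sy oppr0.
rewrite ger0_norm// => sy ypi; apply/eqP; rewrite eq_le y0 andbT leNgt.
by apply/negP => y1; have := @sin_gt0_pi R y; rewrite y1 ypi sy ltxx => /(_ isT).
Qed.

(** Equality modulo pi; the sine avoids carrying an integer. *)
Definition par_angle x y := sin (x - y) == 0.

Lemma par_angle_refl x : par_angle x x.
Proof. by rewrite /par_angle subrr sin0. Qed.

Lemma par_angle_sym x y : par_angle x y = par_angle y x.
Proof. by rewrite /par_angle -opprB sinN oppr_eq0. Qed.

Lemma par_angle_trans y x z : par_angle x y -> par_angle y z -> par_angle x z.
Proof.
rewrite /par_angle => /eqP xy /eqP yz.
have -> : x - z = (x - y) + (y - z) by rewrite addrA subrK.
by rewrite sinD xy yz mul0r mulr0 addr0.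
Qed.

Lemma par_angle_small x y : par_angle x y -> `|x - y| < pi -> x = y.
Proof. by move=> /eqP e /(sin_eq0_small e) /eqP; rewrite subr_eq0 => /eqP. Qed.

(** Different values congruent to [g x] modulo pi are at distance at least pi from it, and
    continuity keeps [g] closer than that. *)
Lemma par_angle_locally_cst g x : {for x, continuous g} ->
  (\forall u \near x, par_angle (g u) (g x)) -> \forall u \near x, g u = g x.
Proof.
move=> cg pg.
have small : \forall u \near x, `|g x - g u| < pi.
  by move/cvgrPdist_lt : cg => /(_ pi (pi_gt0 R)).
apply: filterS2 pg small => u p n; apply: par_angle_small => //.
by rewrite distrC.
Qed.

Lemma circ_eqP s t : circ s = circ t <-> exists n : int, s = t + pi *+ 2 *~ n.
Proof.
split; last first.
  move=> [n ->].
  have pos u (m : nat) : circ (u + pi *+ 2 *+ m) = circ u :> R * R.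
    by rewrite /circ (periodicn (@cosD2pi R)) (periodicn (@sinD2pi R)).
  case: (intP n) => [|m|m]; first by rewrite mulr0z addr0.
    by rewrite -pmulrn pos.
  by rewrite -[in RHS](subrK (pi *+ 2 *+ m.+1) t) mulrNz -pmulrn pos.
have pi2 : 0 < pi *+ 2 :> R by rewrite mulrn_wgt0// pi_gt0.
move=> [cst sst]; pose n := Num.floor ((s - t) / (pi *+ 2)).
exists n; set p := _ *~ n.
pose y := s - t - p.
have /andP[y0 y1] : 0 <= y < pi *+ 2.
  have /andP[] := real_floor_itv (num_real ((s - t) / (pi *+ 2))).
  rewrite ltr_pdivrMr// ler_pdivlMr// -/n intrD mulrDl mul1r.
  rewrite /y /p -mulrzl => h1 h2; apply/andP; split; lra.
suff : y = 0 by rewrite /y => /eqP; rewrite subr_eq0 subr_eq => /eqP ->; rewrite addrC.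
have cy : cos y = 1.
  have -> : cos y = cos (s - t).
    rewrite /y /p; case: (intP n) => [|m|m]; first by rewrite mulr0z subr0.
      rewrite -pmulrn -[in RHS](subrK (pi *+ 2 *+ m.+1) (s - t)).
      by rewrite (periodicn (@cosD2pi R)).
    by rewrite mulrNz opprK -pmulrn (periodicn (@cosD2pi R)).
  by rewrite cosB cst sst -!expr2 cos2Dsin2.
(* If 0 < y < 2 pi then [sin (y / 2)] is positive, whereas [cos y = 1] forces its square to
   vanish. *)
apply/eqP; rewrite eq_le y0 andbT leNgt; apply/negP => yp.
have s2 : 0 < sin (y / 2).
  by apply: sin_gt0_pi; rewrite divr_gt0//= ltr_pdivrMr// mulr_natr.
have cos2 z : cos (z *+ 2) = 1 - sin z ^+ 2 *+ 2 :> R.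
  by rewrite cos_mulr2n cos2sin2; ring.
have y2 : y = (y / 2) *+ 2 by rewrite -mulr_natr divfK.
have := cos2 (y / 2); rewrite -y2 cy => /eqP.
rewrite eq_sym -subr_eq0 addrAC subrr sub0r oppr_eq0 mulrn_eq0 /=.
by rewrite expf_eq0/= gt_eqF.
Qed.

Lemma circ_rep s : exists2 t, 0 <= t < pi *+ 2 & circ s = circ t :> R * R.
Proof.
have pi2 : 0 < pi *+ 2 :> R by rewrite mulrn_wgt0// pi_gt0.
pose n := Num.floor (s / (pi *+ 2)).
exists (s - pi *+ 2 *~ n).
  have /andP[] := real_floor_itv (num_real (s / (pi *+ 2))).
  rewrite ltr_pdivrMr// ler_pdivlMr// -/n intrD mulrDl mul1r.
  rewrite -mulrzl => h1 h2; apply/andP; split; lra.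
by apply/circ_eqP; exists n; rewrite subrK.
Qed.

Lemma circ_small s t : circ s = circ t -> `|s - t| < pi *+ 2 -> s = t.
Proof.
have pi2 : 0 < pi *+ 2 :> R by rewrite mulrn_wgt0// pi_gt0.
move=> /circ_eqP[n ->]; rewrite [X in `|X|]addrC addKr -mulrzl normrM.
rewrite [`|pi *+ 2|]gtr0_norm// -[X in _ < X]mul1r ltr_pM2r// -intr_norm.
rewrite -[X in _ < X]/(1%:~R) ltr_int => n1.
have -> : n = 0 by apply/eqP; rewrite -normr_eq0; case: `|n| (normr_ge0 n) n1 => -[].
by rewrite mulr0z ?mul0r addr0.
Qed.

Lemma near_at_left (P : R -> Prop) x : (\forall u \near x, P u) ->
  \forall u \near x^'-, P u.
Proof. exact: cvg_within. Qed.

Lemma near_at_right (P : R -> Prop) x : (\forall u \near x, P u) ->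
  \forall u \near x^'+, P u.
Proof. exact: cvg_within. Qed.

Lemma at_left_contra k x : (\forall u \near x^'-, k u < 0) ->
  (\forall u \near x^'-, 0 < k u) -> False.
Proof.
move=> h1 h2; have [u [u1 u2]] :=
  @filter_ex _ _ (at_left_proper_filter x) _ (filterI h1 h2).
by have := lt_trans u1 u2; rewrite ltxx.
Qed.

Lemma at_right_contra k x : (\forall u \near x^'+, k u < 0) ->
  (\forall u \near x^'+, 0 < k u) -> False.
Proof.
move=> h1 h2; have [u [u1 u2]] :=
  @filter_ex _ _ (at_right_proper_filter x) _ (filterI h1 h2).
by have := lt_trans u1 u2; rewrite ltxx.
Qed.

Lemma changes_sign_near k1 k2 x : (\forall u \near x, Num.sg (k1 u) = Num.sg (k2 u)) ->
  changes_sign k1 x -> changes_sign k2 x.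
Proof.
move=> e.
have P u : Num.sg (k1 u) = Num.sg (k2 u) -> (0 < k1 u -> 0 < k2 u) /\ (k1 u < 0 -> k2 u < 0).
  by move=> sgE; split; rewrite -sgr_cp0 sgE sgr_cp0.
have el : \forall u \near x^'-, Num.sg (k1 u) = Num.sg (k2 u) by exact: near_at_left.
have er : \forall u \near x^'+, Num.sg (k1 u) = Num.sg (k2 u) by exact: near_at_right.
move=> [[l rr]|[l rr]]; [left|right]; split.
- by apply: filterS2 el l => u /P[].
- by apply: filterS2 er rr => u /P[].
- by apply: filterS2 el l => u /P[].
- by apply: filterS2 er rr => u /P[].
Qed.

Lemma changes_sign_zero k x : {for x, continuous k} -> changes_sign k x -> k x = 0.
Proof.
move=> ck cs; apply/eqP; apply/negP => /negP; rewrite neq_lt => /orP[k0|k0].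
- have e := near_lt0 ck k0.
  by case: cs => -[l rr]; [apply: at_right_contra (near_at_right e) rr|
    apply: at_left_contra (near_at_left e) l].
- have e := near_gt0 ck k0.
  by case: cs => -[l rr]; [apply: at_left_contra l (near_at_left e)|
    apply: at_right_contra rr (near_at_right e)].
Qed.

End Trigo.

(** * Inflexions, parallel pairs and [S_set] read on the angle *)

Section Curve.
Variable R : realType.
Variables (f : R -> R * R) (r th : R -> R).
Implicit Types (s t u : R).

Hypotheses (f_closed : closed_smooth_curve f) (f_gen : generic f).
Hypotheses (Cr : forall k s, Ck k r s) (Cth : forall k s, Ck k th s)
  (r_neq0 : forall s, r s != 0)
  (f'E : forall s, derive1 f s = (r s * cos (th s), r s * sin (th s))).

Notation w := (derive1 th).

Lemma der_radius s : der r s (derive1 r s).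
Proof. exact: Ck_der. Qed.

Lemma der_angle s : der th s (w s).
Proof. exact: Ck_der. Qed.

Lemma Ck_angle_deriv k s : Ck k w s.
Proof. exact: Ck_deriv. Qed.

Lemma angle_continuous : continuous th.
Proof. by move=> s; exact: Ck_cont (Cth 1%N s). Qed.

Lemma angle_deriv_continuous : continuous w.
Proof. by move=> s; exact: Ck_cont (Ck_angle_deriv 1%N s). Qed.

Lemma curve_derive1n2 s : derive1n 2 f s =
  (derive1 r s * cos (th s) - r s * sin (th s) * w s,
   derive1 r s * sin (th s) + r s * cos (th s) * w s).
Proof.
have -> : derive1n 2 f = derive1 (fun s => (r s * cos (th s), r s * sin (th s))).
  by rewrite -[LHS]/(derive1 (derive1 f)); congr derive1; exact/funext.
have Dc := der_comp (der_angle s) (der_cos _); have Ds := der_comp (der_angle s) (der_sin _).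
apply: derive1_pair.
- by apply: der_eq (derM (der_radius s) Dc) _; rewrite mulNr mulrN mulrA.
- by apply: der_eq (derM (der_radius s) Ds) _; rewrite mulrA.
Qed.

Lemma det_f'_f'' s : det2 (derive1 f s) (derive1n 2 f s) = r s ^+ 2 * w s.
Proof.
rewrite f'E curve_derive1n2 /det2 /=.
have := cos2Dsin2 (th s); set c := cos _; set d := sin _ => e.
transitivity (r s ^+ 2 * w s * (c ^+ 2 + d ^+ 2)); first by ring.
by rewrite e mulr1.
Qed.

Lemma det_f'_f' s t : det2 (derive1 f s) (derive1 f t) = r s * r t * sin (th t - th s).
Proof. by rewrite !f'E /det2 /= sinB; ring. Qed.

Lemma det_f'_par s t : det2 (derive1 f s) (derive1 f t) = 0 <-> par_angle (th s) (th t).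
Proof.
rewrite det_f'_f' par_angle_sym; split => [/eqP|/eqP ->]; last by rewrite mulr0.
by rewrite mulf_eq0 mulf_eq0 !(negbTE (r_neq0 _)).
Qed.

Lemma enorm_derive1_gt0 s : 0 < enorm (derive1 f s).
Proof.
rewrite /enorm sqrtr_gt0 f'E /= !exprMn -mulrDr cos2Dsin2 mulr1.
by rewrite exprn_even_gt0//= r_neq0.
Qed.

Lemma curvature_sg s : Num.sg (curvature f s) = Num.sg (w s).
Proof.
have r2 : 0 < r s ^+ 2 by rewrite exprn_even_gt0//= r_neq0.
have e3 : 0 < (enorm (derive1 f s) ^+ 3)^-1 by rewrite invr_gt0 exprn_gt0// enorm_derive1_gt0.
rewrite /curvature det_f'_f'' sgrM (gtr0_sg e3) mulr1 sgrM (gtr0_sg r2).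
exact: mul1r.
Qed.

Lemma inflexionP s : inflexion f s <-> changes_sign w s.
Proof.
split; apply: changes_sign_near; apply: filterE => u; rewrite curvature_sg//.
Qed.

(** A zero of th' is a zero of the curvature; without a change of sign it would be an undulation,
    which genericity excludes. *)
Lemma inflexion_w0 s : inflexion f s <-> w s = 0.
Proof.
split; first by move/inflexionP/changes_sign_zero; apply; exact: angle_deriv_continuous.
move=> ws; apply: contrapT => ninf; case: f_gen => _ [_ /(_ s)] + _ _ _; apply.
by split=> //; apply/eqP; rewrite -sgr_eq0 curvature_sg ws sgr0.
Qed.

(** Where th' vanishes, det (f', f''') equals r^2 th'', so non-degeneracy of the inflexion says that
    th'' is nonzero. *)
Lemma inflexion_w' s : inflexion f s -> derive1 w s != 0.
Proof.
move=> inf; case: f_gen => _ [/(_ s inf) + _] _ _ _; move/inflexion_w0 in inf.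
apply: contra_not_neq => w's.
have e2 : derive1n 2 f = (fun s => (derive1 r s * cos (th s) - r s * sin (th s) * w s,
   derive1 r s * sin (th s) + r s * cos (th s) * w s)).
  by apply/funext => u; exact: curve_derive1n2.
have Dc := der_comp (der_angle s) (der_cos _); have Ds := der_comp (der_angle s) (der_sin _).
have Dr' : der (derive1 r) s (derive1 (derive1 r) s) by exact: Ck_der (Ck_deriv (Cr 2 s)).
have Dw : der w s (derive1 w s) by exact: Ck_der (Ck_angle_deriv 1 s).
have D1 := derB (derM Dr' Dc) (derM (derM (der_radius s) Ds) Dw).
have D2 := derD (derM Dr' Ds) (derM (derM (der_radius s) Dc) Dw).
move: e2; set c := (X in _ = X) => e2.
have e3 := @derive1_pair _ c s _ _ D1 D2.
rewrite -[derive1n 3 f s]/(derive1 (derive1n 2 f) s) e2 e3.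
by rewrite f'E /det2 /= w's inf; ring.
Qed.

Lemma f_periodic_circ s t : circ s = circ t -> f s = f t /\ derive1 f s = derive1 f t.
Proof.
have per (V : Type) (g : R -> V) (n : nat) u : (forall v, g (v + pi *+ 2) = g v) ->
    g (u + pi *+ 2 *+ n) = g u.
  by move=> gp; elim: n => [|n IH]; rewrite ?mulr0n ?addr0// mulrSr addrA gp.
have perz (V : Type) (g : R -> V) : (forall v, g (v + pi *+ 2) = g v) ->
    circ s = circ t -> g s = g t.
  move=> gp /circ_eqP[n ->]; case: (intP n) => [|m|m]; first by rewrite mulr0z addr0.
    by rewrite -pmulrn per.
  by rewrite -[in RHS](subrK (pi *+ 2 *+ m.+1) t) mulrNz -pmulrn per.
have [fp _] := f_closed.
have f'p v : derive1 f (v + pi *+ 2) = derive1 f v.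
  rewrite /derive1.
  suff -> : (fun h : R => h^-1 *: (f (h + (v + pi *+ 2)) - f (v + pi *+ 2))) =
    (fun h => h^-1 *: (f (h + v) - f v)) by [].
  by apply/funext => h; rewrite addrA !fp.
by move=> st; split; [exact: (perz _ f fp st)|exact: (perz _ _ f'p st)].
Qed.

Lemma circ_par s t : circ s = circ t -> par_angle (th s) (th t).
Proof.
move=> /f_periodic_circ[_ e]; apply/det_f'_par; rewrite e.
by rewrite /det2 mulrC subrr.
Qed.

(** [th] itself need not be periodic: after one turn it changes by a multiple of pi. By continuity
    this multiple is locally constant, so its derivative vanishes. *)
Lemma w_periodic s : w (s + pi *+ 2) = w s.
Proof.
pose g u := th (u + pi *+ 2) - th u.
have Dg u : der g u (w (u + pi *+ 2) - w u).
  have d : der (fun u => u + pi *+ 2) u 1.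
    by apply: der_eq (derD (der_id u) (der_cst _ u)) _; rewrite addr0.
  by apply: der_eq (derB (der_comp d (der_angle _)) (der_angle u)) _; rewrite mulr1.
have ec u : circ (u + pi *+ 2) = circ u :> R * R.
  by apply/circ_eqP; exists 1; rewrite mulr1z.
have lc : \forall u \near s, g u = g s.
  apply: par_angle_locally_cst; first exact: der_continuous (Dg s).
  apply: filterE => u; rewrite /par_angle.
  have := circ_par (ec u); have := circ_par (ec s); rewrite /par_angle -/(g u) -/(g s).
  by move=> /eqP h1 /eqP h2; rewrite sinB h1 h2 mul0r mulr0 subr0.
apply/eqP; rewrite -subr_eq0; apply/eqP.
rewrite -(der_val (Dg s)); apply: der_val.
by apply: der_near (der_cst (g s) s); apply: filterS lc => u ->.
Qed.

Lemma circ_w s t : circ s = circ t -> w s = w t.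
Proof.
move=> /circ_eqP[n ->].
have per (m : nat) u : w (u + pi *+ 2 *+ m) = w u.
  by elim: m => [|m IH]; rewrite ?mulr0n ?addr0// mulrSr addrA w_periodic.
case: (intP n) => [|m|m]; first by rewrite mulr0z addr0.
  by rewrite -pmulrn per.
by rewrite -[in RHS](subrK (pi *+ 2 *+ m.+1) t) mulrNz -pmulrn per.
Qed.

Lemma circ_inflexion s t : circ s = circ t -> inflexion f s -> inflexion f t.
Proof. by move=> st /inflexion_w0; rewrite (circ_w st) => /inflexion_w0. Qed.

(** Distinct parameters with the same image cross transversally, so their tangents cannot be
    parallel. *)
Lemma par_circ_eq s t : f s = f t -> par_angle (th s) (th t) -> circ s = circ t.
Proof.
move=> fst /det_f'_par p; apply: contrapT => nst.
by case: f_gen => _ _ + _ _ => /(_ s t nst fst).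
Qed.

Lemma inflexion_par_circ s t : inflexion f s -> inflexion f t ->
  par_angle (th s) (th t) -> circ s = circ t.
Proof.
move=> si ti p; have [fst|fst] := pselect (f s = f t); first exact: par_circ_eq.
by case: f_gen => _ _ _ /(_ s t) + _; case; split=> //; exact/det_f'_par.
Qed.

Definition special s := exists2 t, inflexion f t & par_angle (th s) (th t).

Lemma special_par s t : special s -> par_angle (th s) (th t) -> special t.
Proof.
move=> [u ui su] st; exists u => //; apply: par_angle_trans su.
by rewrite par_angle_sym.
Qed.

Lemma special_circ s t : special s -> circ s = circ t -> special t.
Proof. by move=> ss /circ_par; exact: special_par. Qed.

Lemma inflexion_special s : inflexion f s -> special s.
Proof. by move=> si; exists s => //; exact: par_angle_refl. Qed.

Lemma angle_functionP s a : angle_function f s a <-> par_angle a (th s - th 0).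
Proof.
rewrite /angle_function /= !f'E /rotate /=.
have -> : (cos a * (r 0 * cos (th 0)) - sin a * (r 0 * sin (th 0)),
    sin a * (r 0 * cos (th 0)) + cos a * (r 0 * sin (th 0))) =
    (r 0 * cos (a + th 0), r 0 * sin (a + th 0)).
  by rewrite cosD sinD; congr (_, _); ring.
have -> : par_angle a (th s - th 0) = par_angle (a + th 0) (th s).
  by rewrite /par_angle opprB addrA.
set b := a + th 0; split.
  move=> [k k0 [e1 e2]]; rewrite /par_angle sinB.
  have {}e1 : r s * cos (th s) = k * (r 0 * cos b) := e1.
  have {}e2 : r s * sin (th s) = k * (r 0 * sin b) := e2.
  have : r s * (sin b * cos (th s) - cos b * sin (th s)) = 0.
    transitivity (sin b * (r s * cos (th s)) - cos b * (r s * sin (th s))); first by ring.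
    by rewrite e1 e2; ring.
  by move/eqP; rewrite mulf_eq0 (negbTE (r_neq0 _)).
move=> /eqP sb; have nc := norm_cos_eq1 (b - th s); rewrite sb eqxx in nc.
pose c := cos (b - th s).
have cc : c * c = 1 by rewrite -expr2 -real_normK ?num_real// (eqP nc) expr1n.
have bE : b = (b - th s) + th s by rewrite subrK.
(* [c] is 1 or -1 and accounts for [b] and [th s] being equal only modulo pi. *)
exists (r s / r 0 * c).
  rewrite mulf_neq0 ?mulf_neq0 ?invr_eq0//.
  by apply/eqP => c0; move: cc; rewrite c0 mul0r => /esym/eqP; rewrite oner_eq0.
rewrite bE (cosD (b - th s)) (sinD (b - th s)) sb !mul0r subr0 add0r -/c /GRing.scale/=.
by congr (_, _); rewrite -[LHS]mulr1 -cc /GRing.scale/=; field.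
Qed.

(** Any continuous lift differs from [th] by a constant near the point, so its critical points are
    zeros of th', that is inflexions. Conversely [th - th 0] is a lift, and non-degeneracy makes its
    second derivative nonzero. *)
Lemma angle_local_extremaP s : angle_local_extrema f (angle_function f s) <-> special s.
Proof.
split.
  move=> [s1 [e [h [hang hcont h'0 _]]]].
  exists s1.
    apply/inflexion_w0.
    pose g u := h u - th u.
    have ch : {for s1, continuous h} by have /nbhs_singleton := hcont.
    have lc : \forall u \near s1, g u = g s1.
      apply: par_angle_locally_cst; first by apply: continuousB => //; exact: angle_continuous.
      have /nbhs_singleton/angle_functionP p1 := hang.
      apply: filterS hang => u /angle_functionP p2.
      move: p1 p2; rewrite /par_angle /g => /eqP p1 /eqP p2.
      have -> : h u - th u - (h s1 - th s1) =
        (h u - (th u - th 0)) - (h s1 - (th s1 - th 0)) by ring.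
      by rewrite sinB p1 p2 mul0r mulr0 subr0.
    have dh : der h s1 (w s1).
      have := derD (der_cst (g s1) s1) (der_angle s1); rewrite add0r.
      by apply: der_near; apply: filterS lc => u <-; rewrite /g subrK.
    by rewrite -(der_val dh).
  have : angle_function f s1 (th s1 - th 0) by apply/angle_functionP/par_angle_refl.
  rewrite e => /angle_functionP; rewrite par_angle_sym /par_angle.
  by have -> : th s - th 0 - (th s1 - th 0) = th s - th s1 by ring.
move=> [t ti st].
exists t; split.
  apply/seteqP; split => a /angle_functionP p; apply/angle_functionP;
    apply: par_angle_trans p _; rewrite /par_angle.
    have -> : th t - th 0 - (th s - th 0) = th t - th s by ring.
    by rewrite -[_ == 0]/(par_angle _ _) par_angle_sym.
  by have -> : th s - th 0 - (th t - th 0) = th s - th t by ring.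
have Dh u : der (fun u => th u - th 0) u (w u).
  by apply: der_eq (derB (der_angle u) (der_cst _ u)) _; rewrite subr0.
have h'E : derive1 (fun u => th u - th 0) = w by apply/funext => u; exact: der_val (Dh u).
exists (fun u => th u - th 0); split.
- by apply: filterE => u; apply/angle_functionP/par_angle_refl.
- by apply: filterE => u; exact: der_continuous (Dh u).
- by rewrite h'E; exact/inflexion_w0.
- by rewrite -[derive1n 2 _]/(derive1 (derive1 _)) h'E; exact/eqP/inflexion_w'.
Qed.

Lemma S_setE : S_set f = @circ R @` [set s | special s].
Proof.
by rewrite /S_set; congr (_ @` _); apply/seteqP; split => s /= /angle_local_extremaP.
Qed.

End Curve.

(** * Counting and the torus *)

Lemma card_finset (T : finType) (U : Type) (X : {set T}) (F : T -> U) :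
  {in X &, injective F} -> F @` [set x | x \in X] #= `I_#|X|.
Proof.
move=> Finj.
have XI : [set x | x \in X] #= `I_#|X|.
  rewrite card_eq_sym.
  have -> : `I_#|X| = (fun x => index x (enum X)) @` [set x | x \in X].
    apply/seteqP; split => i /=.
      move=> iX; have [x0 _] : exists x, x \in X.
        by apply/card_gt0P; rewrite (leq_trans _ iX).
      exists (nth x0 (enum X) i); first by rewrite -mem_enum mem_nth// -cardE.
      by rewrite index_uniq ?enum_uniq// -cardE.
    by move=> [x xX <-]; rewrite cardE index_mem mem_enum.
  apply: inj_card_eq => x y; rewrite !inE => xX yX e.
  by rewrite -[x](@nth_index _ x x (enum X)) ?mem_enum// e nth_index ?mem_enum.
apply: card_eq_trans XI; apply: inj_card_eq => x y; rewrite !inE.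
exact: Finj.
Qed.

Lemma card_finset_eq (T : finType) (U : Type) (X : {set T}) (F : T -> U) (A : set U) n :
  {in X &, injective F} -> A = F @` [set x | x \in X] -> A #= `I_n -> #|X| = n.
Proof.
move=> Finj -> An; apply/card_eq_II; apply: card_eq_trans An.
by rewrite card_eq_sym; exact: card_finset.
Qed.

(** Sorted representatives in [0, 2 pi) give the cut points in cyclic order, so that consecutive
    ones bound the arcs. *)
Lemma enumerate_circ (R : realType) (A : set (R * R)) N : A #= `I_N ->
  A `<=` range (@circ R) ->
  exists s : nat -> R, [/\ forall i j, (i < j < N)%N -> s i < s j,
    forall i, (i < N)%N -> 0 <= s i < pi *+ 2 &
    A = [set circ (s i) | i in `I_N]].
Proof.
rewrite card_eq_sym => /pcard_eqP/bijPex[g [gA ginj gsurj]] Ac.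
have rep i : exists t : R, (i < N)%N -> 0 <= t < pi *+ 2 /\ circ t = g i.
  have [iN|_] := boolP (i < N)%N; last by exists 0.
  have [t0 _ t0E] := Ac _ (gA i iN); have [t tb tE] := circ_rep t0.
  by exists t => _; rewrite -tE.
have {rep} [t tP] := choice rep.
pose sq := sort <=%O [seq t i | i <- iota 0 N].
have tinj : {in gtn N &, injective t}.
  move=> i j; rewrite !inE => iN jN tij; apply: ginj; rewrite ?inE//.
  by rewrite -(tP i iN).2 -(tP j jN).2 tij.
have sz : size sq = N by rewrite size_sort size_map size_iota.
have sq_uniq : uniq sq.
  rewrite sort_uniq map_inj_in_uniq ?iota_uniq// => i j.
  by rewrite !mem_iota !add0n /= => iN jN; exact: tinj.
have mem_sq x : x \in sq <-> exists2 i, (i < N)%N & x = t i.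
  rewrite mem_sort; split => [/mapP[i]|[i iN ->]].
    by rewrite mem_iota add0n => /= iN ->; exists i.
  by apply/mapP; exists i => //; rewrite mem_iota add0n.
have sq_sorted : sorted <%O sq.
  by rewrite lt_sorted_uniq_le sq_uniq sort_le_sorted.
exists (nth 0 sq); split.
- move=> i j /andP[ij jN]; apply: (sorted_ltn_nth lt_trans) => //; rewrite inE sz//.
  exact: ltn_trans jN.
- move=> i iN; have /mem_sq[k kN ->] : nth 0 sq i \in sq by rewrite mem_nth// sz.
  by have [] := tP k kN.
- apply/seteqP; split => x /=.
    move=> /gsurj[k kN <-].
    have tk : t k \in sq by apply/mem_sq; exists k.
    exists (index (t k) sq); first by rewrite /= -sz index_mem.
    by rewrite nth_index// (tP k kN).2.
  move=> [i iN <-].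
  have /mem_sq[k kN ->] : nth 0 sq i \in sq by rewrite mem_nth// sz.
  by rewrite (tP k kN).2; exact: gA.
Qed.

Section TorusTopology.
Variable R : realType.
Implicit Types (s t : R).

Lemma circ_continuous : continuous (@circ R).
Proof. by move=> s; exact: (cvg_pair (@continuous_cos R s) (@continuous_sin R s)). Qed.

Lemma torus_continuous : continuous (@torus R).
Proof.
move=> [s t].
have c1 : circ st.1 @[st --> (s, t)] --> circ s.
  by apply: (cvg_comp fst (@circ R)); [exact: cvg_fst|exact: circ_continuous].
have c2 : circ st.2 @[st --> (s, t)] --> circ t.
  by apply: (cvg_comp snd (@circ R)); [exact: cvg_snd|exact: circ_continuous].
exact: (cvg_pair c1 c2).
Qed.

Lemma within_pair (A : set R) (f g : R -> R) : {within A, continuous f} ->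
  {within A, continuous g} -> {within A, continuous (fun x => (f x, g x))}.
Proof. by move=> cf cg x; exact: (cvg_pair (cf x) (cg x)). Qed.

Lemma within_comp (A B : set R) (f g : R -> R) : {within A, continuous f} ->
  (forall x, A x -> B (f x)) -> {within B, continuous g} ->
  {within A, continuous (g \o f)}.
Proof.
move=> /subspace_continuousP cf fAB /subspace_continuousP cg.
apply/subspace_continuousP => x Ax P /(cg _ (fAB x Ax)) h.
have := cf x Ax _ h; rewrite /nbhs/= /within /=.
by apply: filterS => y + Ay; apply => //; exact: fAB.
Qed.

Lemma within_torus (A : set R) (f : R -> R * R) : {within A, continuous f} ->
  {within A, continuous (@torus R \o f)}.
Proof.
move=> /subspace_continuousP cf; apply/subspace_continuousP => x Ax.
exact: cvg_comp (cf x Ax) (@torus_continuous (f x)).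
Qed.

Lemma torusE (s t s' t' : R) : torus (s, t) = torus (s', t') ->
  circ s = circ s' /\ circ t = circ t'.
Proof. by move=> [e1 e2 e3 e4]; rewrite /circ e1 e2 e3 e4. Qed.

Lemma torus_eq (s t s' t' : R) : circ s = circ s' -> circ t = circ t' ->
  torus (s, t) = torus (s', t').
Proof. by rewrite /torus /= => -> ->. Qed.

Section Components.
Variable T : topologicalType.
Implicit Types (A B C : set T).

Lemma connected_split A B C : closed A -> closed B -> A `&` B = set0 ->
  connected C -> C `<=` A `|` B -> C `&` A !=set0 -> C `<=` A.
Proof.
move=> cA cB AB0 cC CAB [x [Cx Ax]].
have sep : separated A B.
  by split; [rewrite -(closure_id A).1|rewrite -(closure_id B).1].
case: (connected_subset sep CAB cC) => // CB.
by have : (A `&` B) x by [split => //; exact: CB]; rewrite AB0.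
Qed.

End Components.

End TorusTopology.

(** * Arcs, germs and the components of Sigma *)

Section Arcs.
Variable R : realType.
Variables (th w : R -> R) (infl : R -> Prop).
Implicit Types (x y : R).
(** The arcs depend on the curve only through these properties. [infl_two] serves to keep the
    turning of an arc below pi. *)
Hypotheses (Dth : forall x, der th x (w x)) (w_cont : continuous w)
  (infl_w0 : forall x, infl x <-> w x = 0)
  (inflP : forall x, infl x <-> changes_sign w x)
  (circ_par : forall x y, circ x = circ y -> par_angle (th x) (th y))
  (circ_w : forall x y, circ x = circ y -> w x = w y)
  (infl_unique : forall x y, infl x -> infl y -> par_angle (th x) (th y) ->
     circ x = circ y)
  (infl_two : exists x y, [/\ infl x, infl y & ~~ par_angle (th x) (th y)]).

Let spec x := exists2 t, infl t & par_angle (th x) (th t).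

Variables (N : nat) (s : nat -> R).
Hypotheses (s_lt : forall i j, (i < j < N)%N -> s i < s j)
  (s_bound : forall i, (i < N)%N -> 0 <= s i < pi *+ 2)
  (specP : forall x, spec x <-> exists2 i, (i < N)%N & circ x = circ (s i)).

Implicit Types (j k : 'I_N).

Let pi2 : 0 < pi *+ 2 :> R.
Proof. by rewrite mulrn_wgt0// pi_gt0. Qed.

Let N_gt0 : (0 < N)%N.
Proof.
have [x [_ [xi _ _]]] := infl_two.
have /specP[i iN _] : spec x by exists x => //; exact: par_angle_refl.
exact: leq_ltn_trans iN.
Qed.

Lemma s_le (i j : nat) : (i <= j)%N -> (j < N)%N -> s i <= s j.
Proof.
rewrite leq_eqVlt => /orP[/eqP ->//|ij] jN.
by rewrite ltW// s_lt// ij.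
Qed.

Definition arc_l j := s j.
(** The last arc wraps around the circle; lifting its right end by 2 pi makes every arc an ordinary
    interval. *)
Definition arc_r j := if (j.+1 < N)%N then s j.+1 else s 0 + pi *+ 2.

Lemma arc_lr j : arc_l j < arc_r j.
Proof.
rewrite /arc_l /arc_r; case: ifP => jN; first by rewrite s_lt// ltnS leqnn.
have /andP[s0 _] := s_bound N_gt0; have /andP[_ sj] := s_bound (ltn_ord j).
by rewrite (lt_le_trans sj)// lerDr.
Qed.

Lemma arc_r_le j (i : nat) : (j < i)%N -> (i < N)%N -> arc_r j <= s i.
Proof. by move=> ji iN; rewrite /arc_r (leq_ltn_trans ji iN); exact: s_le. Qed.

Lemma arc_l_ge j : s 0 <= arc_l j.
Proof. exact: s_le. Qed.

Lemma arc_r_bound j : arc_r j <= s 0 + pi *+ 2.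
Proof.
rewrite /arc_r; case: ifP => // jN.
have /andP[s0 _] := s_bound N_gt0; have /andP[_ sj] := s_bound jN.
by rewrite (le_trans (ltW sj))// lerDr.
Qed.

Lemma special_circ_eq x y : spec x -> circ x = circ y -> spec y.
Proof. by move=> /specP[i iN xi] xy; apply/specP; exists i => //; rewrite -xy. Qed.

Lemma spec_par x y : spec x -> par_angle (th x) (th y) -> spec y.
Proof.
move=> [u ui su] st; exists u => //; apply: par_angle_trans su.
by rewrite par_angle_sym.
Qed.

Lemma infl_spec x : infl x -> spec x.
Proof. by move=> xi; exists x => //; exact: par_angle_refl. Qed.

Lemma spec_s i : (i < N)%N -> spec (s i).
Proof. by move=> iN; apply/specP; exists i. Qed.

Lemma arc_not_spec j x : arc_l j < x < arc_r j -> ~ spec x.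
Proof.
move=> /andP[jx xj] /specP[i iN xi].
have xs : x = s i.
  apply: circ_small xi _.
  have h1 := lt_le_trans xj (arc_r_bound j); have h2 := le_lt_trans (arc_l_ge j) jx.
  have h3 := s_le (leq0n i) iN.
  have /andP[s0 _] := s_bound N_gt0; have /andP[_ si] := s_bound iN.
  by rewrite ltr_norml; apply/andP; split; lra.
move: jx xj; rewrite xs => h1 h2; have [ij|ji] := leqP i j.
  by move: h1; rewrite ltNge (s_le ij).
by move: h2; rewrite ltNge (arc_r_le ji iN).
Qed.

Lemma arc_cover x : exists j y, arc_l j <= y < arc_r j /\ circ x = circ y.
Proof.
have [t /andP[t0 t1] tE] := circ_rep (x - s 0).
pose y := t + s 0.
have ys : s 0 <= y by rewrite lerDr.
have xy : circ x = circ y.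
  move/circ_eqP : tE => [n nE]; apply/circ_eqP; exists n.
  by rewrite /y addrAC -nE subrK.
pose P (i : 'I_N) := s i <= y.
have P0 : P (Ordinal N_gt0) by [].
case: (@arg_maxnP _ (Ordinal N_gt0) P (fun i => i) P0) => j Pj jmax.
exists j, y; split=> //; apply/andP; split => //; rewrite /arc_r.
case: ifP => jN; last by rewrite /y addrC ltrD2l.
rewrite ltNge; apply/negP => Psj.
by have := jmax (Ordinal jN) Psj; rewrite /= ltnn.
Qed.

Lemma arc_interior_unique j k x y : arc_l j < x < arc_r j ->
  arc_l k <= y <= arc_r k -> circ x = circ y -> j = k /\ x = y.
Proof.
move=> /andP[jx xj] /andP[ky yk] xy.
have h1 := lt_le_trans xj (arc_r_bound j); have h2 := le_lt_trans (arc_l_ge j) jx.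
have h3 := le_trans yk (arc_r_bound k); have h4 := le_trans (arc_l_ge k) ky.
have e : x = y by apply: circ_small xy _; rewrite ltr_norml; apply/andP; split; lra.
split=> //; apply/val_inj; move: ky yk; rewrite -e => ky yk.
have [jk|kj|//] := ltngtP j k.
- by have := arc_r_le jk (ltn_ord k); rewrite leNgt (le_lt_trans ky xj).
- have := arc_r_le kj (ltn_ord j).
  by move=> /(le_trans yk); rewrite leNgt jx.
Qed.

Lemma circ_arc_r j : circ (arc_r j) = circ (s (ordS j)).
Proof.
rewrite /arc_r /=; case: ifP => jN; first by rewrite modn_small.
have -> : j.+1 = N by apply/eqP; rewrite eqn_leq ltn_ord leqNgt jN.
by rewrite modnn; apply/circ_eqP; exists 1; rewrite mulr1z.
Qed.

Lemma circ_s_inj (i j : nat) : (i < N)%N -> (j < N)%N -> circ (s i) = circ (s j) -> i = j.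
Proof.
move=> iN jN e.
have sij : s i = s j.
  apply: circ_small e _.
  have /andP[a1 a2] := s_bound iN; have /andP[a3 a4] := s_bound jN.
  by rewrite ltr_norml; apply/andP; split; lra.
have [ij|ji|//] := ltngtP i j.
  by have := @s_lt i j; rewrite ij jN sij ltxx => /(_ isT).
by have := @s_lt j i; rewrite ji iN sij ltxx => /(_ isT).
Qed.

Definition arc_inc j := th (arc_l j) < th (arc_r j).

Lemma th_continuous : continuous th.
Proof. by move=> x; exact: der_continuous (Dth x). Qed.

Lemma arc_w_neq0 j x : arc_l j < x < arc_r j -> w x != 0.
Proof.
by move=> jx; apply/eqP => wx; apply: (arc_not_spec jx); apply/infl_spec/infl_w0.
Qed.

Lemma arc_w_sign j x y : arc_l j < x < arc_r j -> arc_l j < y < arc_r j ->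
  0 < w x -> 0 < w y.
Proof.
move=> jx jy wx; rewrite lt_neqAle eq_sym (arc_w_neq0 jy)/= leNgt; apply/negP => wy.
have mem z : Num.min x y <= z <= Num.max x y -> w z != 0.
  move=> /andP[z1 z2]; apply: (@arc_w_neq0 j).
  move: jx jy z1 z2 => /andP[? ?] /andP[? ?].
  by case: (leP x y) => ? ? ?; apply/andP; split; lra.
have cw : {within `[Num.min x y, Num.max x y], continuous w} by exact: continuous_subspaceT.
have xy : Num.min x y <= Num.max x y by case: (leP x y) => // /ltW.
have [|z] := @IVT R w (Num.min x y) (Num.max x y) 0 xy cw.
  case: (leP x y) => _; rewrite ?(ltW wx) ?(ltW wy) ?andbT.
    by rewrite ge_min le_max (ltW wx) (ltW wy) orbT.
  by rewrite ge_min le_max (ltW wx) (ltW wy) orbT.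
by rewrite in_itv/= => /mem /eqP.
Qed.

Lemma arc_mono j :
  (arc_inc j /\ {in `[arc_l j, arc_r j]%R &, {mono th : x y / x < y}} /\
    forall x, arc_l j < x < arc_r j -> 0 < w x) \/
  (~~ arc_inc j /\ {in `[arc_l j, arc_r j]%R &, {mono th : x y /~ x < y}} /\
    forall x, arc_l j < x < arc_r j -> w x < 0).
Proof.
have lr := arc_lr j; pose m := (arc_l j + arc_r j) / 2.
have mj : arc_l j < m < arc_r j by rewrite /m; apply/andP; split; lra.
have c : {within `[arc_l j, arc_r j], continuous th}.
  by apply: continuous_subspaceT; exact: th_continuous.
have lmem : arc_l j \in `[arc_l j, arc_r j]%R by rewrite bound_itvE ltW.
have rmem : arc_r j \in `[arc_l j, arc_r j]%R by rewrite bound_itvE ltW.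
have [wm|wm] := ltP 0 (w m).
- have pos x : arc_l j < x < arc_r j -> 0 < w x by move=> jx; exact: arc_w_sign mj jx wm.
  have mono : {in `[arc_l j, arc_r j]%R &, {homo th : x y / x < y}}.
    apply: gtr0_derive1_lt_cc c => x; rewrite in_itv/= => jx.
      exact: der_derivable (Dth x).
    by rewrite (der_val (Dth x)) pos.
  left; split; [exact: mono|split=> //].
  exact/leW_mono_in/le_mono_in.
- have wm' : w m < 0 by rewrite lt_neqAle wm (arc_w_neq0 mj).
  have neg x : arc_l j < x < arc_r j -> w x < 0.
    move=> jx; rewrite lt_neqAle (arc_w_neq0 jx)/= leNgt; apply/negP => wx.
    by have := arc_w_sign jx mj wx; rewrite ltNge wm.
  have mono : {in `[arc_l j, arc_r j]%R &, {homo th : x y /~ x < y}}.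
    apply: ltr0_derive1_lt_cc c => x; rewrite in_itv/= => jx.
      exact: der_derivable (Dth x).
    by rewrite (der_val (Dth x)) neg.
  right; split; [by rewrite /arc_inc -leNgt ltW// mono|split=> //].
  exact/leW_nmono_in/le_nmono_in.
Qed.

Definition arc_lo j := if arc_inc j then th (arc_l j) else th (arc_r j).
Definition arc_hi j := if arc_inc j then th (arc_r j) else th (arc_l j).

Lemma arc_inj j x y : arc_l j <= x <= arc_r j -> arc_l j <= y <= arc_r j ->
  th x = th y -> x = y.
Proof.
move=> jx jy e; case: (arc_mono j) => -[_ [mono _]].
- have [xy|yx|//] := ltgtP x y.
    by have := mono x y; rewrite !in_itv/= jx jy e ltxx xy => /(_ isT isT).
  by have := mono y x; rewrite !in_itv/= jx jy e ltxx yx => /(_ isT isT).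
- have [xy|yx|//] := ltgtP x y.
    by have := mono y x; rewrite !in_itv/= jx jy e ltxx xy => /(_ isT isT).
  by have := mono x y; rewrite !in_itv/= jx jy e ltxx yx => /(_ isT isT).
Qed.

Lemma arc_lo_hi j : arc_lo j < arc_hi j.
Proof.
rewrite /arc_lo /arc_hi; case: (arc_mono j) => -[i [mono _]].
  by rewrite i; exact: i.
rewrite (negbTE i) mono ?bound_itvE ?arc_lr// ltW ?arc_lr//.
Qed.

Lemma arc_interior_value j x : arc_l j < x < arc_r j -> arc_lo j < th x < arc_hi j.
Proof.
have lr := ltW (arc_lr j); move=> /andP[jx xj].
rewrite /arc_lo /arc_hi; case: (arc_mono j) => -[i [mono _]].
  by rewrite i !mono ?bound_itvE// ?jx ?xj// in_itv/= !ltW.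
by rewrite (negbTE i) !mono ?bound_itvE// ?jx ?xj// in_itv/= !ltW.
Qed.

Lemma arc_value_ex j v : arc_lo j < v < arc_hi j ->
  exists2 x, arc_l j < x < arc_r j & th x = v.
Proof.
have lr := arc_lr j; have lh := arc_lo_hi j; move=> /andP[lv vh].
have c : {within `[arc_l j, arc_r j], continuous th}.
  by apply: continuous_subspaceT; exact: th_continuous.
have [|x xj xv] := @IVT R th (arc_l j) (arc_r j) v (ltW lr) c.
  move: lh lv vh; rewrite /arc_lo /arc_hi; case: (arc_inc j) => lh lv vh.
    by rewrite ge_min le_max (ltW lv) (ltW vh) ?orbT.
  by rewrite ge_min le_max (ltW lv) (ltW vh) ?orbT.
exists x => //; move: xj; rewrite in_itv/= => /andP[xl xr].
rewrite !lt_neqAle xl xr !andbT; apply/andP; split; apply/eqP => e;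
  move: lv vh; rewrite -xv; [rewrite -e|rewrite e]; rewrite /arc_lo /arc_hi;
  by case: ifP; rewrite ltxx.
Qed.

(** An intermediate value is attained inside the arc, away from the cut points, and being special
    depends on the direction only. The comparisons of arcs below rest on this: a translate of an end
    value by a multiple of pi cannot fall strictly inside the range of an arc. *)
Lemma arc_value_not_spec j v u : arc_lo j < v < arc_hi j -> spec u ->
  ~~ par_angle v (th u).
Proof.
move=> /arc_value_ex[x jx <-] su; apply/negP => p; apply: (arc_not_spec jx).
by apply: spec_par su _; rewrite par_angle_sym.
Qed.

Lemma spec_l j : spec (arc_l j).
Proof. exact: spec_s. Qed.

Lemma spec_r j : spec (arc_r j).
Proof. exact: special_circ_eq (spec_s (ltn_ord _)) (esym (circ_arc_r j)). Qed.

Lemma spec_lo j : exists2 u, spec u & th u = arc_lo j.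
Proof.
by rewrite /arc_lo; case: ifP => _; [exists (arc_l j)|exists (arc_r j)];
  rewrite //; [exact: spec_l|exact: spec_r].
Qed.

Lemma spec_hi j : exists2 u, spec u & th u = arc_hi j.
Proof.
by rewrite /arc_hi; case: ifP => _; [exists (arc_r j)|exists (arc_l j)];
  rewrite //; [exact: spec_r|exact: spec_l].
Qed.

Lemma par_angle_shift (x y a : R) : par_angle x y -> par_angle (a + (x - y)) a.
Proof. by rewrite /par_angle addrAC subrr add0r. Qed.

Lemma par_angle_rep (a v : R) : ~~ par_angle a v ->
  exists2 v', a < v' < a + pi & par_angle v' v.
Proof.
move=> nav; have p0 := pi_gt0 R.
pose n := Num.floor ((v - a) / pi); pose v' := v - pi *~ n.
have p : par_angle v' v.
  rewrite /par_angle /v' addrAC subrr add0r sinN oppr_eq0.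
  have sp m : sin (pi *+ m) = 0 :> R.
    by elim: m => [|m IH]; rewrite ?mulr0n ?sin0// mulrS addrC sinD sinpi IH mul0r mulr0 addr0.
  by case: (intP n) => [|m|m]; rewrite ?mulr0z ?sin0 ?mulrNz ?sinN -?pmulrn ?sp ?oppr0.
exists v' => //.
have /andP[] := real_floor_itv (num_real ((v - a) / pi)).
rewrite ltr_pdivrMr// ler_pdivlMr// -/n intrD mulrDl mul1r => h1 h2.
have h3 : a <= v' by rewrite /v' -mulrzl; lra.
apply/andP; split; last by rewrite /v' -mulrzl; lra.
rewrite lt_neqAle h3 andbT; apply: contraNneq nav => ->; exact: p.
Qed.

(** An arc of width at least pi would take, strictly inside, every direction not parallel to its low
    end, and at least one of two non-parallel inflexions has such a direction. *)
Lemma arc_width j : arc_hi j - arc_lo j < pi.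
Proof.
rewrite ltNge; apply/negP => le_pi.
have [u ui nu] : exists2 u, infl u & ~~ par_angle (arc_lo j) (th u).
  have [x [y [xi yi nxy]]] := infl_two.
  have [px|nx] := boolP (par_angle (arc_lo j) (th x)); last by exists x.
  exists y => //; apply: contra nxy => py.
  by apply: par_angle_trans py; rewrite par_angle_sym.
have [v /andP[v1 v2] pv] := par_angle_rep nu.
have : ~~ par_angle v (th u).
  by apply: (@arc_value_not_spec j); [apply/andP; split; lra|exact: infl_spec].
by rewrite pv.
Qed.

Lemma arc_par_inj j x y : arc_l j < x < arc_r j -> arc_l j < y < arc_r j ->
  par_angle (th x) (th y) -> x = y.
Proof.
move=> jx jy p; have wd := arc_width j.
have /andP[x1 x2] := arc_interior_value jx; have /andP[y1 y2] := arc_interior_value jy.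
have e : th x = th y.
  by apply: par_angle_small p _; rewrite ltr_norml; apply/andP; split; lra.
by apply: (@arc_inj j) e; [move: jx|move: jy] => /andP[? ?]; rewrite !ltW.
Qed.

(** If one arc were narrower, its high end, moved by the difference of the low ends, would lie
    strictly inside the range of the other. *)
Lemma arc_lo_par j k : par_angle (arc_lo j) (arc_lo k) ->
  arc_hi j - arc_lo j = arc_hi k - arc_lo k.
Proof.
suff H j' k' : par_angle (arc_lo j') (arc_lo k') ->
    ~ (arc_hi j' - arc_lo j' < arc_hi k' - arc_lo k').
  move=> p; have p' := p; rewrite par_angle_sym in p'.
  by have := H _ _ p; have := H _ _ p'; case: ltgtP.
move=> p lt; have lh := arc_lo_hi j'.
have [u su uE] := spec_hi j'.
have : ~~ par_angle (arc_hi j' + (arc_lo k' - arc_lo j')) (th u).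
  by apply: (@arc_value_not_spec k') => //; apply/andP; split; lra.
by rewrite uE par_angle_shift// par_angle_sym.
Qed.

Lemma arc_hi_par j k : par_angle (arc_hi j) (arc_hi k) ->
  arc_hi j - arc_lo j = arc_hi k - arc_lo k.
Proof.
suff H j' k' : par_angle (arc_hi j') (arc_hi k') ->
    ~ (arc_hi j' - arc_lo j' < arc_hi k' - arc_lo k').
  move=> p; have p' := p; rewrite par_angle_sym in p'.
  by have := H _ _ p; have := H _ _ p'; case: ltgtP.
move=> p lt; have lh := arc_lo_hi j'.
have [u su uE] := spec_lo j'.
have : ~~ par_angle (arc_lo j' + (arc_hi k' - arc_hi j')) (th u).
  by apply: (@arc_value_not_spec k') => //; apply/andP; split; lra.
by rewrite uE par_angle_shift// par_angle_sym.
Qed.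

(** If two parallel points were at different heights above the low ends of their arcs, the low end
    of the arc with the smaller height would be carried strictly inside the range of the other. *)
Lemma arc_match j k x y : arc_l j < x < arc_r j -> arc_l k < y < arc_r k ->
  par_angle (th x) (th y) -> th x - th y = arc_lo j - arc_lo k.
Proof.
suff H j' k' x' y' : arc_l j' < x' < arc_r j' -> arc_l k' < y' < arc_r k' ->
    par_angle (th x') (th y') -> ~ (th x' - th y' < arc_lo j' - arc_lo k').
  move=> jx ky p; have p' := p; rewrite par_angle_sym in p'.
  have h1 := H _ _ _ _ jx ky p; have h2 := H _ _ _ _ ky jx p'.
  by apply/eqP; rewrite eq_le !leNgt; apply/andP; split; apply/negP => h;
    [apply: h2; lra|apply: h1].
move=> jx ky p lt.
have /andP[x1 x2] := arc_interior_value jx; have /andP[y1 y2] := arc_interior_value ky.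
have [u su uE] := spec_lo j'.
have : ~~ par_angle (arc_lo j' + (th y' - th x')) (th u).
  by apply: (@arc_value_not_spec k') => //; apply/andP; split; lra.
by rewrite uE par_angle_shift// par_angle_sym.
Qed.

(** * Germs at the cut points *)

Notation germ := ('I_N * bool)%type.
Implicit Types h : germ.

Definition germ_pt h := if h.2 then arc_r h.1 else arc_l h.1.
Definition germ_al h : germ := (h.1, ~~ h.2).
Definition germ_ga h : germ :=
  if h.2 then (ordS h.1, false) else (ord_pred h.1, true).
Definition germ_up h := th (germ_pt h) < th (germ_pt (germ_al h)).
Definition germ_par (h k : germ) := par_angle (th (germ_pt h)) (th (germ_pt k)).

Lemma germ_alK : involutive germ_al.
Proof. by case=> j b; rewrite /germ_al /= negbK. Qed.

Lemma germ_gaK : involutive germ_ga.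
Proof. by case=> j [] /=; rewrite /germ_ga /= ?ordSK ?ord_predK. Qed.

Lemma germ_side_ga h : (germ_ga h).2 = ~~ h.2.
Proof. by case: h => j []. Qed.

Lemma germ_upE h : germ_up h = if h.2 then ~~ arc_inc h.1 else arc_inc h.1.
Proof.
case: h => j [] /=; rewrite /germ_up /germ_pt /= -/(arc_inc j) //.
have lr := ltW (arc_lr j); case: (arc_mono j) => -[i [mono _]].
  by rewrite i; apply/negbTE; rewrite -leNgt ltW.
by rewrite i mono ?bound_itvE// arc_lr.
Qed.

Lemma germ_up_al h : germ_up (germ_al h) = ~~ germ_up h.
Proof. by rewrite !germ_upE; case: h => j [] //=; rewrite negbK. Qed.

Lemma germ_pt_up h : germ_up h -> th (germ_pt h) = arc_lo h.1 /\
  th (germ_pt (germ_al h)) = arc_hi h.1.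
Proof.
by rewrite germ_upE /arc_lo /arc_hi; case: h => j [] /= i; rewrite /germ_pt /=
  ?i ?(negbTE i).
Qed.

Lemma germ_pt_down h : ~~ germ_up h -> th (germ_pt h) = arc_hi h.1 /\
  th (germ_pt (germ_al h)) = arc_lo h.1.
Proof. by rewrite -germ_up_al => /germ_pt_up[]; rewrite germ_alK. Qed.

(** Arcs with parallel starting ends and the same direction of variation turn by the same amount, so
    the difference of angles is equal at both ends, not merely congruent modulo pi. *)
Lemma germ_par_al (h k : germ) : germ_par h k -> germ_up h = germ_up k ->
  th (germ_pt (germ_al h)) - th (germ_pt (germ_al k)) =
  th (germ_pt h) - th (germ_pt k).
Proof.
rewrite /germ_par => p; have [hu /esym ku|hd /esym/negbT kd] := boolP (germ_up h).
- have [h1 h2] := germ_pt_up hu; have [k1 k2] := germ_pt_up ku.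
  move: p; rewrite h1 h2 k1 k2 => /arc_lo_par; lra.
- have [h1 h2] := germ_pt_down hd; have [k1 k2] := germ_pt_down kd.
  move: p; rewrite h1 h2 k1 k2 => /arc_hi_par; lra.
Qed.

Lemma germ_vertexP (h k : germ) : circ (germ_pt h) = circ (germ_pt k) ->
  k = h \/ k = germ_ga h.
Proof.
pose v (g : germ) := if g.2 then ordS g.1 else g.1.
have vE g : circ (germ_pt g) = circ (s (v g)).
  by case: g => j [] //; rewrite /germ_pt /= circ_arc_r.
rewrite !vE => /circ_s_inj e; have /val_inj {e} : val (v h) = val (v k).
  by apply: e; exact: ltn_ord.
case: h k => [j []] [k []]; rewrite /v /germ_ga /= => e.
- by left; rewrite (ordS_inj e).
- by right; rewrite e.
- by right; rewrite e ordSK.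
- by left; rewrite e.
Qed.

Lemma circ_germ_ga h : circ (germ_pt (germ_ga h)) = circ (germ_pt h).
Proof.
case: h => j []; rewrite /germ_pt /germ_ga /= circ_arc_r//.
by rewrite ord_predK.
Qed.

Lemma germ_spec h : spec (germ_pt h).
Proof. by case: h => j []; [exact: spec_r|exact: spec_l]. Qed.

Lemma germ_par_refl (h k : germ) : circ (germ_pt h) = circ (germ_pt k) -> germ_par h k.
Proof. exact: circ_par. Qed.

Let sign_left j : if arc_inc j then \forall u \near (arc_r j)^'-, 0 < w u
  else \forall u \near (arc_r j)^'-, w u < 0.
Proof.
have nl : \forall u \near (arc_r j)^'-, arc_l j < u < arc_r j.
  have a : \forall u \near (arc_r j)^'-, arc_l j < u.
    by apply: nbhs_left_gt; exact: arc_lr.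
  have b : \forall u \near (arc_r j)^'-, u < arc_r j by exact: nbhs_left_lt.
  by apply: filterS2 a b => u -> ->.
by case: (arc_mono j) => -[i [_ ws]]; rewrite ?i ?(negbTE i);
  apply: filterS nl => u; exact: ws.
Qed.

Let sign_right j : if arc_inc (ordS j) then \forall u \near (arc_r j)^'+, 0 < w u
  else \forall u \near (arc_r j)^'+, w u < 0.
Proof.
set k := ordS j; have lr := arc_lr k.
have nl : \forall u \near (arc_r j)^'+,
    exists2 v, arc_l k < v < arc_r k & w u = w v.
  have a : \forall u \near (arc_r j)^'+, u < arc_r j + (arc_r k - arc_l k).
    by apply: nbhs_right_lt; lra.
  have b : \forall u \near (arc_r j)^'+, arc_r j < u by exact: nbhs_right_gt.
  (* On the line the arc following [j] may start one full turn earlier, hence the translation and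
     the use of [circ_w]. *)
  apply: filterS2 a b => u u1 u2; exists (u - (arc_r j - arc_l k)).
    by apply/andP; split; lra.
  apply: circ_w; have /circ_eqP[n nE] := circ_arc_r j; apply/circ_eqP; exists n.
  rewrite -/k -/(arc_l k) in nE; rewrite nE; lra.
by case: (arc_mono k) => -[i [_ ws]]; rewrite ?i ?(negbTE i);
  apply: filterS nl => u [v kv ->]; exact: ws.
Qed.

Lemma infl_arc_r j : infl (arc_r j) <-> arc_inc (ordS j) = ~~ arc_inc j.
Proof.
rewrite inflP; have := sign_left j; have := sign_right j.
case: (arc_inc j); case: (arc_inc (ordS j)) => rr l; split=> //.
- by case=> -[l' r']; [case: (at_left_contra l' l)|case: (at_right_contra r' rr)].
- by right.
- by left.
- by case=> -[l' r']; [case: (at_right_contra rr r')|case: (at_left_contra l l')].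
Qed.

Lemma circ_infl x y : circ x = circ y -> infl x -> infl y.
Proof. by move=> xy /infl_w0; rewrite (circ_w xy) => /infl_w0. Qed.

Lemma germ_foldP h : fold germ_ga germ_up h <-> infl (germ_pt h).
Proof.
have fold_r j : fold germ_ga germ_up (j, true) <-> infl (arc_r j).
  rewrite infl_arc_r /fold !germ_upE /germ_ga /=.
  by case: (arc_inc j); case: (arc_inc _).
case: h => j []; first exact: fold_r.
have e : germ_ga (ord_pred j, true) = (j, false) by rewrite /germ_ga /= ord_predK.
rewrite -e fold_ga ?fold_r; last exact: germ_gaK.
by split; apply: circ_infl; rewrite circ_germ_ga.
Qed.

Lemma germ_fold_unique (h k : germ) : fold germ_ga germ_up h ->
  fold germ_ga germ_up k -> germ_par h k -> k = h \/ k = germ_ga h.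
Proof.
by move=> /germ_foldP hi /germ_foldP ki p; apply: germ_vertexP; exact: infl_unique.
Qed.

Lemma germ_par_sym : symmetric germ_par.
Proof. by move=> h k; exact: par_angle_sym. Qed.

Lemma germ_par_trans : transitive germ_par.
Proof. by move=> k h g; exact: par_angle_trans. Qed.

Lemma germ_par_ga h : germ_par h (germ_ga h).
Proof. by apply: germ_par_refl; rewrite circ_germ_ga. Qed.

Lemma germ_par_al' (h k : germ) : germ_par h k -> germ_up h = germ_up k ->
  germ_par (germ_al h) (germ_al k).
Proof. by move=> p u; rewrite /germ_par /par_angle germ_par_al. Qed.

Lemma arc_lo_min j : arc_lo j = Num.min (th (arc_l j)) (th (arc_r j)).
Proof.
have := arc_lo_hi j; rewrite /arc_lo /arc_hi /arc_inc.
by case: (ltgtP (th (arc_l j))) => //= -> //; rewrite ltxx.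
Qed.

Lemma arc_hi_max j : arc_hi j = Num.max (th (arc_l j)) (th (arc_r j)).
Proof.
have := arc_lo_hi j; rewrite /arc_lo /arc_hi /arc_inc.
by case: (ltgtP (th (arc_l j))) => //= -> //; rewrite ltxx.
Qed.

Lemma arc_value j x : arc_l j <= x <= arc_r j -> arc_lo j <= th x <= arc_hi j.
Proof.
have lh := ltW (arc_lo_hi j); move=> /andP[].
rewrite le_eqVlt => /orP[/eqP <- _|jx].
  by move: lh; rewrite /arc_lo /arc_hi; case: ifP => _; rewrite lexx// => ->.
rewrite le_eqVlt => /orP[/eqP ->|xj].
  by move: lh; rewrite /arc_lo /arc_hi; case: ifP => _; rewrite lexx ?andbT// => ->.
have /arc_interior_value/andP[? ?] : arc_l j < x < arc_r j by rewrite jx.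
by rewrite !ltW.
Qed.

Lemma arc_value_surj j v : arc_lo j <= v <= arc_hi j ->
  exists2 x, arc_l j <= x <= arc_r j & th x = v.
Proof.
rewrite arc_lo_min arc_hi_max => vj.
have c : {within `[arc_l j, arc_r j], continuous th}.
  by apply: continuous_subspaceT; exact: th_continuous.
have [x xj xv] := IVT (ltW (arc_lr j)) c vj.
by exists x => //; move: xj; rewrite in_itv.
Qed.

(** * The arcs of Sigma attached to darts *)

Implicit Types d : germ * germ.
Notation dts := (darts germ_up germ_par).

Definition dart_shift d := th (germ_pt d.1) - th (germ_pt d.2).
(** An exact equation replaces parallelism modulo pi; for a dart this makes the edge the graph of a
    continuous function over its first arc. *)
Definition edge d : set (R * R) :=
  [set st | [/\ arc_l d.1.1 <= st.1 <= arc_r d.1.1,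
                arc_l d.2.1 <= st.2 <= arc_r d.2.1 &
                th st.1 - th st.2 = dart_shift d]].
Definition dart_arc d := @torus R @` edge d.
Definition dart_pt d := torus (germ_pt d.1, germ_pt d.2).
Definition off_diag := @torus R @`
  [set st | circ st.1 <> circ st.2 /\ par_angle (th st.1) (th st.2)].
Definition Sig := closure off_diag.

Lemma germ_pt_in h : arc_l h.1 <= germ_pt h <= arc_r h.1.
Proof.
have lr := ltW (arc_lr h.1).
by rewrite /germ_pt; case: ifP; rewrite lr lexx.
Qed.

Lemma edge_pt d : edge d (germ_pt d.1, germ_pt d.2).
Proof. by split; rewrite /= ?germ_pt_in. Qed.

Lemma dart_arc_pt d : dart_arc d (dart_pt d).
Proof. by eexists; [exact: edge_pt|]. Qed.

Lemma dartP d : d \in dts -> [/\ germ_par d.1 d.2, germ_up d.1 = germ_up d.2 &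
  d.1 <> d.2].
Proof. by rewrite inE => /and3P[p /eqP u /eqP n]. Qed.

Lemma dart_shift_lo d : d \in dts ->
  dart_shift d = arc_lo d.1.1 - arc_lo d.2.1.
Proof.
move=> /dartP[p u _]; rewrite /dart_shift.
have [hu|hd] := boolP (germ_up d.1).
  have ku := hu; rewrite u in ku.
  by rewrite (germ_pt_up hu).1 (germ_pt_up ku).1.
have kd := hd; rewrite u in kd.
by rewrite -(germ_par_al p u) (germ_pt_down hd).2 (germ_pt_down kd).2.
Qed.

Lemma dart_shift_hi d : d \in dts ->
  dart_shift d = arc_hi d.1.1 - arc_hi d.2.1.
Proof.
move=> /dartP[p u _]; rewrite /dart_shift.
have [hu|hd] := boolP (germ_up d.1).
  have ku := hu; rewrite u in ku.
  by rewrite -(germ_par_al p u) (germ_pt_up hu).2 (germ_pt_up ku).2.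
have kd := hd; rewrite u in kd.
by rewrite (germ_pt_down hd).1 (germ_pt_down kd).1.
Qed.

Lemma dart_shift_al d : d \in dts -> dart_shift (dart_al germ_al d) = dart_shift d.
Proof. by move=> /dartP[p u _]; rewrite /dart_shift germ_par_al. Qed.

Lemma dart_arc_al d : d \in dts -> dart_arc (dart_al germ_al d) = dart_arc d.
Proof.
by move=> dD; rewrite /dart_arc /edge dart_shift_al.
Qed.

Lemma edge_par d st : d \in dts -> edge d st -> par_angle (th st.1) (th st.2).
Proof. by move=> /dartP[p _ _] [_ _ e]; rewrite /par_angle e. Qed.

Lemma edge_inj d x y y' : edge d (x, y) -> edge d (x, y') -> y = y'.
Proof.
move=> [/= _ ky e1] [/= _ ky' e2]; apply: arc_inj ky ky' _.
by apply: (can_inj (subKr (th x))); rewrite e1 e2.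
Qed.

(** Low ends and high ends of the two ranges correspond under the shift, so the inverse of the
    strictly monotone [th] on the second arc is defined at every [th x - dart_shift d]. *)
Lemma edge_param d : d \in dts -> exists p : R -> R,
  {within `[arc_l d.1.1, arc_r d.1.1], continuous p} /\
  forall x, arc_l d.1.1 <= x <= arc_r d.1.1 -> edge d (x, p x).
Proof.
move=> dD; set j := d.1.1; set k := d.2.1.
pose g v := xget 0 [set y | arc_l k <= y <= arc_r k /\ th y = v].
have gE v : arc_lo k <= v <= arc_hi k -> arc_l k <= g v <= arc_r k /\ th (g v) = v.
  by move=> /arc_value_surj[y ky yv]; rewrite /g; case: xgetP => [z _ //|/(_ y)[]].
have gK : {in `[arc_l k, arc_r k]%R, cancel th g}.
  move=> y; rewrite in_itv/= => ky; have [gy thg] := gE _ (arc_value ky).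
  exact: arc_inj gy ky thg.
have c : {within `[arc_l k, arc_r k], continuous th}.
  by apply: continuous_subspaceT; exact: th_continuous.
have cg := segment_can_continuous (ltW (arc_lr k)) c gK.
have val x : arc_l j <= x <= arc_r j -> arc_lo k <= th x - dart_shift d <= arc_hi k.
  move=> /arc_value/andP[x1 x2]; have e1 := dart_shift_lo dD; have e2 := dart_shift_hi dD.
  by rewrite -/j -/k in e1 e2; apply/andP; split; lra.
exists (fun x => g (th x - dart_shift d)); split; last first.
  move=> x jx; have [gy thg] := gE _ (val x jx).
  by split=> //=; rewrite thg opprB addrC subrK.
apply: (@within_comp _ _ _ (fun x => th x - dart_shift d) g _ _ cg).
  apply: continuous_subspaceT => x.
  exact: der_continuous (derB (Dth x) (der_cst _ x)).
by move=> x; rewrite /= !in_itv/= => /val; rewrite arc_lo_min arc_hi_max.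
Qed.

Lemma dart_arc_image d : d \in dts -> exists g : R -> (R * R) * (R * R),
  {within `[arc_l d.1.1, arc_r d.1.1], continuous g} /\
  dart_arc d = g @` `[arc_l d.1.1, arc_r d.1.1].
Proof.
move=> dD; have [p [cp pE]] := edge_param dD.
exists (@torus R \o (fun x => (x, p x))); split.
  apply: within_torus; apply: within_pair => //.
  by apply: continuous_subspaceT => x; exact: cvg_id.
apply/seteqP; split => z /=.
  move=> [[x y] exy <-]; have [/= jx _ _] := exy.
  by exists x; rewrite /= ?in_itv//= (edge_inj exy (pE x jx)).
by move=> [x]; rewrite in_itv/= => jx <-; exists (x, p x) => //; exact: pE.
Qed.

Lemma dart_arc_connected d : d \in dts -> connected (dart_arc d).
Proof.
move=> /dart_arc_image[g [cg ->]].
by apply: connected_continuous_connected cg; exact: segment_connected.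
Qed.

Lemma dart_arc_closed d : d \in dts -> closed (dart_arc d).
Proof.
move=> /dart_arc_image[g [cg ->]].
apply: compact_closed; first exact: norm_hausdorff.
by apply: continuous_compact cg _; exact: segment_compact.
Qed.

Local Notation dbe := (dart_be germ_ga germ_up).
Local Notation dal := (dart_al germ_al).

Lemma dbe_in d : d \in dts -> dbe d \in dts.
Proof.
exact: dart_be_in germ_gaK germ_par_sym germ_par_trans germ_par_ga
  germ_fold_unique d.
Qed.

Lemma dal_in d : d \in dts -> dal d \in dts.
Proof. exact: dart_al_in germ_alK germ_up_al germ_par_al' d. Qed.

Lemma spec_par_iff x y : par_angle (th x) (th y) -> spec x <-> spec y.
Proof.
move=> p; split=> sx; apply: spec_par sx _ => //; by rewrite par_angle_sym.
Qed.

Lemma arc_interior_or_end j x : arc_l j <= x <= arc_r j ->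
  arc_l j < x < arc_r j \/ exists e, x = germ_pt (j, e).
Proof.
move=> /andP[jx xj].
have [xl|xl] := eqVneq x (arc_l j); first by right; exists false.
have [xr|xr] := eqVneq x (arc_r j); first by right; exists true.
by left; rewrite !lt_neqAle jx xj xr eq_sym xl.
Qed.

Lemma germ_up_inj (h k : germ) : h.1 = k.1 -> germ_up h = germ_up k -> h = k.
Proof.
case: h k => [j a] [k b] /= <-; rewrite !germ_upE /=.
by case: a b => -[] // /eqP; case: (arc_inc j).
Qed.

Definition germ_low j : germ := (j, ~~ arc_inc j).

Lemma germ_low_up j : germ_up (germ_low j).
Proof. by rewrite germ_upE /=; case: (boolP (arc_inc j)) => // ->. Qed.

(** Either both coordinates are inside arcs, and [arc_match] places the pair on the edge from the
    low ends, or both are cut points and germs with equal labels have to be chosen there. *)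
Lemma off_diag_cover z : off_diag z -> exists2 d, d \in dts & dart_arc d z.
Proof.
move=> [[a b] [/= nab pab] <-].
have [j [x [/andP[jx xj] ax]]] := arc_cover a.
have [k [y [/andP[ky yk] bk]]] := arc_cover b.
have pxy : par_angle (th x) (th y).
  apply: par_angle_trans (circ_par bk); apply: par_angle_trans pab.
  exact/circ_par/esym.
have nxy : circ x <> circ y by move=> e; apply: nab; rewrite ax bk.
rewrite (torus_eq ax bk).
have sxy := spec_par_iff pxy.
have spec_end j' e : spec (germ_pt (j', e)) by exact: germ_spec.
have jx' : arc_l j <= x <= arc_r j by rewrite jx ltW.
have ky' : arc_l k <= y <= arc_r k by rewrite ky ltW.
have [xi|[e xE]] := arc_interior_or_end jx'.
  have yi : arc_l k < y < arc_r k.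
    have [//|[e yE]] := arc_interior_or_end ky'.
    by case: (arc_not_spec xi); apply/sxy; rewrite yE.
  exists (germ_low j, germ_low k).
    have m := arc_match xi yi pxy.
    rewrite inE; apply/and3P; split => /=; rewrite ?germ_low_up//.
      rewrite /germ_par (germ_pt_up (germ_low_up j)).1 (germ_pt_up (germ_low_up k)).1.
      by rewrite /par_angle -m.
    apply/eqP => -[jk _]; apply: nxy; congr circ; apply: (arc_par_inj xi) pxy.
    by rewrite jk.
  exists (x, y) => //; split => //=.
  rewrite (arc_match xi yi pxy) /dart_shift /=.
  by rewrite (germ_pt_up (germ_low_up j)).1 (germ_pt_up (germ_low_up k)).1.
have sx : spec x by rewrite xE.
have [yi|[e' yE]] := arc_interior_or_end ky'.
  by case: (arc_not_spec yi); apply/sxy.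
have key (h g : germ) : circ (germ_pt h) = circ x -> circ (germ_pt g) = circ y ->
    germ_up h = germ_up g -> exists2 d, d \in dts & dart_arc d (torus (x, y)).
  move=> hx gy u; exists (h, g); last first.
    by rewrite -(torus_eq hx gy); exact: dart_arc_pt (h, g).
  rewrite inE; apply/and3P; split; rewrite /= ?u//.
    apply: par_angle_trans (circ_par hx) _; apply: par_angle_trans pxy _.
    exact/circ_par/esym.
  by apply/eqP => hg; apply: nxy; rewrite -hx -gy hg.
pose h : germ := (j, e); pose g : germ := (k, e').
have hx : circ (germ_pt h) = circ x by rewrite xE.
have gy : circ (germ_pt g) = circ y by rewrite yE.
have [u|u] := eqVneq (germ_up h) (germ_up g); first exact: key hx gy u.
(* The labels differ; at an end that is not a fold, passing to the other germ changes its label and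
   repairs this. *)
have [fh|fh] := boolP (fold germ_ga germ_up h); last first.
  apply: (key (germ_ga h) g) => //; first by rewrite circ_germ_ga.
  by move: fh u; rewrite /fold; case: (germ_up _) (germ_up h) (germ_up g) => -[] [].
have [fg|fg] := boolP (fold germ_ga germ_up g); last first.
  apply: (key h (germ_ga g)) => //; first by rewrite circ_germ_ga.
  by move: fg u; rewrite /fold; case: (germ_up (germ_ga g)) (germ_up h) (germ_up g) => -[] [].
(* Two parallel inflexions would be the same point of the circle. *)
case: nxy; rewrite -hx -gy; apply: infl_unique; try exact/germ_foldP.
by apply: par_angle_trans (circ_par hx) _; apply: par_angle_trans pxy _; exact/circ_par/esym.
Qed.

Lemma edge_off_diag d x y : d \in dts -> edge d (x, y) ->
  arc_l d.1.1 < x < arc_r d.1.1 -> off_diag (torus (x, y)).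
Proof.
move=> dD exy xi; exists (x, y) => //; split; last exact: (edge_par dD exy).
move=> /= cxy; have [_ /= ky _] := exy.
have [jk _] := arc_interior_unique xi ky cxy.
by have [_ u n] := dartP dD; apply: n; exact: germ_up_inj.
Qed.

Lemma dart_arc_Sig d : d \in dts -> dart_arc d `<=` Sig.
Proof.
move=> dD z [[x y] exy <-]; have [/= jx _ _] := exy.
have [p [cp pE]] := edge_param dD.
set l := arc_l d.1.1 in jx cp pE; set r := arc_r d.1.1 in jx cp pE.
have lr : l < r by exact: arc_lr.
pose g := @torus R \o (fun x => (x, p x)).
have cg : {within `[l, r], continuous g}.
  apply: within_torus; apply: within_pair => //.
  by apply: continuous_subspaceT => u; exact: cvg_id.
have -> : y = p x by apply: edge_inj exy (pE x jx).
move=> B Bz; move/subspace_continuousP : cg => /(_ x).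
rewrite /= in_itv/= jx => /(_ isT B Bz); rewrite /nbhs/= /within/= => -[e /= e0 eB].
(* An end of the arc may lie on the diagonal and belong to Sigma only as a limit: moving [x] towards
   the midpoint by the proportion [t] lands strictly inside the arc and within [e]. *)
pose m := (l + r) / 2; pose t := Num.min (e / (2 * (r - l))) 1.
have t0 : 0 < t by rewrite lt_min ltr01 andbT divr_gt0// mulr_gt0//; lra.
have t1 : t <= 1 by rewrite ge_min lexx orbT.
have te : t * (r - l) <= e / 2.
  have : t <= e / (2 * (r - l)) by rewrite ge_min lexx.
  rewrite ler_pdivlMr; last by rewrite mulr_gt0//; lra.
  by rewrite mulrCA ler_pdivlMr// mulrC.
pose u := x + t * (m - x).
have ulr : l < u < r.
  have mx : l < m < r by rewrite /m; apply/andP; split; lra.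
  move: jx mx => /andP[x1 x2] /andP[m1 m2].
  have -> : u = (1 - t) * x + t * m by rewrite /u; ring.
  have h1 : (1 - t) * l <= (1 - t) * x by rewrite ler_wpM2l//; lra.
  have h2 : (1 - t) * x <= (1 - t) * r by rewrite ler_wpM2l//; lra.
  have h3 : t * l < t * m by rewrite ltr_pM2l.
  have h4 : t * m < t * r by rewrite ltr_pM2l.
  by apply/andP; split; lra.
have ue : `|x - u| < e.
  have -> : x - u = - (t * (m - x)) by rewrite /u; ring.
  rewrite normrN normrM gtr0_norm//.
  have : `|m - x| <= r - l by rewrite ler_norml /m; move: jx => /andP[? ?]; apply/andP; split; lra.
  move=> /(ler_wpM2l (ltW t0)) h; lra.
have ulr' : l <= u <= r by move: ulr => /andP[? ?]; rewrite !ltW.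
exists (g u); split; last by apply: (eB u) => //; rewrite in_itv/=.
by apply: (edge_off_diag dD (pE u ulr')).
Qed.

Lemma Sig_cover z : Sig z -> exists2 d, d \in dts & dart_arc d z.
Proof.
pose U := \bigcup_(d in [set d | d \in dts]) dart_arc d.
have cU : closed U.
  by apply: closed_bigcup => [|d dD]; [exact: finite_finset|exact: dart_arc_closed].
move=> /(closure_subset (B := U)); rewrite -(closure_id U).1// => H.
have [|d dD dz] := H; last by exists d.
by move=> x /off_diag_cover[d dD dz]; exists d.
Qed.

Lemma edge_end d x y : d \in dts -> edge d (x, y) -> spec x ->
  exists2 d1, d1 = d \/ d1 = dal d & x = germ_pt d1.1 /\ y = germ_pt d1.2.
Proof.
move=> dD exy sx; have [/= jx ky _] := exy.
have [xi|[e xE]] := arc_interior_or_end jx; first by case: (arc_not_spec xi).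
exists (if d.1.2 == e then d else dal d); first by case: eqP; [left|right].
have main d1 : edge d1 = edge d -> d1.1 = (d.1.1, e) -> x = germ_pt d1.1 /\ y = germ_pt d1.2.
  move=> ed d1E; have x1 : x = germ_pt d1.1 by rewrite d1E.
  split=> //; have := edge_pt d1; rewrite -x1 ed => e2; exact: edge_inj exy e2.
case: eqP => de; apply: main => //.
- by rewrite -de; case: (d.1).
- by rewrite /edge dart_shift_al.
- by rewrite /dart_al /germ_al /=; congr (_, _); case: (d.1.2) e de {xE} => -[].
Qed.

(** Inside an edge a diagonal pair would force the two arcs, hence the two germs, to coincide. So it
    is an end, where two different germs with the same label share a point, which is a fold. *)
Lemma Sig_par x y : Sig (torus (x, y)) ->
  par_angle (th x) (th y) /\ (circ x = circ y -> infl x).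
Proof.
move=> /Sig_cover[d dD [[a b] eab /torusE[ax bx]]].
have p : par_angle (th a) (th b) by exact: (edge_par dD eab).
split.
  apply: par_angle_trans (circ_par bx); apply: par_angle_trans p.
  exact/circ_par/esym.
move=> xy; have [/= ja kb sh] := eab.
have cab : circ a = circ b by rewrite ax bx.
have [ai|[e aE]] := arc_interior_or_end ja.
  have [jk _] := arc_interior_unique ai kb cab.
  by have [_ u n] := dartP dD; case: n; exact: germ_up_inj.
have sa : spec a by rewrite aE; exact: germ_spec.
have [d1 d1d [a1 b1]] := edge_end dD eab sa.
have d1D : d1 \in dts by case: d1d => ->; [|exact: dal_in].
have [_ u n] := dartP d1D.
apply: (circ_infl ax); rewrite a1; apply/germ_foldP.
have : circ (germ_pt d1.1) = circ (germ_pt d1.2) by rewrite -a1 -b1.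
by move=> /germ_vertexP[e1|e1]; [case: n|rewrite /fold -e1 u].
Qed.

(** Each coordinate belongs to two germs, which gives four candidates; equal labels and distinct
    germs leave only [d] and its image by [dart_be]. *)
Lemma dart_pt_eq d d' : d \in dts -> d' \in dts -> dart_pt d = dart_pt d' ->
  d' = d \/ d' = dbe d.
Proof.
move=> dD d'D /torusE[/germ_vertexP c1 /germ_vertexP c2].
have [p u n] := dartP dD; have [_ u' n'] := dartP d'D.
have ff := dart_folds germ_fold_unique dD.
case: d d' dD d'D p u n u' n' c1 c2 ff => [h k] [h' k'] /= _ _ p u n u' n' c1 c2 ff.
have upE g : (germ_up (germ_ga g) == germ_up g) = fold germ_ga germ_up g by [].
case: c1 c2 => -> [] -> in u' n' *; first by left.
- right; have fk : fold germ_ga germ_up k by rewrite -upE -u' u.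
  rewrite /dart_be /= fk implybT /=.
  have [fh|//] := boolP (fold germ_ga germ_up h).
  by case: n'; rewrite ff ?fh ?fk//= germ_gaK.
- right; have fh : fold germ_ga germ_up h by rewrite -upE u' u.
  rewrite /dart_be /= fh implybT /=.
  have [fk|//] := boolP (fold germ_ga germ_up k).
  by case: n'; rewrite ff ?fh ?fk.
- right; rewrite /dart_be /=.
  have -> : fold germ_ga germ_up h = fold germ_ga germ_up k by rewrite -!upE u' u.
  by rewrite implybb.
Qed.

Lemma dart_pt_be d : dart_pt (dbe d) = dart_pt d.
Proof.
by apply: torus_eq; rewrite /dart_be /=; case: ifP => _; rewrite ?circ_germ_ga.
Qed.

Local Notation dorbit := (dart_orbit germ_al germ_ga germ_up).

(** An interior point determines its arc, hence the dart up to its end; at an end both darts, after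
    [dart_al] if needed, start at the same point and [dart_pt_eq] applies. *)
Lemma dart_arc_meet d d' z : d \in dts -> d' \in dts -> dart_arc d z ->
  dart_arc d' z -> d' \in dorbit d.
Proof.
move=> dD d'D [[x y] exy <-] [[x' y'] exy' /esym/torusE[cx cy]].
have [/= jx ky _] := exy; have [/= jx' ky' _] := exy'.
have [p u n] := dartP dD; have [p' u' n'] := dartP d'D.
have pxy : par_angle (th x) (th y) := edge_par dD exy.
have al_or a b : a = b \/ a = dal b -> b = a \/ b = dal a.
  by case=> ->; [left|right]; rewrite ?dart_alK//; exact: germ_alK.
have orb_al a b : a = b \/ a = dal b -> a \in dorbit b.
  by case=> ->; [|apply: dart_orbit_al]; exact: dart_orbit_refl.
have trans a b c : b \in dorbit a -> c \in dorbit b -> c \in dorbit a.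
  by rewrite !inE; exact: connect_trans.
have [xi|[e xE]] := arc_interior_or_end jx.
  have [jj _] := arc_interior_unique xi jx' cx.
  have yi : arc_l d.2.1 < y < arc_r d.2.1.
    have [//|[e yE]] := arc_interior_or_end ky.
    by case: (arc_not_spec xi); apply/(spec_par_iff pxy); rewrite yE; exact: germ_spec.
  have [kk _] := arc_interior_unique yi ky' cy.
  apply: orb_al; have [u1|u1] := eqVneq (germ_up d.1) (germ_up d'.1).
    left; have e1 := germ_up_inj jj u1.
    have e2 : d.2 = d'.2 by apply: germ_up_inj kk _; rewrite -u u1.
    by rewrite (surjective_pairing d') -e1 -e2 -surjective_pairing.
  right; rewrite /dart_al (surjective_pairing d'); congr (_, _);
    apply: germ_up_inj => //=; rewrite germ_up_al -?u -?u';
    by case: (germ_up d'.1) (germ_up d.1) u1 => -[].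
have sx : spec x by rewrite xE; exact: germ_spec.
have [d1 d1d [x1 y1]] := edge_end dD exy sx.
have [d1' d1d' [x1' y1']] := edge_end d'D exy' (special_circ_eq sx cx).
have d1D : d1 \in dts by case: d1d => ->; [|exact: dal_in].
have d1D' : d1' \in dts by case: d1d' => ->; [|exact: dal_in].
have e1 : dart_pt d1 = dart_pt d1'.
  by apply: torus_eq; rewrite -?x1 -?x1' -?y1 -?y1'.
apply: (trans _ d1); first exact: orb_al.
apply: (trans _ d1'); last exact/orb_al/al_or.
by case: (dart_pt_eq d1D d1D' e1) => ->; [|apply: dart_orbit_be]; exact: dart_orbit_refl.
Qed.

(** * Connected components of Sigma as orbits of darts *)

Definition comp_darts (C : set ((R * R) * (R * R))) : {set germ * germ} :=
  [set d in dts | `[< C (dart_pt d) >]].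

Lemma comp_dartsP C d : d \in comp_darts C <-> d \in dts /\ C (dart_pt d).
Proof. by rewrite !inE; split => [/andP[? /asboolP]|[-> /asboolP]]. Qed.

Lemma comp_darts_sub C : {subset comp_darts C <= dts}.
Proof. by move=> d /comp_dartsP[]. Qed.

Section Component.
Variable p : (R * R) * (R * R).
Let C := connected_component Sig p.

Lemma comp_dart_arc d z : d \in dts -> dart_arc d z -> C z -> dart_arc d `<=` C.
Proof.
move=> dD dz Cz; rewrite /C (same_connected_component Cz).
apply: connected_component_max => //; first exact: dart_arc_Sig.
exact: dart_arc_connected.
Qed.

Lemma comp_darts_al : {in comp_darts C, forall d, dal d \in comp_darts C}.
Proof.
move=> d /comp_dartsP[dD Cd]; apply/comp_dartsP; split; first exact: dal_in.
apply: (comp_dart_arc dD (dart_arc_pt d) Cd).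
by rewrite -dart_arc_al//; exact: dart_arc_pt.
Qed.

Lemma comp_darts_be : {in comp_darts C, forall d, dbe d \in comp_darts C}.
Proof.
move=> d /comp_dartsP[dD Cd]; apply/comp_dartsP; split; first exact: dbe_in.
by rewrite dart_pt_be.
Qed.

(** The arcs of the orbit and the remaining ones form two closed sets, as finite unions, disjoint by
    [dart_arc_meet]; a component that meets the first stays in it. *)
Lemma comp_darts_orbit d : d \in comp_darts C -> comp_darts C = dorbit d.
Proof.
move=> dC; have [dD Cd] := (comp_dartsP C d).1 dC.
apply/setP => d'; apply/idP/idP; last first.
  by apply: dart_orbit_sub => //; [exact: comp_darts_al|exact: comp_darts_be].
have orbD : {subset dorbit d <= dts}.
  by apply: dart_orbit_sub => // x; [exact: dal_in|exact: dbe_in].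
pose A := \bigcup_(d' in [set d' | d' \in dorbit d]) dart_arc d'.
pose B := \bigcup_(d' in [set d' | (d' \in dts) && (d' \notin dorbit d)]) dart_arc d'.
have cA : closed A.
  apply: closed_bigcup => [|d2 /= /orbD]; first exact: finite_finset.
  exact: dart_arc_closed.
have cB : closed B.
  apply: closed_bigcup => [|d2 /= /andP[d2D _]]; first exact: finite_finset.
  exact: dart_arc_closed.
have AB : A `&` B = set0.
  apply/seteqP; split => // z [[d1 /= d1o z1] [d2 /= /andP[d2D /negP d2o] z2]].
  apply: d2o; have := dart_arc_meet (orbD _ d1o) d2D z1 z2.
  by move: d1o; rewrite !inE; exact: connect_trans.
have CA : C `<=` A.
  apply: (connected_split cA cB AB); first exact: component_connected.
    move=> z /connected_component_sub/Sig_cover[d2 d2D d2z].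
    have [io|no] := boolP (d2 \in dorbit d); [left|right]; exists d2 => //=.
    by rewrite d2D.
  exists (dart_pt d); split=> //; exists d; last exact: dart_arc_pt.
  exact: dart_orbit_refl.
move=> /comp_dartsP[d'D /CA[d1 /= d1o z1]].
have := dart_arc_meet (orbD _ d1o) d'D z1 (dart_arc_pt d').
by move: d1o; rewrite !inE; exact: connect_trans.
Qed.

End Component.

(** * Counting inflexions of the components *)

Local Notation mark := (fun d : germ * germ =>
  dart_fold germ_ga germ_up d && dart_mark germ_ga germ_up snd d).
Local Notation nf := (nfolds germ_ga germ_up snd).

Definition infl_pt : set ((R * R) * (R * R)) :=
  [set z | Sig z /\ exists x y, z = torus (x, y) /\ (infl x \/ infl y)].

Lemma germ_mark_be d : d \in dts -> dart_fold germ_ga germ_up d ->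
  dart_mark germ_ga germ_up snd (dbe d) = ~~ dart_mark germ_ga germ_up snd d.
Proof.
by apply: (dart_mark_be (par := germ_par)); [exact: germ_gaK|exact: germ_side_ga].
Qed.

Lemma dart_fold_infl d : dart_fold germ_ga germ_up d <->
  infl (germ_pt d.1) \/ infl (germ_pt d.2).
Proof.
rewrite /dart_fold; split => [/orP[]/germ_foldP|[]/germ_foldP ->]; rewrite ?orbT//;
  by [left|right].
Qed.

Lemma infl_pt_dart z : infl_pt z <-> exists d, [/\ d \in dts, mark d & dart_pt d = z].
Proof.
split; last first.
  move=> [d [dD /andP[/dart_fold_infl fd _] <-]]; split.
    exact: dart_arc_Sig dD _ (dart_arc_pt d).
  by exists (germ_pt d.1), (germ_pt d.2).
move=> [/Sig_cover[d dD [[a b] eab <-]] [x [y [/torusE[ax byy] xy]]]].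
have pab : par_angle (th a) (th b) := edge_par dD eab.
have iab : infl a \/ infl b.
  by case: xy => i; [left|right]; apply: circ_infl i; exact/esym.
have sa : spec a.
  by case: iab => /infl_spec // /(spec_par_iff pab).
have [d1 d1d [a1 b1]] := edge_end dD eab sa.
have d1D : d1 \in dts by case: d1d => ->; [|exact: dal_in].
have fd1 : dart_fold germ_ga germ_up d1 by apply/dart_fold_infl; rewrite -a1 -b1.
have z1 : dart_pt d1 = torus (a, b) by rewrite /dart_pt -a1 -b1.
have [m1|m1] := boolP (dart_mark germ_ga germ_up snd d1).
  by exists d1; rewrite fd1 m1.
exists (dbe d1); split; [exact: dbe_in| |by rewrite dart_pt_be].
rewrite dart_fold_be ?fd1//=; last exact: germ_gaK.
by rewrite germ_mark_be.
Qed.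

(** The only other dart at the point of a fold dart is its image by [dart_be], which has the
    opposite mark, so [dart_pt] is injective on marked folds. *)
Lemma card_darts (X : {set germ * germ}) : {subset X <= dts} ->
  dart_pt @` [set d | d \in [set d in X | mark d]%SET] #= `I_(nf X).
Proof.
move=> XD; apply: card_finset => d d'; rewrite !inE.
move=> /andP[dX /andP[fd md]] /andP[dX' /andP[_ md']] e.
case: (dart_pt_eq (XD _ dX) (XD _ dX') e) => [->//|db].
by move: md'; rewrite db germ_mark_be ?md//; exact: XD.
Qed.

Section CountComponent.
Variable p : (R * R) * (R * R).
Let C := connected_component Sig p.

Lemma component_infl : C `&` infl_pt #= `I_(nf (comp_darts C)).
Proof.
have := card_darts (@comp_darts_sub C); congr (is_true (_ #= _)).
apply/seteqP; split => z.
  move=> [d]; rewrite /= inE => /andP[/comp_dartsP[dD Cd] md] <-; split=> //.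
  by apply/infl_pt_dart; exists d.
move=> [Cz /infl_pt_dart[d [dD md dz]]]; exists d => //=.
by rewrite inE md andbT; apply/comp_dartsP; rewrite dz.
Qed.

Lemma component_even : ~~ odd (nf (comp_darts C)).
Proof.
apply: (nfolds_even (al := germ_al) (par := germ_par)).
all: try exact: germ_alK; try exact: germ_gaK; try exact: germ_side_ga;
  try exact: germ_up_al; try exact: germ_fold_unique; try exact: comp_darts_sub;
  try exact: comp_darts_al; try exact: comp_darts_be.
Qed.

Lemma component_diag x : C (torus (x, x)) -> nf (comp_darts C) = 2 %[mod 4].
Proof.
move=> Cx; have Sx : Sig (torus (x, x)) by exact: connected_component_sub Cx.
have ix := (Sig_par Sx).2 erefl.
have /infl_pt_dart[d [dD md dx]] : infl_pt (torus (x, x)).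
  by split=> //; exists x, x; split=> //; left.
have dC : d \in comp_darts C by apply/comp_dartsP; rewrite dx.
rewrite (comp_darts_orbit dC).
have dd : dart_diag germ_ga d.
  have /torusE[e1 e2] : dart_pt d = torus (x, x) by [].
  have [_ u n] := dartP dD.
  have : circ (germ_pt d.1) = circ (germ_pt d.2) by rewrite e1 e2.
  by move=> /germ_vertexP[e|e]; [case: n|rewrite /dart_diag e].
apply: (nfolds_diag (par := germ_par)) dd => //.
all: try exact: germ_alK; try exact: germ_gaK; try exact: germ_side_ga;
  try exact: germ_up_al; try exact: germ_fold_unique; try exact: germ_par_sym;
  try exact: germ_par_trans; try exact: germ_par_ga; try exact: germ_par_al'.
Qed.

End CountComponent.

Let has_diag (C : set ((R * R) * (R * R))) := exists x, C (torus (x, x)).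
Let comp z := connected_component Sig z.

Definition diag_free : {set germ * germ} :=
  [set d in dts | `[< ~ has_diag (comp (dart_pt d)) >]].

Lemma diag_freeP d : d \in diag_free <-> d \in dts /\ ~ has_diag (comp (dart_pt d)).
Proof. by rewrite !inE; split => [/andP[? /asboolP]|[-> /asboolP]]. Qed.

Let sw (z : (R * R) * (R * R)) := (z.2, z.1).

Let sw_continuous : continuous sw.
Proof. by move=> z; exact: (cvg_pair (@cvg_snd _ _ _ _ _) (@cvg_fst _ _ _ _ _)). Qed.

Lemma Sig_swap z : Sig z -> Sig (sw z).
Proof.
move=> Sz B /= Bz.
have [_ [[[a b] [/= nab pab] <-] Bab]] := Sz _ (sw_continuous Bz).
exists (torus (b, a)); split => //; exists (b, a) => //; split => /=.
  exact/nesym.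
by rewrite par_angle_sym.
Qed.

(** The swap is continuous, preserves Sigma and fixes the diagonal, so the image of the component of
    [sw z] is a connected set through [z] with the same diagonal points. *)
Lemma has_diag_swap z : has_diag (comp (sw z)) -> has_diag (comp z).
Proof.
move=> [x cx]; exists x; exists (sw @` comp (sw z)); last by exists (torus (x, x)).
have Sz : Sig (sw z).
  by apply: contrapT => /connected_component_out e; move: cx; rewrite /comp e.
split.
- exists (sw z); last by case: (z).
  exact: connected_component_refl.
- by move=> _ [y /connected_component_sub/Sig_swap ? <-].
- apply: connected_continuous_connected; first exact: component_connected.
  exact: continuous_subspaceT.
Qed.

Lemma comp_al d : d \in dts -> comp (dart_pt (dal d)) = comp (dart_pt d).
Proof.
move=> dD; have Sd := dart_arc_Sig dD (dart_arc_pt d).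
apply/esym/same_connected_component.
apply: (comp_dart_arc dD (dart_arc_pt d)); first exact: connected_component_refl.
by rewrite -dart_arc_al//; exact: dart_arc_pt.
Qed.

Lemma diag_free_count : (4 %| nf diag_free)%N.
Proof.
apply: (nfolds_offdiag (al := germ_al) (par := germ_par)).
all: try exact: germ_alK; try exact: germ_gaK; try exact: germ_side_ga;
  try exact: germ_up_al; try exact: germ_fold_unique; try exact: germ_par_sym;
  try exact: germ_par_trans; try exact: germ_par_ga; try exact: germ_par_al'.
- by move=> d /diag_freeP[].
- move=> d /diag_freeP[dD nd]; apply/diag_freeP; split; first exact: dal_in.
  by rewrite comp_al.
- move=> d /diag_freeP[dD nd]; apply/diag_freeP; split; first exact: dbe_in.
  by rewrite dart_pt_be.
- move=> d /diag_freeP[dD nd]; apply/diag_freeP; split.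
    by apply: dart_sw_in => //; exact: germ_par_sym.
  by move=> h; apply: nd; apply: (@has_diag_swap (dart_pt d)); exact: h.
- move=> d /diag_freeP[dD nd]; apply/negP => /eqP dd; apply: nd.
  exists (germ_pt d.1).
  have -> : torus (germ_pt d.1, germ_pt d.1) = dart_pt d.
    by apply: torus_eq => //; rewrite -dd circ_germ_ga.
  by apply: connected_component_refl; exact: dart_arc_Sig dD _ (dart_arc_pt d).
Qed.

Lemma diag_free_infl :
  [set z | infl_pt z /\ ~ has_diag (comp z)] #= `I_(nf diag_free).
Proof.
have := @card_darts diag_free; have -> : dart_pt @` [set d | d \in
    [set d in diag_free | mark d]%SET] = [set z | infl_pt z /\ ~ has_diag (comp z)].
  apply/seteqP; split => z.
    move=> [d]; rewrite /= inE => /andP[/diag_freeP[dD nd] md] <-; split=> //.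
    by apply/infl_pt_dart; exists d.
  move=> [/infl_pt_dart[d [dD md dz]] nz]; exists d => //=.
  by rewrite inE md andbT; apply/diag_freeP; rewrite dz.
by apply => d /diag_freeP[].
Qed.

(* Each of the N cut points is parallel to exactly one inflexion, so there are N
   pairs with an inflexion on the left and N with one on the right. *)
Lemma infl_pt_card :
  infl_pt #= `I_(2 * N - #|[set i : 'I_N | `[< infl (s i) >]]%SET|).
Proof.
pose I := [set i : 'I_N | `[< infl (s i) >]]%SET.
pose V1 := [set ij : 'I_N * 'I_N | par_angle (th (s ij.1)) (th (s ij.2)) &
  ij.1 \in I]%SET.
pose V2 := [set ij : 'I_N * 'I_N | par_angle (th (s ij.1)) (th (s ij.2)) &
  ij.2 \in I]%SET.
have IP (i : 'I_N) : i \in I <-> infl (s i).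
  by rewrite inE; split => [/asboolP|/asboolP].
have Iu (i j : 'I_N) : i \in I -> j \in I -> par_angle (th (s i)) (th (s j)) -> i = j.
  by move=> /IP ii /IP ij p; apply/val_inj/(circ_s_inj (ltn_ord i) (ltn_ord j))/infl_unique.
have ex (i : 'I_N) : exists k : 'I_N, k \in I /\ par_angle (th (s k)) (th (s i)).
  have [t ti pt] := spec_s (ltn_ord i).
  have [k kN tk] := (specP t).1 (infl_spec ti).
  exists (Ordinal kN); split; first by apply/IP; apply: circ_infl ti.
  rewrite par_angle_sym; apply: par_angle_trans pt _; exact: circ_par.
have {ex} [f fP] := choice ex.
have cV1 : #|V1| = N.
  have -> : V1 = [set (f i, i) | i in [set: 'I_N]]%SET.
    apply/setP => -[i j]; rewrite inE /=; apply/andP/imsetP.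
      move=> [p iI]; exists j; first by rewrite inE.
      have [fI fp] := fP j; suff -> : i = f j by []; apply: Iu => //.
      by apply: par_angle_trans p _; rewrite par_angle_sym.
    by move=> [k _ [-> ->]]; have [fI fp] := fP k.
  by rewrite card_imset ?cardsT ?card_ord// => i j [].
have cV2 : #|V2| = N.
  have -> : V2 = [set (i, f i) | i in [set: 'I_N]]%SET.
    apply/setP => -[i j]; rewrite inE /=; apply/andP/imsetP.
      move=> [p jI]; exists i; first by rewrite inE.
      have [fI fp] := fP i; suff -> : j = f i by []; apply: Iu => //.
      by rewrite par_angle_sym; apply: par_angle_trans fp p.
    by move=> [k _ [-> ->]]; have [fI fp] := fP k; rewrite par_angle_sym.
  by rewrite card_imset ?cardsT ?card_ord// => i j [].
(* Parallel inflexions coincide, so the overlap consists of the diagonal pairs at inflexions. *)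
have cV12 : #|V1 :&: V2| = #|I|.
  have -> : V1 :&: V2 = [set (i, i) | i in I]%SET.
    apply/setP => -[i j]; rewrite !finset.in_setI !inE /=; apply/idP/imsetP.
      move=> /andP[/andP[p iI] /andP[_ jI]].
      have iI' : i \in I by rewrite inE.
      exists i => //; suff -> : j = i by []; apply/esym; apply: Iu => //; by rewrite inE.
    by move=> [k kI [-> ->]]; move: kI; rewrite inE => ->; rewrite par_angle_refl.
  by rewrite card_imset// => i j [].
have <- : #|V1 :|: V2| = (2 * N - #|I|)%N.
  by rewrite cardsU cV1 cV2 cV12 mul2n addnn.
pose F (ij : 'I_N * 'I_N) := torus (s ij.1, s ij.2).
have Finj : {in V1 :|: V2 &, injective F}.
  move=> [i j] [i' j'] _ _ /torusE[/circ_s_inj e1 /circ_s_inj e2].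
  by congr (_, _); apply/val_inj; [apply: e1|apply: e2]; exact: ltn_ord.
have := card_finset Finj; congr (is_true (_ #= _)); apply/seteqP; split => z.
  move=> [[i j]]; rewrite /= finset.in_setU => ij <-.
  have [p ii] : par_angle (th (s i)) (th (s j)) /\ (infl (s i) \/ infl (s j)).
    case/orP: ij; rewrite inE /= => /andP[p /IP ?]; split => //; by [left|right].
  split; last by exists (s i), (s j).
  (* A diagonal pair is not among the points whose closure defines Sigma; it is reached as the end
     of the arc of the dart [(h, germ_ga h)]. *)
  have [e|e] := eqVneq i j.
    rewrite /F -e /=; have {}ii : infl (s i) by case: ii => //; rewrite e.
    pose h : germ := (i, false).
    have fh : fold germ_ga germ_up h by apply/germ_foldP.
    have hD : (h, germ_ga h) \in dts.
      rewrite inE; apply/and3P; split => /=; [exact: germ_par_ga| |].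
        by rewrite eq_sym.
      by apply/eqP => /(congr1 snd) /=.
    have -> : torus (s i, s i) = dart_pt (h, germ_ga h).
      by apply: torus_eq => //; rewrite /= circ_germ_ga.
    exact: dart_arc_Sig hD _ (dart_arc_pt _).
  apply: subset_closure; exists (s i, s j) => //; split => //= c.
  by move/eqP: e; apply; exact/val_inj/(circ_s_inj (ltn_ord i) (ltn_ord j)).
move=> [Sz [x [y [zE xy]]]]; rewrite zE in Sz *.
have [p _] := Sig_par Sz.
have [sx sy] : spec x /\ spec y.
  case: xy => /infl_spec sx; split => //; first exact/(spec_par_iff p).
  exact/(spec_par_iff p).
have [i iN xi] := (specP x).1 sx; have [j jN yj] := (specP y).1 sy.
exists (Ordinal iN, Ordinal jN); last by rewrite /F /=; exact/esym/torus_eq.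
rewrite /= finset.in_setU; apply/orP.
have pij : par_angle (th (s i)) (th (s j)).
  apply: par_angle_trans (circ_par yj); apply: par_angle_trans p; exact/circ_par/esym.
case: xy => ii; [left|right]; rewrite inE /= pij /=; apply/IP => /=.
  exact: circ_infl xi ii.
exact: circ_infl yj ii.
Qed.

End Arcs.

(** * Inflexion points of the branches *)

Section Local.
Variable R : realType.
Implicit Types (x y u : R) (a b g : R -> R) (c : R -> R * R).

Lemma changes_sign_der g x l : der g x l -> g x = 0 -> l != 0 -> changes_sign g x.
Proof.
move=> /is_derive1_caratheodory[q [gq cq qx]] gx l0.
have gE u : g u = q u * (u - x) by rewrite -gq gx subr0.
have lt : \forall u \near x^'-, u < x by exact: nbhs_left_lt.
have gt : \forall u \near x^'+, x < u by exact: nbhs_right_gt.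
move: l0; rewrite neq_lt => /orP[l0|l0]; [right|left]; rewrite -qx in l0.
- have qn := near_lt0 cq l0; split.
    by apply: filterS2 (near_at_left qn) lt => u qu ux; rewrite gE nmulr_rgt0// subr_lt0.
  by apply: filterS2 (near_at_right qn) gt => u qu ux; rewrite gE nmulr_rlt0// subr_gt0.
- have qn := near_gt0 cq l0; split.
    by apply: filterS2 (near_at_left qn) lt => u qu ux; rewrite gE pmulr_rlt0// subr_lt0.
  by apply: filterS2 (near_at_right qn) gt => u qu ux; rewrite gE pmulr_rgt0// subr_gt0.
Qed.

Lemma Ck_smooth_near c k x : (\forall u \near x, smooth_at c u) ->
  Ck k (fun u => (c u).1) x /\ Ck k (fun u => (c u).2) x.
Proof.
elim: k c => // k IH c sc.
have dc : \forall u \near x, derivable c u 1 by apply: filterS sc => u /(_ 0%N).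
have [|C1 C2] := IH (derive1 c).
  by apply: filterS sc => u su n; rewrite -derive1Sn; exact: (su n.+1).
split; split.
- by apply: filterS dc => u /der_fst/der_derivable.
- by apply: Ck_near C1; apply: filterS dc => u /der_fst/der_val.
- by apply: filterS dc => u /der_snd/der_derivable.
- by apply: Ck_near C2; apply: filterS dc => u /der_snd/der_val.
Qed.

Lemma circ_neq_near a b x : {for x, continuous a} -> {for x, continuous b} ->
  circ (a x) <> circ (b x) -> \forall u \near x, circ (a u) <> circ (b u).
Proof.
move=> ca cb nab.
pose q u := (cos (a u) - cos (b u)) ^+ 2 + (sin (a u) - sin (b u)) ^+ 2.
have cq : {for x, continuous q}.
  have cc g : {for x, continuous g} -> {for x, continuous (fun u => cos (g u))}.
    by move=> cg; exact: cvg_comp cg (@continuous_cos R (g x)).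
  have cs g : {for x, continuous g} -> {for x, continuous (fun u => sin (g u))}.
    by move=> cg; exact: cvg_comp cg (@continuous_sin R (g x)).
  have csq g : {for x, continuous g} -> {for x, continuous (fun u => g u ^+ 2)}.
    by move=> cg; exact: cvg_comp cg (@exprn_continuous R 2 (g x)).
  exact: (cvgD (csq _ (cvgB (cc _ ca) (cc _ cb))) (csq _ (cvgB (cs _ ca) (cs _ cb)))).
have q0 : q x != 0.
  apply/eqP => /eqP; rewrite paddr_eq0 ?sqr_ge0// !sqrf_eq0 !subr_eq0.
  by move=> /andP[/eqP e1 /eqP e2]; apply: nab; rewrite /circ e1 e2.
apply: filterS (near_neq0 cq q0) => u /eqP qu [e1 e2]; apply: qu.
by rewrite /q e1 e2 !subrr !expr0n/= addr0.
Qed.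

Lemma der_opp_id x : der (fun u => - u) x (- 1).
Proof. exact: derN (der_id x). Qed.

(* Along a curve (a, b) of parallel pairs, the tangent of the secant map is
   lam times the common direction [th (a u)], so that its curvature has the
   sign of the derivative of [th (a u)]. *)
Section SecantCurve.
Variables (f : R -> R * R) (r th a b : R -> R) (kap : R).
Hypotheses (Cr : forall k s, Ck k r s) (Cth : forall k s, Ck k th s)
  (f'E : forall s, derive1 f s = (r s * cos (th s), r s * sin (th s)))
  (df : forall s, derivable f s 1).
Hypotheses (Ca : \forall u \near (0 : R), Ck 2 a u)
  (Cb : \forall u \near (0 : R), Ck 2 b u)
  (ab : \forall u \near (0 : R), th (a u) - th (b u) = kap) (skap : sin kap = 0).

(** As [sin kap = 0], [cos kap] is 1 or -1 and compares the directions [th (a u)] and [th (b u)];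
    [lam] is the signed speed of the secant along their common line. *)
Let lam u := r (a u) * derive1 a u - cos kap * (r (b u) * derive1 b u).
Let F u := secant f (a u, b u).

Lemma secant_derive1 : \forall u \near (0 : R),
  derive1 F u = (lam u * cos (th (a u)), lam u * sin (th (a u))).
Proof.
apply: filterS3 Ca Cb ab => u Cau Cbu abu.
have Da : der a u (derive1 a u) := Ck_der (CkW Cau).
have Db : der b u (derive1 b u) := Ck_der (CkW Cbu).
have D1 s : der (fun v => (f v).1) s (r s * cos (th s)).
  by have := der_fst (@df s); rewrite f'E.
have D2 s : der (fun v => (f v).2) s (r s * sin (th s)).
  by have := der_snd (@df s); rewrite f'E.
have bE : th (b u) = th (a u) - kap by rewrite -abu subKr.
have cb : cos (th (b u)) = cos kap * cos (th (a u)).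
  by rewrite bE cosB skap mulr0 addr0 mulrC.
have sb : sin (th (b u)) = cos kap * sin (th (a u)).
  by rewrite bE sinB skap mulr0 subr0 mulrC.
rewrite (@derive1_pair _ F u _ _ (derB (der_comp Da (D1 _)) (der_comp Db (D1 _)))
  (derB (der_comp Da (D2 _)) (der_comp Db (D2 _)))).
by rewrite cb sb /lam; congr (_, _); ring.
Qed.

Lemma secant_curvature : lam 0 != 0 ->
  \forall u \near (0 : R), Num.sg (curvature F u) =
    Num.sg (derive1 th (a u) * derive1 a u).
Proof.
move=> lam0.
have Clam : \forall u \near (0 : R), Ck 1 lam u.
  apply: filterS2 Ca Cb => u Cau Cbu.
  have Cra : Ck 1 (fun u => r (a u)) u := Ck_comp (Cr 1 (a u)) (CkW Cau).
  have Crb : Ck 1 (fun u => r (b u)) u := Ck_comp (Cr 1 (b u)) (CkW Cbu).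
  exact: CkD (CkM Cra (Ck_deriv Cau))
    (CkN (CkM (Ck_cst 1 (cos kap) u) (CkM Crb (Ck_deriv Cbu)))).
have clam : {for 0, continuous lam} by have /nbhs_singleton/Ck_cont := Clam.
have near_lam := near_neq0 clam lam0.
apply: filterS3 (filterI Ca Clam) (near_join secant_derive1) near_lam.
move=> u [Cau Clu] F'E lu.
have Da : der a u (derive1 a u) := Ck_der (CkW Cau).
have Dt := der_comp Da (Ck_der (Cth 1 (a u))).
have Dc := der_comp Dt (der_cos _); have Ds := der_comp Dt (der_sin _).
have Dl : der lam u (derive1 lam u) := Ck_der Clu.
have F1 : derive1 F u = (lam u * cos (th (a u)), lam u * sin (th (a u))).
  by have /nbhs_singleton := F'E.
pose G u := (lam u * cos (th (a u)), lam u * sin (th (a u))).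
have F2 : derive1n 2 F u = derive1 G u by exact: derive1_near2 F'E.
have G' := @derive1_pair _ G u _ _ (derM Dl Dc) (derM Dl Ds).
rewrite /curvature F2 G' F1.
set t := th (a u) in Dt Dc Ds F1 G' *; set t' := derive1 th (a u) * derive1 a u.
have e3 : 0 < (enorm (lam u * cos t, lam u * sin t) ^+ 3)^-1.
  rewrite invr_gt0 exprn_gt0// /enorm sqrtr_gt0 /= !exprMn -mulrDr cos2Dsin2 mulr1.
  by rewrite exprn_even_gt0//= lu.
have -> : det2 (lam u * cos t, lam u * sin t)
    (derive1 lam u * cos t + lam u * (- sin t * t'),
     derive1 lam u * sin t + lam u * (cos t * t')) = lam u ^+ 2 * t'.
  rewrite /det2 /=.
  transitivity (lam u ^+ 2 * t' * (cos t ^+ 2 + sin t ^+ 2)); first by ring.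
  by rewrite cos2Dsin2 mulr1.
have l2 : 0 < lam u ^+ 2 by rewrite exprn_even_gt0//= lu.
by rewrite sgrM (gtr0_sg e3) mulr1 sgrM (gtr0_sg l2); exact: mul1r.
Qed.

Lemma secant_regular : derive1 F 0 <> 0 <-> lam 0 <> 0.
Proof.
have /nbhs_singleton -> := secant_derive1; split=> h e; apply: h.
  by rewrite e !mul0r.
case: e => e1 e2.
have : lam 0 ^+ 2 * (cos (th (a 0)) ^+ 2 + sin (th (a 0)) ^+ 2) = 0.
  by rewrite mulrDr -!exprMn e1 e2 expr0n/= addr0.
by rewrite cos2Dsin2 mulr1 => /eqP; rewrite sqrf_eq0 => /eqP.
Qed.

End SecantCurve.
End Local.

(** * Inflexions of a branch as pairs containing an inflexion of the curve *)

Section BranchInflexions.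
Variable R : realType.
Variables (f : R -> R * R) (r th : R -> R).
Implicit Types (x y u : R) (a b g : R -> R) (c : R -> R * R).
Hypotheses (f_smooth : forall s, smooth_at f s)
  (Cr : forall k s, Ck k r s) (Cth : forall k s, Ck k th s)
  (r_neq0 : forall s, r s != 0)
  (f'E : forall s, derive1 f s = (r s * cos (th s), r s * sin (th s))).
Variable infl : R -> Prop.
Hypotheses (infl_w0 : forall x, infl x <-> derive1 th x = 0)
  (infl_w' : forall x, infl x -> derive1 (derive1 th) x != 0)
  (infl_unique : forall x y, infl x -> infl y -> par_angle (th x) (th y) ->
     circ x = circ y)
  (Sig_par : forall x y, Sig th (torus (x, y)) ->
     par_angle (th x) (th y) /\ (circ x = circ y -> infl x)).

Let f_der s : derivable f s 1.
Proof. exact: (@f_smooth s 0%N). Qed.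

Let Dth x : der th x (derive1 th x).
Proof. exact: Ck_der. Qed.

Let Cw k x : Ck k (derive1 th) x.
Proof. exact: Ck_deriv. Qed.

Variable p : (R * R) * (R * R).
Let C := connected_component (Sig th) p.

(** The curvature has the sign of th'(a) a'. If neither coordinate is an inflexion, its vanishing
    forces a' = 0, and the derivative of the constant th(a) - th(b) forces b' = 0, against the
    regularity of the parameterization. *)
Lemma branch_inflexions_sub : branch_inflexions f C `<=` C `&` infl_pt th infl.
Proof.
move=> z [c [c0 cC c'0 F'0 cs]].
have [Cz smc] : C (torus (c 0)) /\ smooth_at c 0 by have /nbhs_singleton := cC.
have Sz : Sig th (torus (c 0)) by exact: connected_component_sub Cz.
rewrite -c0; split => //; split => //.
exists (c 0).1, (c 0).2; split; first by rewrite -surjective_pairing.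
pose a u := (c u).1; pose b u := (c u).2.
have cE u : c u = (a u, b u) by rewrite -surjective_pairing.
have sc : \forall u \near (0 : R), smooth_at c u by apply: filterS cC => u [].
have Ca k : \forall u \near (0 : R), Ck k a u.
  by apply: filterS (near_join sc) => u /(@Ck_smooth_near _ c k)[].
have Cb k : \forall u \near (0 : R), Ck k b u.
  by apply: filterS (near_join sc) => u /(@Ck_smooth_near _ c k)[].
have ca0 : der a 0 (derive1 a 0) by have /nbhs_singleton/Ck_der := Ca 1%N.
have cb0 : der b 0 (derive1 b 0) by have /nbhs_singleton/Ck_der := Cb 1%N.
pose g u := th (a u) - th (b u).
have pg : \forall u \near (0 : R), sin (g u) = 0.
  apply: filterS cC => u [/connected_component_sub + _].
  by rewrite cE => /Sig_par[/eqP].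
have sg0 : sin (g 0) = 0 by have /nbhs_singleton := pg.
have dg := derB (der_comp ca0 (Dth (a 0))) (der_comp cb0 (Dth (b 0))).
have ab : \forall u \near (0 : R), th (a u) - th (b u) = g 0.
  apply: par_angle_locally_cst; first exact: der_continuous dg.
  by apply: filterS pg => u gu; rewrite /par_angle sinB gu sg0 mul0r mulr0 subr0.
have FE : (fun u => secant f (a u, b u)) = secant f \o c.
  by apply/funext => u /=; rewrite -cE.
have /eqP lam0 := (secant_regular f'E f_der (Ca 2%N) (Cb 2%N) ab sg0).1
  (eq_ind_r (fun F => derive1 F 0 <> 0) F'0 FE).
have sgE := secant_curvature Cr Cth f'E f_der (Ca 2%N) (Cb 2%N) ab sg0 lam0.
rewrite FE in sgE.
have {}cs : changes_sign (fun u => derive1 th (a u) * derive1 a u) 0.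
  exact: changes_sign_near sgE cs.
apply: contrapT => /not_orP[na nb].
have wa : derive1 th (a 0) != 0 by apply/eqP => /infl_w0.
have wb : derive1 th (b 0) != 0 by apply/eqP => /infl_w0.
have ca' : der (derive1 a) 0 (derive1 (derive1 a) 0).
  by have /nbhs_singleton/Ck_deriv/Ck_der := Ca 2%N.
have dwa := derM (der_comp ca0 (Ck_der (Cw 1 (a 0)))) ca'.
have /eqP := changes_sign_zero (der_continuous dwa) cs.
rewrite mulf_eq0 (negbTE wa) /= => /eqP a'0.
have g'0 : derive1 th (a 0) * derive1 a 0 - derive1 th (b 0) * derive1 b 0 = 0.
  rewrite -(der_val dg); apply: der_val.
  by apply: der_near (der_cst (g 0) 0); apply: filterS ab => u ->.
have b'0 : derive1 b 0 = 0.
  move/eqP: g'0; rewrite a'0 mulr0 sub0r oppr_eq0 mulf_eq0 (negbTE wb) /=.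
  by move/eqP.
by apply: c'0; rewrite (derive1_pair ca0 cb0) a'0 b'0.
Qed.

Lemma component_near a b : {for 0, continuous a} -> {for 0, continuous b} ->
  (\forall u \near (0 : R), {for u, continuous a}) ->
  (\forall u \near (0 : R), {for u, continuous b}) ->
  (\forall u \near (0 : R), Sig th (torus (a u, b u))) ->
  C (torus (a 0, b 0)) -> \forall u \near (0 : R), C (torus (a u, b u)).
Proof.
move=> ca0 cb0 ca cb S0 C0.
have [e /= e0 eP] := filterI (filterI ca cb) S0.
pose I := `](- e), e[%classic.
have IP u : I u -> ball (0 : R) e u.
  by rewrite /I /= in_itv/= /ball/= sub0r normrN ltr_norml.
have I0 : I 0 by rewrite /I /= in_itv/= oppr_lt0 e0.
have cI : connected I by apply/connected_intervalP; exact: interval_is_interval.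
have cc : {within I, continuous (@torus R \o (fun u => (a u, b u)))}.
  apply: within_torus; apply: within_pair; apply: continuous_in_subspaceT => u;
    by rewrite inE => /IP/eP[[]].
have cK := connected_continuous_connected cI cc.
exists e => //= u ue; rewrite /C (same_connected_component C0).
apply: (connected_component_max _ _ cK).
- by exists 0.
- by move=> _ [v /IP/eP[_ Sv] <-].
- exists u => //; rewrite /I /= in_itv/=.
  by move: ue; rewrite /ball/= sub0r normrN ltr_norml.
Qed.

(** A nonzero speed of the secant at 0 gives regularity of both the secant and the pair (a, b), and
    a simple zero of the derivative of [th (a u)] gives the change of sign. *)
Lemma branch_inflexionI a b kap l :
  (\forall u \near (0 : R), forall k, Ck k a u) ->
  (\forall u \near (0 : R), forall k, Ck k b u) ->
  (\forall u \near (0 : R), th (a u) - th (b u) = kap) -> sin kap = 0 ->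
  (\forall u \near (0 : R), Sig th (torus (a u, b u))) ->
  C (torus (a 0, b 0)) ->
  r (a 0) * derive1 a 0 - cos kap * (r (b 0) * derive1 b 0) != 0 ->
  der (fun u => derive1 th (a u) * derive1 a u) 0 l -> l != 0 ->
  derive1 th (a 0) * derive1 a 0 = 0 ->
  branch_inflexions f C (torus (a 0, b 0)).
Proof.
move=> Ca Cb ab skap Sab Cab lam0 dl l0 z0.
have Ca2 : \forall u \near (0 : R), Ck 2 a u by apply: filterS Ca => u; apply.
have Cb2 : \forall u \near (0 : R), Ck 2 b u by apply: filterS Cb => u; apply.
have Da : der a 0 (derive1 a 0) by have /nbhs_singleton/CkW/Ck_der := Ca2.
have Db : der b 0 (derive1 b 0) by have /nbhs_singleton/CkW/Ck_der := Cb2.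
exists (fun u => (a u, b u)); split => //.
- have cn : \forall u \near (0 : R), C (torus (a u, b u)).
    apply: component_near => //; [exact: der_continuous Da|exact: der_continuous Db| |].
      by apply: filterS Ca2 => u /Ck_cont.
    by apply: filterS Cb2 => u /Ck_cont.
  apply: filterS3 cn Ca Cb => u Cu Cau Cbu; split => //.
  exact: smooth_at_pair.
- rewrite (@derive1_pair _ (fun u => (a u, b u)) 0 _ _ Da Db) => -[a0 b0]; move: lam0.
  by rewrite a0 b0 !mulr0 subr0 eqxx.
- exact: (secant_regular f'E f_der Ca2 Cb2 ab skap).2 (elimN eqP lam0).
- have sgE := secant_curvature Cr Cth f'E f_der Ca2 Cb2 ab skap lam0.
  have cs := changes_sign_der dl z0 l0.
  by apply: changes_sign_near cs; apply: filterS sgE => u ->.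
Qed.

Lemma cos_kap_neq0 (k : R) : sin k = 0 -> cos k != 0.
Proof.
by move=> sk; rewrite -normr_eq0 (eqP (_ : `|cos k| == 1)) ?oner_eq0// norm_cos_eq1 sk.
Qed.

Lemma off_diag_Sig x y : circ x <> circ y -> par_angle (th x) (th y) ->
  Sig th (torus (x, y)).
Proof. by move=> nc pc; apply: subset_closure; exists (x, y). Qed.

Let pi2_gt0 : 0 < pi *+ 2 :> R.
Proof. by rewrite mulrn_wgt0// pi_gt0. Qed.

Let shift_der y : der (fun u => y + u) 0 1.
Proof. by apply: der_eq (derD (der_cst y 0) (der_id 0)) _; rewrite add0r. Qed.

Let shift_Ck k y u : Ck k (fun v => y + v) u.
Proof. by apply: CkD; [exact: Ck_cst|exact: Ck_id]. Qed.

(** [th] is locally invertible at [x], so [g u] can be chosen as the partner of [y + u] that keeps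
    the difference of angles constant. *)
Lemma lift_angle x y : derive1 th x != 0 -> exists g, [/\ g 0 = x,
  \forall u \near (0 : R), th (g u) - th (y + u) = th x - th y,
  \forall u \near (0 : R), forall k, Ck k g u &
  der g 0 ((derive1 th x)^-1 * derive1 th y)].
Proof.
move=> wx.
have Cn : \forall v \near x, forall k, Ck k th v by apply: filterE => v k.
have [q [qx thq Cq Dq]] := local_inverse Cn wx.
pose h u := th (y + u) + (th x - th y).
have h0 : h 0 = th x by rewrite /h addr0 addrC subrK.
have Dh : der h 0 (derive1 th y).
  have Dthy : der th (y + 0) (derive1 th y) by rewrite addr0.
  apply: der_eq (derD (der_comp (shift_der y) Dthy) (der_cst (th x - th y) 0)) _.
  by rewrite mulr1 addr0.
have ch := der_continuous Dh.
exists (fun u => q (h u)); split; first by rewrite h0.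
- apply: filterS (near_continuous_eq ch h0 thq) => u ->.
  by rewrite /h addrAC subrr add0r.
- apply: filterS (near_continuous_eq ch h0 Cq) => u Cqu k.
  apply: (@Ck_comp _ k h q) => //.
  apply: CkD; last exact: Ck_cst.
  by apply: (@Ck_comp _ k (fun v => y + v) th).
- by apply: der_comp Dh _; rewrite h0.
Qed.

(** On the diagonal the Morse form parameterizes the branch; otherwise exactly one coordinate is an
    inflexion, it serves as parameter, and [lift_angle] provides the other one. *)
Lemma branch_inflexions_sup : C `&` infl_pt th infl `<=` branch_inflexions f C.
Proof.
move=> z [Cz [Sz [x [y [zE xy]]]]]; rewrite zE in Cz Sz *.
have [pxy diag] := Sig_par Sz; have /eqP skap := pxy.
have [cxy|cxy] := pselect (circ x = circ y).
  have ix := diag cxy.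
  have zx : torus (x, x) = torus (x, y) by apply: torus_eq.
  rewrite -zx in Cz *.
  pose G u := th (x + u) - th x.
  have CG k u : Ck k G u.
    apply: CkD; last exact: Ck_cst.
    by apply: (@Ck_comp _ k (fun v => x + v) th).
  have DG u : der G u (derive1 th (x + u)).
    have ds : der (fun v => x + v) u 1.
      by apply: der_eq (derD (der_cst x u) (der_id u)) _; rewrite add0r.
    by apply: der_eq (derB (der_comp ds (Dth _)) (der_cst (th x) u)) _; rewrite mulr1 subr0.
  have G'E : derive1 G = (fun u => derive1 th (x + u)).
    by apply/funext => u; exact: der_val (DG u).
  have G''0 : derive1 (derive1 G) 0 = derive1 (derive1 th) x.
    have Dwx : der (derive1 th) (x + 0) (derive1 (derive1 th) x).
      by rewrite addr0; exact: Ck_der.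
    by rewrite G'E (der_val (der_comp (shift_der x) Dwx)) mulr1.
  have [| | |e [g [e0 g0 Gg [Cg [w wg]] [l l0 Dg]]]] := @morse _ G CG.
  - by rewrite /G addr0 subrr.
  - by rewrite G'E addr0; exact/infl_w0.
  - by rewrite G''0; exact: infl_w'.
  have cN : {for 0, continuous (fun u : R => - u)} by exact: der_continuous (der_opp_id 0).
  have nearN (P : R -> Prop) : (\forall u \near (0 : R), P u) ->
      \forall u \near (0 : R), P (- u).
    by move=> h; exact: near_continuous_eq cN (oppr0 R) h.
  (* Both points have the angle [th x + e * u ^+ 2]: they are the two preimages, on either side of
     [x], that the fold identifies. *)
  pose a u := x + g u; pose b u := x + g (- u).
  have Da : der a 0 l.
    by apply: der_eq (derD (der_cst x 0) Dg) _; rewrite add0r.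
  have Db : der b 0 (- l).
    have Dg' : der g (- 0) l by rewrite oppr0.
    apply: der_eq (derD (der_cst x 0) (der_comp (der_opp_id 0) Dg')) _.
    by rewrite add0r mulrN1.
  have a0 : a 0 = x by rewrite /a g0 addr0.
  have b0 : b 0 = x by rewrite /b oppr0 g0 addr0.
  have Ca : \forall u \near (0 : R), forall k, Ck k a u.
    by apply: filterS Cg => u Cgu k; exact: CkD (Ck_cst k x u) (Cgu k).
  have Cb : \forall u \near (0 : R), forall k, Ck k b u.
    apply: filterS (nearN _ Cg) => u Cgu k; apply: CkD; first exact: Ck_cst.
    exact: (@Ck_comp _ k (fun v => - v) g u (Cgu k) (CkN (Ck_id k u))).
  have tha : \forall u \near (0 : R), th (a u) = th x + e * u ^+ 2.
    by apply: filterS Gg => u; rewrite /G /a => <-; rewrite [RHS]addrC subrK.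
  have thb : \forall u \near (0 : R), th (b u) = th x + e * u ^+ 2.
    by apply: filterS (nearN _ Gg) => u; rewrite sqrrN /G /b => <-; rewrite [RHS]addrC subrK.
  have ab : \forall u \near (0 : R), th (a u) - th (b u) = 0.
    by apply: filterS2 tha thb => u -> ->; rewrite subrr.
  have Sab : \forall u \near (0 : R), Sig th (torus (a u, b u)).
    have small : \forall u \near (0 : R), `|a u - b u| < pi *+ 2.
      have cab := der_continuous (derB Da Db).
      have := @cvgr_lt _ _ _ _ _ _ (cvg_norm cab) (pi *+ 2).
      rewrite a0 b0 subrr normr0; apply; exact: pi2_gt0.
    apply: filterS (filterI (filterI wg (nearN _ wg)) (filterI small ab)) => u.
    move=> [[wu wNu] [su abu]].
    have [u0|u0] := eqVneq u 0.
      by rewrite u0 a0 b0 zx.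
    apply: off_diag_Sig; last by rewrite /par_angle abu sin0.
    (* Nearby points that agree on the circle agree on the line, and the left inverse [w] of [g]
       then gives [u = - u]. *)
    move=> /circ_small/(_ su)/addrI gu; move/eqP: u0; apply.
    have : u = - u by rewrite -[LHS]wu gu wNu.
    by move/eqP; rewrite -subr_eq0 opprK -mulr2n mulrn_eq0 => /eqP.
  have Cab : C (torus (a 0, b 0)) by rewrite a0 b0.
  (* Near 0 the product is 2 e u, the derivative of [th x + e * u ^+ 2]. *)
  have dw : der (fun u => derive1 th (a u) * derive1 a u) 0 (e * (1 + 1)).
    have Ca1 : \forall u \near (0 : R), der a u (derive1 a u).
      by apply: filterS Ca => u /(_ 1%N)/Ck_der.
    have eqn : \forall u \near (0 : R), e * (u + u) = derive1 th (a u) * derive1 a u.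
      apply: filterS2 Ca1 (near_join tha) => u Dau thau.
      rewrite -(der_val (der_comp Dau (Dth (a u)))); apply/esym/der_val.
      have d2 : der (fun v => th x + e * v ^+ 2) u (0 + (0 * u ^+ 2 + e * (2 * u ^+ 1))).
        by apply: derD (der_cst _ _) (derM (der_cst _ _) (derX 1 u)).
      apply: der_near (der_eq d2 _); first by apply: filterS thau => v ->.
      by rewrite mul0r !add0r expr1 mulr_natl mulr2n.
    apply: der_near eqn _.
    apply: der_eq (derM (der_cst e 0) (derD (der_id 0) (der_id 0))) _.
    by rewrite mul0r add0r.
  have := @branch_inflexionI a b 0 _ Ca Cb ab (sin0 R) Sab Cab _ dw.
  rewrite a0 b0; apply.
  - rewrite (der_val Da) (der_val Db) cos0 mul1r mulrN opprK -mulr2n mulrn_eq0 /=.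
    by rewrite mulf_neq0.
  - by rewrite mulf_neq0// -mulr2n mulrn_eq0 oner_eq0.
  - by have /infl_w0 -> := ix; rewrite mul0r.
have kap0 := cos_kap_neq0 skap.
have offS a b : a 0 = x -> b 0 = y -> {for 0, continuous a} -> {for 0, continuous b} ->
    (\forall u \near (0 : R), th (a u) - th (b u) = th x - th y) ->
    \forall u \near (0 : R), Sig th (torus (a u, b u)).
  move=> a0 b0 ca cb ab.
  have nc : \forall u \near (0 : R), circ (a u) <> circ (b u).
    by apply: circ_neq_near => //; rewrite a0 b0.
  by apply: filterS2 nc ab => u nu abu; apply: off_diag_Sig => //; rewrite /par_angle abu.
have shift_val v : derive1 (fun u => v + u) 0 = 1 by exact: der_val (shift_der v).
have Csh v : \forall u \near (0 : R), forall k, Ck k (fun w => v + w) u.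
  by apply: filterE => u k.
have Dwsh v : der (fun u => derive1 th (v + u)) 0 (derive1 (derive1 th) v).
  have Dwv : der (derive1 th) (v + 0) (derive1 (derive1 th) v).
    by rewrite addr0; exact: Ck_der.
  by apply: der_eq (der_comp (shift_der v) Dwv) _; rewrite mulr1.
have [ix|nix] := pselect (infl x).
  have wy : derive1 th y != 0.
    by apply/eqP => /infl_w0 iy; apply: cxy; exact: infl_unique.
  have wx : derive1 th x = 0 by exact/infl_w0.
  have [g [g0 thg Cg Dg]] := @lift_angle y x wy.
  pose a u := x + u.
  have a0 : a 0 = x by rewrite /a addr0.
  have ab : \forall u \near (0 : R), th (a u) - th (g u) = th x - th y.
    by apply: filterS thg => u; rewrite /a => h; lra.
  have Sab := offS a g a0 g0 (der_continuous (shift_der x)) (der_continuous Dg) ab.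
  have Cab : C (torus (a 0, g 0)) by rewrite a0 g0.
  have dw : der (fun u => derive1 th (a u) * derive1 a u) 0 (derive1 (derive1 th) x).
    apply: der_near (Dwsh x); apply: filterE => u.
    have -> : derive1 a u = 1.
      by apply: der_val; apply: der_eq (derD (der_cst x u) (der_id u)) _; rewrite add0r.
    by rewrite mulr1.
  have := @branch_inflexionI a g _ _ (Csh x) Cg ab skap Sab Cab _ dw (infl_w' ix).
  rewrite a0 g0; apply; last by rewrite wx mul0r.
  by rewrite shift_val (der_val Dg) wx !mulr0 subr0 mulr1.
have iy : infl y by case: xy.
have wx : derive1 th x != 0 by apply/eqP => /infl_w0.
have wy : derive1 th y = 0 by exact/infl_w0.
have [g [g0 thg Cg Dg]] := @lift_angle x y wx.
pose b u := y + u.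
have b0 : b 0 = y by rewrite /b addr0.
have Sab := offS g b g0 b0 (der_continuous Dg) (der_continuous (shift_der y)) thg.
have Cab : C (torus (g 0, b 0)) by rewrite g0 b0.
(* Since the difference of angles is constant, the angle along [g] has the same derivative as along
   [b]. *)
have dw : der (fun u => derive1 th (g u) * derive1 g u) 0 (derive1 (derive1 th) y).
  apply: der_near (Dwsh y).
  have Cg1 : \forall u \near (0 : R), der g u (derive1 g u).
    by apply: filterS Cg => u /(_ 1%N)/Ck_der.
  apply: filterS2 Cg1 (near_join thg) => u Dgu thgu.
  rewrite -(der_val (der_comp Dgu (Dth (g u)))); apply/esym/der_val.
  have ds : der (fun v => y + v) u 1.
    by apply: der_eq (derD (der_cst y u) (der_id u)) _; rewrite add0r.
  have d2 := derD (der_comp ds (Dth (y + u))) (der_cst (th x - th y) u).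
  apply: der_near (der_eq d2 _); last by rewrite mulr1 addr0.
  by apply: filterS thgu => v <-; rewrite [LHS]addrC subrK.
have := @branch_inflexionI g b _ _ Cg (Csh y) thg skap Sab Cab _ dw (infl_w' iy).
rewrite g0 b0; apply.
- rewrite shift_val (der_val Dg) wy !mulr0 sub0r mulr1 oppr_eq0.
  by rewrite mulf_neq0.
- by rewrite (der_val Dg) wy !mulr0.
Qed.

Lemma branch_inflexionsE : branch_inflexions f C = C `&` infl_pt th infl.
Proof.
by apply/seteqP; split; [exact: branch_inflexions_sub|exact: branch_inflexions_sup].
Qed.

End BranchInflexions.

(** A point of [J] lies in exactly one component, so the disjoint sum over the branches is [J] with
    each point tagged by its component. *)
Lemma total_inflexionsE (R : realType) (f : R -> R * R)
    (J : set ((R * R) * (R * R))) (P : set (set ((R * R) * (R * R)))) :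
  (forall p, Sigma f p -> branch_inflexions f (connected_component (Sigma f) p) =
     connected_component (Sigma f) p `&` J) ->
  J `<=` Sigma f ->
  total_inflexions f (branches f `&` P) =
  (fun z => (connected_component (Sigma f) z, z)) @`
    [set z | J z /\ P (connected_component (Sigma f) z)].
Proof.
move=> bE JS; apply/seteqP; split => -[C z] /=.
  move=> [[[p Sp /= pC] /= PC] /= bi]; rewrite -pC in PC bi *.
  move: bi; rewrite bE// => -[Cz Jz]; have e := same_connected_component Cz.
  by exists z; rewrite -e.
move=> [y [Jy Py] [<- <-]]; have Sy := JS _ Jy.
split; first by split=> //; exists y.
by rewrite bE//; split=> //; exact: connected_component_refl.
Qed.

Theorem theorem3p16 (R : realType) (f : R -> R * R) (n m : nat)
    (f_closed : closed_smooth_curve f)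
    (f_generic : generic f)
    (f0 : ~ inflexion f 0)
    (n_gt0 : (0 < n)%N)
    (card_inflexions : inflexion_set f #= `I_(2 * n)%N)
    (card_S : S_set f #= `I_(2 * m)%N) :
  [/\ total_inflexions f (branches f) #= `I_(4 * m - 2 * n)%N,
      forall C, branches f C ->
        exists2 k : nat, branch_inflexions f C #= `I_k & ~~ odd k,
      forall C, branches f C -> through_origin f C ->
        exists2 k : nat, branch_inflexions f C #= `I_k & (k = 2 %[mod 4])%N &
      exists2 k : nat,
        total_inflexions f (branches f `\` through_origin f) #= `I_k &
        (4 %| k)%N].
Proof.
have f_smooth : forall s, smooth_at f s by case: f_closed.
have f'0 : forall s, derive1 f s <> 0 by case: f_generic.
have [r [th [Cr Cth r0 f'E]]] := polar f_smooth f'0.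
have Dth x : der th x (derive1 th x) := Ck_der (Cth 1%N x).
have wc : continuous (derive1 th) by move=> x; exact: Ck_cont (Ck_deriv (Cth 2%N x)).
have iw := inflexion_w0 f_generic Cr Cth r0 f'E.
have iw' := inflexion_w' f_generic Cr Cth r0 f'E.
have iP := inflexionP Cr Cth r0 f'E.
have cpar := circ_par f_closed r0 f'E.
have cw := circ_w f_closed Cth r0 f'E.
have iu := inflexion_par_circ f_generic r0 f'E.
(* [2 * n] is positive, hence at least 2, and two different inflexions are not parallel by [iu]. *)
have two : exists x y, [/\ inflexion f x, inflexion f y & ~~ par_angle (th x) (th y)].
  move: card_inflexions; rewrite card_eq_sym => /pcard_eqP/bijPex[g [gA ginj _]].
  have h0 : `I_(2 * n)%N 0%N by rewrite /= muln_gt0.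
  have h1 : `I_(2 * n)%N 1%N by rewrite /= (leq_trans _ (leq_pmulr 2 n_gt0)).
  have [x xi xg] := gA _ h0; have [y yi yg] := gA _ h1.
  exists x, y; split => //; apply/negP => /(iu _ _ xi yi); rewrite xg yg.
  by move=> /ginj; rewrite !inE => /(_ h0 h1).
have SE := S_setE f_generic Cr Cth r0 f'E.
have [|s [s_lt s_bound Ss]] := enumerate_circ card_S.
  by rewrite SE => _ [x _ <-]; exists x.
have specP x : (exists2 t, inflexion f t & par_angle (th x) (th t)) <->
    (exists2 i, (i < 2 * m)%N & circ x = circ (s i)).
  split=> [sx|[i iN xi]].
    have : S_set f (circ x) by rewrite SE; exists x.
    by rewrite Ss => -[i iN e]; exists i.
  have : S_set f (circ (s i)) by rewrite Ss; exists i.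
  rewrite SE => -[y sy yi]; apply: (special_circ f_closed r0 f'E sy).
  by rewrite yi.
(* Every inflexion is a cut point, so the inflexions can be counted among the [s i]. *)
have card_I : #|[set i : 'I_(2 * m) | `[< inflexion f (s i) >]]%SET| = (2 * n)%N.
  apply: (card_finset_eq (F := fun i : 'I_(2 * m) => circ (s i))) card_inflexions.
    move=> i j _ _ e; apply/val_inj.
    exact: (circ_s_inj s_lt s_bound (ltn_ord i) (ltn_ord j) e).
  apply/seteqP; split => z.
    move=> [x xi <-].
    have [i iN e] := (specP x).1 (inflexion_special th xi).
    exists (Ordinal iN) => //=; rewrite inE; apply/asboolP.
    exact: (circ_inflexion f_closed f_generic Cr Cth r0 f'E e xi).
  by move=> [i]; rewrite /= inE => /asboolP ii <-; exists (s i).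
have SigE : Sigma f = Sig th.
  congr closure; congr (_ @` _); apply/seteqP; split => -[x y] /= [nc p];
    by split => //; apply/(det_f'_par r0 f'E).
have Sp := Sig_par Dth wc iw iP cpar cw iu two s_lt s_bound specP.
have bE p : Sigma f p -> branch_inflexions f (connected_component (Sigma f) p) =
    connected_component (Sigma f) p `&` infl_pt th (inflexion f).
  by move=> _; rewrite SigE; exact: (branch_inflexionsE f_smooth Cr Cth r0 f'E iw iw' iu Sp).
have JS : infl_pt th (inflexion f) `<=` Sigma f by rewrite SigE => z [].
(* Transversality excludes equal images with parallel tangents unless the parameters agree on the
   circle, so a branch reaches the origin exactly where it meets the diagonal. *)
have originE p : through_origin f (connected_component (Sig th) p) <->
    exists x, connected_component (Sig th) p (torus (x, x)).
  split=> [[[x y] Cxy /eqP]|[x Cx]].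
    rewrite subr_eq0 => /eqP /= fxy; exists x.
    have [pxy _] := Sp _ _ (connected_component_sub Cxy).
    have -> : torus (x, x) = torus (x, y); last by [].
    by apply: torus_eq => //; exact: (par_circ_eq f_generic r0 f'E fxy pxy).
  by exists (x, x) => //; rewrite /secant subrr.
have cnt T (J : set T) k (F : T -> set ((R * R) * (R * R))) : J #= `I_k ->
    (fun z => (F z, z)) @` J #= `I_k.
  by apply: card_eq_trans; apply: inj_card_eq => x y _ _ [].
have comp_card := component_infl Dth wc iw iP cpar cw iu two s_lt s_bound specP.
split.
- have := total_inflexionsE setT bE JS; rewrite setIT => ->.
  apply: cnt.
  have := infl_pt_card Dth wc iw iP cpar cw iu two s_lt s_bound specP.
  rewrite card_I mulnA; congr (is_true (_ #= _)).
  by apply/seteqP; split => z // [].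
- move=> C [p Sgp <-]; rewrite bE// SigE.
  exists (nfolds (@germ_ga (2 * m)) (germ_up th s) snd
    (comp_darts th (2 * m) s (connected_component (Sig th) p))).
    exact: comp_card.
  exact: (component_even Dth wc iw iP cpar cw iu two s_lt s_bound specP).
- move=> C [p Sgp <-]; rewrite bE// SigE => /originE[x Cx].
  exists (nfolds (@germ_ga (2 * m)) (germ_up th s) snd
    (comp_darts th (2 * m) s (connected_component (Sig th) p))).
    exact: comp_card.
  exact: (component_diag Dth wc iw iP cpar cw iu two s_lt s_bound specP Cx).
- rewrite setDE (total_inflexionsE _ bE JS) SigE.
  exists (nfolds (@germ_ga (2 * m)) (germ_up th s) snd (diag_free th (2 * m) s)).
    apply: cnt.
    have := diag_free_infl Dth wc iw iP cpar cw iu two s_lt s_bound specP.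
    congr (is_true (_ #= _)); apply/seteqP; split => z [Jz nz]; split => //;
      by rewrite /setC /= originE in nz *.
  exact: (diag_free_count Dth wc iw iP cpar cw iu two s_lt s_bound specP).
Qed.
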